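(* Let $0<\beta<\alpha<1$ be constants independent of $n$, and let $m=\alpha n$, $k=\beta n$. Let $A$ be an $m\times n$ matrix with i.i.d. standard normal components, and let $\xi_{lric}=\min_{\mathbf{x}\in S_{ric}}\|A\mathbf{x}\|_2$. For $c>0$ let $$\widehat{\gamma}(c)=\frac{2c-\sqrt{4c^2+16\alpha}}{8},\qquad I_{sph}(c,\alpha)=\widehat{\gamma}(c)-\frac{\alpha}{2c}\log\left(1-\frac{c}{2\widehat{\gamma}(c)}\right).$$ For $c>0$, $\gamma$ with $\frac{c}{4\gamma}<\frac12$ (i.e. $\gamma>c/2$) and $\nu\geq 0$ let $$p=\frac{c}{4\gamma},\quad r=-c\nu,\quad C=\frac{e^{r}}{\sqrt{1-2p}},\quad a=2\sqrt{\nu\gamma}\sqrt{1-2p},$$ $$I^{(uric)}(c,\gamma,\nu)=C\,\mathrm{erfc}\left(\frac{a}{\sqrt2}\right)+\left(1-\mathrm{erfc}\left(\sqrt{2\nu\gamma}\right)\right),$$ and $$I_{lric}(c,\beta)=\inf_{\gamma>c/2,\ \nu\geq 0}\left(\nu\beta+\gamma+\frac{1}{c}\log I^{(uric)}(c,\gamma,\nu)\right).$$ Then $$\liminf_{n\rightarrow\infty}\frac{E\,\xi_{lric}}{\sqrt{m}}\geq\frac{1}{\sqrt{\alpha}}\sup_{c>0}\left[-\left(-\frac{c}{2}+I_{lric}(c,\beta)+I_{sph}(c,\alpha)\right)\right].$$ Moreover, let $\xi_{lric}^{(l,lift)}$ be a constant such that $$\frac{1}{\sqrt{\alpha}}\sup_{c>0}\left[-\left(-\frac{c}{2}+I_{lric}(c,\beta)+I_{sph}(c,\alpha)\right)\right]>\xi_{lric}^{(l,lift)}.$$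 Then $$\lim_{n\rightarrow\infty}P\left(\xi_{lric}\geq \xi_{lric}^{(l,lift)}\sqrt{m}\right)=1,$$ and, if $\xi_{lric}^{(l,lift)}\geq 0$, equivalently $$\lim_{n\rightarrow\infty}P\left(\xi_{lric}^2\geq (\xi_{lric}^{(l,lift)})^2 m\right)=1.$$
   Context: $S_{ric}=\{\mathbf{x}\in S^{n-1} : \|\mathbf{x}\|_{\ell_0}=k\}$, where $S^{n-1}$ is the Euclidean unit sphere in $\mathbb{R}^n$ and $\|\mathbf{x}\|_{\ell_0}$ is the number of nonzero components of $\mathbf{x}$. The minimum over $S_{ric}$ is understood as an infimum. The relations $k=\beta n$, $m=\alpha n$ are understood up to rounding to integers (e.g. $k=\lfloor\beta n\rfloor$, $m=\lfloor\alpha n\rfloor$). $\mathrm{erf}(x)=\frac{2}{\sqrt{\pi}}\int_0^x e^{-t^2}dt$ and $\mathrm{erfc}=1-\mathrm{erf}$. The quantity $I^{(uric)}(c,\gamma,\nu)$ equals $E\exp\left(c\max\{\frac{h^2}{4\gamma}-\nu,0\}\right)$ for a standard normal variable $h$. The variables $c,\gamma,\nu$ are written $c_3^{(s)},\gamma_{uric}^{(s)},\nu_{uric}^{(s)}$ in the paper. *)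

(* Defs.v *)
(* MathComp / MathComp-Analysis, over an arbitrary [R : realType]. *)
From HB Require Import structures.
From mathcomp Require Import all_boot all_order all_algebra.
From mathcomp Require Import all_classical all_reals all_analysis.

Set Implicit Arguments.
Unset Strict Implicit.
Unset Printing Implicit Defensive.

Import Order.TTheory GRing.Theory Num.Theory.
Import numFieldNormedType.Exports.

Local Open Scope classical_set_scope.
Local Open Scope ring_scope.

(* Either integer neighbour of a non-integer [x] is allowed, so this covers
   floor, ceiling and nearest-integer conventions alike; an integer [x] can
   only be rounded to itself. *)
Definition rounds_to {R : realType} (x : R) (j : nat) : Prop :=
  `|j%:R - x| < 1.

(* MathComp-Analysis norms matrices by the sup norm, hence this definition. *)
Definition l2norm {R : realType} {n : nat} (x : 'cV[R]_n) : R :=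
  Num.sqrt (\sum_(i < n) x i 0 ^+ 2).

Definition l0norm {R : realType} {n : nat} (x : 'cV[R]_n) : nat :=
  #|[set i : 'I_n | x i 0 != 0]%SET|.

Definition S_ric {R : realType} (n k : nat) : set 'cV[R]_n :=
  [set x | l2norm x = 1 /\ l0norm x = k].

(* [inf] is the real infimum; the set is bounded below by 0, and it is nonempty
   as soon as [1 <= k <= n]. *)
Definition xi_lric {R : realType} {m n : nat} (k : nat) (A : 'M[R]_(m, n)) : R :=
  inf [set l2norm (A *m x) | x in @S_ric R n k].

Definition mutually_independent {R : realType} {d : measure_display}
    {T : measurableType d} {P : probability T R} {I : finType}
    (X : I -> {RV P >-> R}) : Prop :=
  forall (J : {set I}) (B : I -> set R),
    (forall i, i \in J -> measurable (B i)) ->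
    P (\bigcap_(i in [set` J]) (X i @^-1` B i)) =
    (\prod_(i in J) P (X i @^-1` B i))%E.

(* The laws are compared on measurable sets only: off the sigma-algebra the
   values of [distribution] and [normal_prob] are meaningless. *)
Definition iid_std_normal {R : realType} {d : measure_display}
    {T : measurableType d} {P : probability T R} {I : finType}
    (X : I -> {RV P >-> R}) : Prop :=
  mutually_independent X /\
  forall (i : I) (B : set R), measurable B ->
    distribution P (X i) B = normal_prob 0 1 B.

Definition random_mx {R : realType} {d : measure_display}
    {T : measurableType d} {P : probability T R} {m n : nat}
    (A : 'I_m * 'I_n -> {RV P >-> R}) (w : T) : 'M[R]_(m, n) :=
  \matrix_(i, j) A (i, j) w.

(* The difference is the oriented integral from 0 to x: at most one of the two
   intervals is not negligible. *)
Definition erf {R : realType} (x : R) : R :=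
  2 / Num.sqrt pi *
  (Rintegral lebesgue_measure `[0, x] (fun t : R => expR (- t ^+ 2)) -
   Rintegral lebesgue_measure `[x, 0] (fun t : R => expR (- t ^+ 2))).

Definition erfc {R : realType} (x : R) : R := 1 - erf x.

Definition gamma_hat {R : realType} (c alpha : R) : R :=
  (2 * c - Num.sqrt (4 * c ^+ 2 + 16 * alpha)) / 8.

Definition I_sph {R : realType} (c alpha : R) : R :=
  gamma_hat c alpha
  - alpha / (2 * c) * ln (1 - c / (2 * gamma_hat c alpha)).

Definition I_uric {R : realType} (c gamma nu : R) : R :=
  let p := c / (4 * gamma) in
  let r := - (c * nu) in
  let C := expR r / Num.sqrt (1 - 2 * p) in
  let a := 2 * Num.sqrt (nu * gamma) * Num.sqrt (1 - 2 * p) in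
  C * erfc (a / Num.sqrt 2) + (1 - erfc (Num.sqrt (2 * nu * gamma))).

Definition I_lric {R : realType} (c beta : R) : \bar R :=
  ereal_inf [set (q.2 * beta + q.1 + c^-1 * ln (I_uric c q.1 q.2))%:E
            | q in [set q : R * R | c / 2 < q.1 /\ 0 <= q.2]].

Definition lric_lower_bound {R : realType} (alpha beta : R) : \bar R :=
  ((Num.sqrt alpha)^-1%:E *
   ereal_sup [set - ((- (c / 2))%:E + I_lric c beta + (I_sph c alpha)%:E)
             | c in [set c : R | (0 < c)%R]])%E.

(* Main.v *)
Require Import Defs.
From HB Require Import structures.
From mathcomp Require Import all_boot all_order all_algebra.
From mathcomp Require Import all_classical all_reals all_analysis.
From mathcomp Require Import measurable_realfun.
From mathcomp Require Import ring lra.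

Import Order.TTheory GRing.Theory Num.Theory.
Import numFieldNormedType.Exports.

Local Open Scope classical_set_scope.
Local Open Scope ring_scope.

(** The proof follows Gordon's comparison in its lifted (exponential) form.

    Let x_1, ..., x_r be finitely many k-sparse unit vectors and let S = sqrt n.
    Gordon's inequality compares the process |A x_a| + g, where g is an
    additional standard normal variable, with the decoupled process
    |g'| + <h, x_a>, where g' and h are independent standard normal vectors of
    R^m and R^n: the probability that the first one drops below a level at some
    a is at most that of the second one.  If |A x_a| < t for some a, and
    independently g <= - c S, the first process is below t - c S; the price
    of the second event is about expR (- c ^ 2 n / 2)
    ([small_event_bound], [normal_tail_ge]).  For the second process Markov's
    inequality with parameter c S gives

      expR (c S (t - c S)) E expR (- c S |g'|) E expR (c S max_a (- <h, x_a>)).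

    The maximum is bounded by Lagrangian duality with multipliers gamma and nu
    ([sparse_bound]), after which the mean factors over the coordinates of h and
    equals expR (c (k nu + gamma n)) I_uric ^ n ([integral_exp_excess]).  Near
    each radius of a finite grid the norm |g'| is replaced by the parabola
    tangent to it there ([norm_tangent]), whose exponential factors over the
    coordinates of g'; the best radius produces I_sph ([I_sph_ge]).  Altogether

      P (xi < y S) <= K expR (n c (y - c / 2 + I_lric + I_sph + o(1))),

    ([prob_xi_exp]), which tends to 0 when y is below the quantity whose
    supremum over c defines the bound (y corresponds to xi_lift sqrt alpha).
    The passage from finite families to the infimum over all sparse unit
    vectors uses a countable dense family ([dense_family], [prob_xi_le]), and
    the statement about the expectation follows by Markov's inequality
    ([expectation_liminf]).

    Gordon's inequality itself is proved for the smooth functional prodF, a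
    product over a of a C^2 step function of sqrt (1 + |V_a|^2) + w_a - tau
    ([gordon_comparison]); both processes are sums of independent standard
    normal coefficients times fixed directions in the space of all pairs
    (V_a, w_a).  The comparison of two such sums ([lindeberg_comparison]) only
    uses one-dimensional Gaussian integrals: scaling the directions by a small
    e, a second-order Taylor expansion shows that the sum of the second
    derivatives along the directions decides the sign up to O (e ^ 3); since
    smoothing with v is smoothing twice with v / sqrt 2, the comparison at
    scale e propagates to scale 1 with total error O (e).  For prodF the sums of
    second derivatives differ by the nonnegative terms
    rho' rho' (1 - <x_a, x_b>) (1 - <y_a, y_b>) with |y_a| <= 1.  Finally
    [gaussian_law] identifies the iterated one-dimensional smoothing with an
    expectation over the entries of A. *)

Set Implicit Arguments.
Unset Strict Implicit.
Unset Printing Implicit Defensive.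

(** * Gaussian integrals on the line *)

Section gauss1.
Context {R : realType}.
Implicit Types (f g : R -> R).
Local Notation mu := lebesgue_measure.
Local Notation gam := (@normal_prob R 0 1).
Local Notation phi := (@normal_pdf R 0 1).

(** The normal law is the integral of its density, so its Radon-Nikodym
    derivative with respect to the Lebesgue measure is that density almost
    everywhere. *)
Lemma ge0_integral_normale (f : R -> \bar R) :
  measurable_fun setT f -> (forall x, 0 <= f x)%E ->
  (\int[gam]_x f x = \int[mu]_x (f x * (phi x)%:E))%E.
Proof.
move=> mf f0.
have dom := normal_prob_dominates (0 : R) 1.
rewrite -(@Radon_Nikodym_SigmaFinite.change_of_variables _ _ _ (normal_prob (0:R) 1)
  mu dom f)//=.
have mphi : measurable_fun setT (EFin \o phi).
  by apply/measurable_EFinP; exact: measurable_normal_pdf.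
apply: ge0_ae_eq_integral => //.
- apply: emeasurable_funM => //.
  exact: measurable_int (Radon_Nikodym_SigmaFinite.f_integrable _).
- exact: emeasurable_funM.
- by move=> x _; apply: mule_ge0 => //; exact: Radon_Nikodym_SigmaFinite.f_ge0.
- by move=> x _; rewrite mule_ge0// lee_fin normal_pdf_ge0.
apply: ae_eqe_mul2l; apply: integral_ae_eq => //.
- exact: Radon_Nikodym_SigmaFinite.f_integrable.
- by move=> E _ mE; rewrite -Radon_Nikodym_SigmaFinite.f_integral.
Qed.

Lemma ge0_integral_normal f : measurable_fun setT f -> (forall x, 0 <= f x) ->
  (\int[gam]_x (f x)%:E = \int[mu]_x (f x * phi x)%:E)%E.
Proof.
move=> mf f0; rewrite ge0_integral_normale//; exact/measurable_EFinP.
Qed.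

Lemma ge0_integral_affine (a b : R) f : 0 < a -> continuous f ->
  (forall x, 0 <= f x) ->
  (\int[mu]_x (f x)%:E = \int[mu]_x (f (a * x + b) * a)%:E)%E.
Proof.
move=> a0 cf f0; pose F (x : R) := a * x + b.
have dF (x : R) : is_derive x (1 : R) F a.
  by rewrite /F; apply: is_derive_eq; rewrite addr0 /GRing.scale/= mulr1.
have dFE : F^`()%classic = cst a.
  by apply/funext => x; rewrite derive1E; apply: derive_val.
rewrite (@increasing_ge0_integration_by_substitutionT _ F f)//.
- by apply: eq_integral => x _; rewrite /= /GRing.mul/= dFE.
- by move=> x y xy; rewrite /F ltrD2r ltr_pM2l.
- by rewrite dFE => x; exact: cvg_cst.
- by rewrite dFE; exact: is_cvg_cst.
- by rewrite dFE; exact: is_cvg_cst.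
- have h : (fun x : R => x * a) @ -oo --> -oo.
    by apply: (gt0_cvgMlNy a0); exact: cvg_id.
  have -> : F = (fun x => x * a + b) by apply/funext => x; rewrite /F mulrC.
  exact: (cvg_comp _ _ h (cvg_addrr_Ny b)).
- have h : (fun x : R => x * a) @ +oo --> +oo.
    by apply: (gt0_cvgMly a0); exact: cvg_id.
  have -> : F = (fun x => x * a + b) by apply/funext => x; rewrite /F mulrC.
  exact: (cvg_comp _ _ h (cvg_addrr b)).
Qed.

Lemma normal01E (x : R) :
  phi x = (Num.sqrt (pi *+ 2))^-1 * expR (- (x ^+ 2 / 2)).
Proof.
rewrite normal_pdfE ?oner_eq0// /normal_peak /normal_fun expr1n mul1r subr0.
by rewrite mulr2n mulNr.
Qed.

Lemma continuous_phi : continuous phi.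
Proof. exact: continuous_normal_pdf (oner_neq0 _). Qed.

(** The half-line substitution rule, applied to each half of the line. *)
Lemma ge0_integral_reflect f : continuous f -> (forall x, 0 <= f x) ->
  (\int[mu]_x (f (- x))%:E = \int[mu]_x (f x)%:E)%E.
Proof.
move=> cf f0.
have half g : continuous g -> (forall x, 0 <= g x) ->
    (\int[mu]_x (g x)%:E = \int[mu]_(x in `[0%R, +oo[) (g (- x))%:E +
                           \int[mu]_(x in `[0%R, +oo[) (g x)%:E)%E.
  move=> cg g0; have mg := continuous_measurable_fun cg.
  have -> : [set: R] = `]-oo, 0[ `|` `[0, +oo[ by rewrite -setCitvl setUv.
  rewrite ge0_integral_setU//=.
  - congr (_ + _)%E; rewrite integral_itv_bndo_bndc; last exact/measurable_EFinP/measurable_funTS.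
    rewrite -{1}oppr0 ge0_integration_by_substitutionNy//.
    exact: continuous_subspaceT.
  - by apply/measurable_EFinP/measurable_funTS.
  - by move=> x _; rewrite lee_fin.
  - apply/disj_setPS => x [] /=; rewrite !in_itv/= andbT => x0 x1.
    by move: x0; rewrite ltNge x1.
have cN : continuous (f \o -%R).
  by move=> x; apply: continuous_comp; [exact: opp_continuous|exact: cf].
rewrite [RHS]half// (half (f \o -%R))//= addeC; congr (_ + _)%E.
by apply: eq_integral => x _; rewrite opprK.
Qed.

Lemma phiN (x : R) : phi (- x) = phi x.
Proof. by rewrite !normal01E sqrrN. Qed.

Lemma normal_reflect f : continuous f -> (forall x, 0 <= f x) ->
  (\int[gam]_x (f (- x))%:E = \int[gam]_x (f x)%:E)%E.
Proof.
move=> cf f0.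
have cN : continuous (f \o -%R).
  by move=> x; apply: continuous_comp; [exact: opp_continuous|exact: cf].
have mf := continuous_measurable_fun cf.
have mN := continuous_measurable_fun cN.
rewrite !ge0_integral_normal// -[RHS]ge0_integral_reflect.
- by apply: eq_integral => x _; rewrite phiN.
- by move=> x; apply: cvgM; [exact: cf|exact: continuous_phi].
- by move=> x; rewrite mulr_ge0// normal_pdf_ge0.
Qed.

(** The substitution x := sqrt (1 + l) * x turns the integrand into a multiple
    of the normal density.  Negative l are included: l = -1/2 gives the
    exponential moment from which integrability of polynomials follows, and
    positive l gives the factor (1 + l)^(-1/2) contributed by each coordinate of
    a Gaussian vector of R^m. *)
Lemma normal_expquad (l : R) : -1 < l ->
  (\int[gam]_x (expR (- (l * x ^+ 2 / 2)))%:E = ((Num.sqrt (1 + l))^-1)%:E)%E.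
Proof.
move=> l1; have l0 : 0 < 1 + l by rewrite -ltrBlDl sub0r.
have s0 : 0 < Num.sqrt (1 + l) by rewrite sqrtr_gt0.
have ce : continuous (fun x : R => expR (- (l * x ^+ 2 / 2))).
  move=> x; apply: continuous_comp; last exact: continuous_expR.
  apply: cvgN; apply: cvgMl; apply: cvgMr.
  exact: exprn_continuous.
rewrite ge0_integral_normal//; last exact: continuous_measurable_fun.
have := @integral_normal_pdf R 0 1.
rewrite (@ge0_integral_affine (Num.sqrt (1 + l)) 0 phi)//; last 2 first.
- exact: continuous_phi.
- by move=> x; exact: normal_pdf_ge0.
under eq_integral do rewrite addr0 EFinM muleC.
rewrite ge0_integralZl//; last 2 first.
- apply/measurable_EFinP/measurableT_comp; first exact: measurable_normal_pdf.
  exact: measurable_funM.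
- by move=> x _; rewrite lee_fin normal_pdf_ge0.
move=> h.
have -> : (\int[mu]_x (expR (- (l * x ^+ 2 / 2)) * phi x)%:E =
    \int[mu]_x (phi (Num.sqrt (1 + l) * x))%:E)%E.
  apply: eq_integral => x _; rewrite !normal01E mulrCA -expRD; do 3 congr (_ _).
  by rewrite exprMn sqr_sqrtr ?(ltW l0)//; field.
move: h; move: (integral _ _ _) => [r||] /=.
- by rewrite -EFinM => -[] h; congr EFin; apply: (mulfI (lt0r_neq0 s0)); rewrite h divff// lt0r_neq0.
- by rewrite mulry gtr0_sg// mul1e.
- by rewrite mulrNy gtr0_sg// mul1e.
Qed.

(** Stability of the normal law.  With q = sqrt 2 and t = q u - s the density
    becomes phi (q u - s) phi s, which equals phi u phi (q s - u) because both
    pairs of arguments have the same sum of squares; after Tonelli the integral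
    over s is 1. *)
Lemma normal_halve f : continuous f -> (forall x, 0 <= f x) ->
  (\int[gam]_s \int[gam]_t (f ((Num.sqrt 2)^-1 * (s + t)))%:E =
   \int[gam]_u (f u)%:E)%E.
Proof.
move=> cf f0; set q := Num.sqrt 2.
have q0 : 0 < q by rewrite sqrtr_gt0.
have q2 : q ^+ 2 = 2 by rewrite sqr_sqrtr.
have mf := continuous_measurable_fun cf.
have mphi : measurable_fun setT phi := measurable_normal_pdf 0 1.
have p0 x : 0 <= phi x by exact: normal_pdf_ge0.
have mpa (s : R) : measurable_fun setT (fun u : R => phi (q * u - s)).
  by apply: measurableT_comp => //; apply: measurable_funB => //; exact: measurable_funM.
have inner s : (\int[gam]_t (f (q^-1 * (s + t)))%:E =
    \int[mu]_u (f u * phi (q * u - s) * q)%:E)%E.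
  have c1 : continuous (fun t => f (q^-1 * (s + t))).
    move=> t; apply: (@continuous_comp _ _ _ (fun t => q^-1 * (s + t))); last exact: cf.
    by apply: cvgMr; apply: cvgD; [exact: cvg_cst|exact: cvg_id].
  rewrite ge0_integral_normal//; last exact: continuous_measurable_fun.
  rewrite (@ge0_integral_affine q (- s) (fun t => f (q^-1 * (s + t)) * phi t))//.
  - apply: eq_integral => u _.
    by have -> : q^-1 * (s + (q * u - s)) = u by rewrite addrC subrK mulKf// gt_eqF.
  - by move=> t; apply: cvgM; [exact: c1|exact: continuous_phi].
  - by move=> t; rewrite mulr_ge0.
have -> : (\int[gam]_s \int[gam]_t (f (q^-1 * (s + t)))%:E =
    \int[gam]_s \int[mu]_u (f u * phi (q * u - s) * q)%:E)%E.
  by apply: eq_integral => s _; exact: inner.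
have mK : measurable_fun setT (fun z : R * R => (f z.2 * phi (q * z.2 - z.1) * q)%:E).
  apply/measurable_EFinP; apply: measurable_funM => //; apply: measurable_funM.
    exact: measurableT_comp.
  apply: measurableT_comp => //; apply: measurable_funB => //.
  exact: measurable_funM.
rewrite ge0_integral_normale; last 2 first.
- have hK z : (0 <= (f z.2 * phi (q * z.2 - z.1) * q)%:E)%E.
    by rewrite lee_fin !mulr_ge0// ltW.
  exact: (@measurable_fun_fubini_tonelli_F _ _ _ _ _ mu _ mK hK).
- by move=> s; apply: integral_ge0 => u _; rewrite lee_fin !mulr_ge0// ltW.
have -> : (\int[mu]_x (\int[mu]_u (f u * phi (q * u - x) * q)%:E * (phi x)%:E) =
    \int[mu]_x (\int[mu]_u (f u * phi u * (phi (q * x - u) * q))%:E))%E.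
  apply: eq_integral => s _; rewrite -ge0_integralZr//=.
  - apply: eq_integral => u _; rewrite -EFinM; congr EFin.
    suff h : phi (q * u - s) * phi s = phi u * phi (q * s - u).
      transitivity (f u * q * (phi (q * u - s) * phi s)); first by ring.
      by rewrite h; ring.
    rewrite !normal01E; set k := (Num.sqrt _)^-1.
    rewrite mulrACA [RHS]mulrACA -!expRD; congr (_ * expR _).
    rewrite !sqrrB !exprMn q2; ring.
  - have mc : measurable_fun [set: R] (fun=> q) by exact: measurable_cst.
    by apply/measurable_EFinP; exact: (measurable_funM (measurable_funM mf (mpa s)) mc).
  - by move=> u _; rewrite lee_fin !mulr_ge0// ltW.
  - by rewrite lee_fin.
have mK2 : measurable_fun setT (fun z : R * R => (f z.2 * phi z.2 * (phi (q * z.1 - z.2) * q))%:E).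
  apply/measurable_EFinP; apply: measurable_funM => //.
    by apply: measurable_funM; exact: measurableT_comp.
  apply: measurable_funM => //.
  apply: measurableT_comp => //; apply: measurable_funB => //.
  exact: measurable_funM.
rewrite (@fubini_tonelli _ _ _ _ _ mu mu _ mK2)/=; last first.
  by move=> z; rewrite lee_fin !mulr_ge0// ltW.
rewrite ge0_integral_normal//; apply: eq_integral => u _.
under eq_integral do rewrite EFinM.
rewrite ge0_integralZl//; last 3 first.
- have mc : measurable_fun [set: R] (fun=> q) by exact: measurable_cst.
  by apply/measurable_EFinP; exact: (measurable_funM (mpa u) mc).
- by move=> x _; rewrite lee_fin !mulr_ge0// ltW.
- by rewrite lee_fin mulr_ge0.
rewrite -(@ge0_integral_affine q (- u) phi)//.
  by rewrite integral_normal_pdf mule1.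
exact: continuous_phi.
Qed.

(** The dominating function is a multiple of expR (x ^ 2 / 4), which is at
    least (1 + x ^ 2 / 8) ^ 2, hence at least (1 + x ^ 4) / 64. *)
Lemma normal_integrable_poly f (C : R) : measurable_fun setT f ->
  (forall x, `|f x| <= C * (1 + x ^+ 4)) -> gam.-integrable setT (EFin \o f).
Proof.
move=> mf fC.
have C0 : 0 <= C.
  by have := le_trans (normr_ge0 _) (fC 0); rewrite expr0n addr0 mulr1.
have me : measurable_fun [set: R] (fun x : R => expR (- ((- 2^-1) * x ^+ 2 / 2))).
  apply: measurableT_comp => //; apply: measurableT_comp => //.
  apply: measurable_funM => //; apply: measurable_funM => //.
have ie : gam.-integrable setT (EFin \o (fun x => expR (- ((- 2^-1) * x ^+ 2 / 2)))).
  apply/integrableP; split; first exact/measurable_EFinP.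
  under eq_integral do rewrite /= ger0_norm ?expR_ge0//.
  by rewrite normal_expquad ?ltry//; lra.
apply: (@le_integrable _ _ _ gam _ measurableT _
  (EFin \o (fun x => (C * 64) * expR (- ((- 2^-1) * x ^+ 2 / 2))))).
- exact/measurable_EFinP.
- move=> x _; rewrite lee_fin (le_trans (fC x))// ger0_norm; last first.
    by rewrite !mulr_ge0// expR_ge0.
  rewrite -mulrA ler_wpM2l//.
  have -> : - ((- 2^-1) * x ^+ 2 / 2) = x ^+ 2 / 8 + x ^+ 2 / 8 by field.
  rewrite expRD.
  have h : 1 + x ^+ 2 / 8 <= expR (x ^+ 2 / 8) := expR_ge1Dx _.
  have h0 : 0 <= 1 + x ^+ 2 / 8 by nra.
  have h1 := ler_pM h0 h0 h h.
  have x2 := sqr_ge0 x.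
  have -> : x ^+ 4 = x ^+ 2 * x ^+ 2 by ring.
  nra.
- exact: (integrableZl measurableT (C * 64) ie).
Qed.

Lemma integrable_id01 : gam.-integrable setT (EFin \o (fun s : R => s)).
Proof.
apply: (@normal_integrable_poly _ 1) => // x; rewrite mul1r.
case: (lerP `|x| 1) => h; first by rewrite (le_trans h)// lerDl (exprM x 2 2) sqr_ge0.
apply: (@le_trans _ _ (`|x| ^+ 4)); first by rewrite ler_eXnr// ltW.
by rewrite -normrX ger0_norm ?lerDr// (exprM x 2 2) sqr_ge0.
Qed.

(** Symmetry, applied to the nonnegative function `|s| + s because
    [normal_reflect] is stated for nonnegative integrands. *)
Lemma Rintegral_normal_id : \int[gam]_s s = 0 :> R.
Proof.
have cn : continuous (fun s : R => `|s|) by exact: norm_continuous.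
have ip := integrable_id01.
have ia : gam.-integrable setT (EFin \o (fun s : R => `|s|)).
  by apply: (@integrable_abse _ _ _ gam setT (EFin \o (fun s : R => s))).
have h : \int[gam]_s (`|s| + s) = \int[gam]_s (`|s| - s) :> R.
  rewrite /Rintegral; congr fine; rewrite -[RHS]normal_reflect.
  - by apply: eq_integral => x _; rewrite normrN opprK.
  - by move=> x; apply: cvgB; [exact: cn|exact: cvg_id].
  - by move=> x; rewrite subr_ge0 ler_norm.
move: h; rewrite RintegralD// RintegralB//.
move/addrI => h; apply/eqP; rewrite -[_ == _](mulrn_eq0 _ 2) mulr2n.
by rewrite {1}h addNr.
Qed.

(** Kept as a symbol: in the comparison both families of directions carry the
    same factor var01 / 2. *)
Definition var01 : R := \int[gam]_s (s ^+ 2).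
Definition abs3 : R := \int[gam]_s (`|s| ^+ 3).

Lemma integrable_sqr01 : gam.-integrable setT (EFin \o (fun s : R => s ^+ 2)).
Proof.
apply: (@normal_integrable_poly _ 1) => [|x]; first exact: measurable_funX.
rewrite mul1r ger0_norm ?sqr_ge0// (exprM x 2 2).
have := sqr_ge0 (x ^+ 2 - 1); nra.
Qed.

Lemma integrable_abs3 : gam.-integrable setT (EFin \o (fun s : R => `|s| ^+ 3)).
Proof.
apply: (@normal_integrable_poly _ 1) => [|x].
  apply: (measurable_funX 3); exact: normr_measurable.
rewrite mul1r ger0_norm ?exprn_ge0//.
have -> : x ^+ 4 = `|x| ^+ 4 by rewrite -normrX ger0_norm// (exprM x 2 2) sqr_ge0.
have := normr_ge0 x; move: `|x| => y y0.
case: (lerP y 1) => h.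
  by rewrite (@le_trans _ _ 1)// ?exprn_ile1// lerDl exprn_ge0.
by rewrite (@le_trans _ _ (y ^+ 4))// ?lerDr// ler_eXn2l// ltW.
Qed.

Lemma var01_ge0 : 0 <= var01.
Proof. by apply: Rintegral_ge0 => x _; exact: sqr_ge0. Qed.

End gauss1.

(** * Integrals against a probability measure *)

Section prob_integral.
Context {R : realType} {d : measure_display} {T : measurableType d}
  {P : probability T R}.

Lemma integrable_bounded_prob (f : T -> R) (B : R) : measurable_fun setT f ->
  (forall x, `|f x| <= B) -> P.-integrable setT (EFin \o f).
Proof.
move=> mf fB; apply: measurable_bounded_integrable => //.
  by rewrite (le_lt_trans (probability_le1 P _)) ?ltry.
by exists B; split => [|x Bx y _]; [exact: num_real|apply: (le_trans (fB y)); exact: ltW].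
Qed.

Lemma integrableZr (c : R) (f : T -> R) : P.-integrable setT (EFin \o f) ->
  P.-integrable setT (EFin \o (fun x => c * f x)).
Proof. by move=> h; exact: (integrableZl measurableT c h). Qed.

Lemma Rintegral_indic_prob (A : set T) : measurable A ->
  \int[P]_x \1_A x = fine (P A).
Proof. by move=> mA; rewrite /Rintegral integral_indic// setIT. Qed.

Lemma Rintegral_prob_cst (c : R) : \int[P]_x c = c.
Proof. by rewrite Rintegral_cst// [X in fine X]probability_setT mulr1. Qed.

Lemma Rintegral_sum (I : finType) (f : I -> T -> R) :
  (forall i, P.-integrable setT (EFin \o f i)) ->
  \int[P]_x (\sum_i f i x) = \sum_i \int[P]_x f i x.
Proof.
move=> fi; rewrite /Rintegral; under eq_integral do rewrite -sumEFin.
rewrite integral_sum//= -sum_fine//= => i _.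
exact: (integrable_fin_num measurableT (fi i)).
Qed.

End prob_integral.

(** * Discretisation of the standard normal law *)

Section grid.
Context {R : realType}.
Local Notation gam := (@normal_prob R 0 1).

Definition grid_in (M : nat) (s : R) : bool := (- M%:R <= s) && (s < M%:R).
(** The window [-M, M[ is cut into cells of width 1 / M.  The points outside
    are all sent to the index M * M, whose grid point is 0, so that
    [grid_dist] holds on the whole line. *)
Definition grid_idx (M : nat) (s : R) : 'I_(M * M + M * M).+1 :=
  inord (if grid_in M s then Num.truncn (M%:R * (s + M%:R)) else M * M)%N.
Definition grid_pt {M : nat} (i : 'I_(M * M + M * M).+1) : R :=
  i%:R / M%:R - M%:R.

Lemma grid_idx_in M s : (0 < M)%N -> grid_in M s ->
  (grid_idx M s)%:R <= M%:R * (s + M%:R) < (grid_idx M s).+1%:R.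
Proof.
move=> M0 h; rewrite /grid_idx h; move: h => /andP[h1 h2].
have MR : 0 < M%:R :> R by rewrite ltr0n.
have y0 : 0 <= M%:R * (s + M%:R) by rewrite mulr_ge0//; lra.
have ht := truncn_itv y0.
have hlt : (Num.truncn (M%:R * (s + M%:R)) < (M * M + M * M).+1)%N.
  rewrite ltnS -(ler_nat R) (le_trans (andP ht).1)// natrD natrM.
  by rewrite -mulrDr ler_pM2l// lerD2r ltW.
by rewrite inordK.
Qed.

Lemma grid_idx_out M s : ~~ grid_in M s -> grid_idx M s = (M * M)%N :> nat.
Proof. by move=> /negbTE h; rewrite /grid_idx h inordK// ltnS leq_addr. Qed.

(** Inside the window the error is at most 1 / M; outside it is `|s|, which is
    at most s ^ 2 / M because M <= `|s|. *)
Lemma grid_dist M s : (0 < M)%N ->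
  `|s - grid_pt (grid_idx M s)| <= (1 + s ^+ 2) / M%:R.
Proof.
move=> M0; have MR : 0 < M%:R :> R by rewrite ltr0n.
rewrite /grid_pt ler_pdivlMr//; have s2 := sqr_ge0 s.
case: (boolP (grid_in M s)) => h.
  have /andP[h1 h2] := grid_idx_in M0 h.
  rewrite -[X in _ * X](gtr0_norm MR) -normrM.
  have -> : (s - ((grid_idx M s)%:R / M%:R - M%:R)) * M%:R =
      M%:R * (s + M%:R) - (grid_idx M s)%:R by field; rewrite gt_eqF.
  rewrite ger0_norm ?subr_ge0//; move: h2; rewrite -natr1; lra.
rewrite (grid_idx_out h) natrM mulfK ?gt_eqF// subrr subr0.
apply: (@le_trans _ _ (`|s| * `|s|)); last by rewrite -normrM -expr2 ger0_norm// lerDr.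
rewrite ler_wpM2l//; move: h; rewrite negb_and -ltNge -leNgt ler_normr => /orP[|->//].
by rewrite ltrNr => /ltW ->; rewrite orbT.
Qed.

Lemma measurable_grid M i : (0 < M)%N -> measurable (grid_idx M @^-1` [set i]).
Proof.
move=> M0; have MR : 0 < M%:R :> R by rewrite ltr0n.
set B := [set s : R | (i%:R / M%:R - M%:R <= s) && (s < i.+1%:R / M%:R - M%:R)].
have mB : measurable B.
  by rewrite (_ : B = [set` `[i%:R / M%:R - M%:R, i.+1%:R / M%:R - M%:R[])//; apply/seteqP; split => s /=; rewrite in_itv.
set C := [set s : R | grid_in M s].
have mC : measurable C.
  by rewrite (_ : C = [set` `[- M%:R, M%:R[])//; apply/seteqP; split => s /=; rewrite in_itv.
rewrite (_ : _ @^-1` _ = (C `&` B) `|` (if (i == M * M :> nat)%N then ~` C else set0)); last first.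
  have bnd (s : R) j : (j%:R / M%:R - M%:R <= s) && (s < j.+1%:R / M%:R - M%:R) =
      (j%:R <= M%:R * (s + M%:R) < j.+1%:R).
    by rewrite lerBlDr ltrBrDr ler_pdivrMr// ltr_pdivlMr// ![_ * M%:R]mulrC.
  apply/seteqP; split => s /=.
    move=> ei; case: (boolP (grid_in M s)) => h.
      left; split => //; rewrite /B /= bnd -ei; exact: grid_idx_in.
    by right; rewrite -ei (grid_idx_out h) eqxx /= /C /=; apply/negP.
  case=> [[h]|].
    rewrite /B /= bnd => /andP[b1 b2].
    have /andP[c1 c2] := grid_idx_in M0 h.
    have e1 : (grid_idx M s < i.+1)%N by rewrite -(ltr_nat R) (le_lt_trans c1 b2).
    have e2 : (i < (grid_idx M s).+1)%N by rewrite -(ltr_nat R) (le_lt_trans b1 c2).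
    by apply/val_inj/eqP => /=; rewrite eqn_leq; apply/andP; split.
  case: ifP => // /eqP hi /negP h; apply/val_inj; rewrite /= hi; exact: grid_idx_out.
apply: measurableU; first exact: measurableI.
by case: ifP => // _; exact: measurableC.
Qed.

Definition grid_wt {M : nat} (i : 'I_(M * M + M * M).+1) : R :=
  fine (gam (grid_idx M @^-1` [set i])).

Lemma grid_wt_ge0 M i : 0 <= grid_wt (M := M) i.
Proof. exact: fine_ge0. Qed.

Lemma grid_fun_sum M (f : 'I_(M * M + M * M).+1 -> R) s :
  f (grid_idx M s) = \sum_i f i * \1_(grid_idx M @^-1` [set i]) s.
Proof.
rewrite (bigD1 (grid_idx M s))//= indicE mem_set// mulr1 big1 ?addr0// => i ni.
by rewrite indicE memNset ?mulr0//= => h; move: ni; rewrite h eqxx.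
Qed.

Lemma Rintegral_grid M (f : 'I_(M * M + M * M).+1 -> R) : (0 < M)%N ->
  \int[gam]_s f (grid_idx M s) = \sum_i f i * grid_wt i.
Proof.
move=> M0; under eq_Rintegral do rewrite grid_fun_sum.
rewrite Rintegral_sum; last first.
  move=> i; apply: integrableZr.
  exact: (integrable_indic gam (measurable_grid _ M0)).
apply: eq_bigr => i _; rewrite RintegralZl//; last first.
  exact: (integrable_indic gam (measurable_grid _ M0)).
by rewrite Rintegral_indic_prob//; exact: measurable_grid.
Qed.

End grid.

(** * Gaussian smoothing along one direction *)

Section gauss_op.
Context {R : realType} {Z : lmodType R}.
Local Notation gam := (@normal_prob R 0 1).
Implicit Types (f g : Z -> R) (z v w : Z).

Definition dir_lip v (C : R) f := forall z s, `|f (z + s *: v) - f z| <= C * `|s|.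
(** Boundedness and a Lipschitz constant for each direction, uniform over
    base points.  This is enough regularity for the smoothing operators, which
    preserve it, and it makes sense without a norm on Z. *)
Definition dlip f := (exists B : R, forall z, `|f z| <= B) /\
  forall v, exists C : R, dir_lip v C f.

(** The expectation of f (z + h v) for a standard normal h: the heat semigroup
    in direction v at a fixed time.  A Gaussian vector with independent
    components in directions v_1, ..., v_p is handled by composing these
    one-dimensional operators. *)
Definition gT v f z : R := \int[gam]_s f (z + s *: v).

Lemma dir_lip_continuous v C f z : dir_lip v C f ->
  continuous (fun s : R => f (z + s *: v)).
Proof.
move=> h s.
have C0 : 0 <= C by have := le_trans (normr_ge0 _) (h 0 1); rewrite normr1 mulr1.
apply/cvgrPdist_le => /= e e0; near=> t.
have -> : z + s *: v = (z + t *: v) + (s - t) *: v.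
  by rewrite -addrA -scalerDl addrCA subrr addr0.
apply: (le_trans (h _ _)).
have st : `|s - t| < e / (C + 1).
  near: t; exists (e / (C + 1)) => //=.
  by rewrite divr_gt0// ltr_wpDl.
apply: (@le_trans _ _ ((C + 1) * `|s - t|)); first by rewrite ler_wpM2r// lerDl.
by rewrite mulrC -ler_pdivlMr ?ltr_wpDl// ltW.
Unshelve. all: by end_near. Qed.

Lemma dlip_continuous v f z : dlip f -> continuous (fun s : R => f (z + s *: v)).
Proof. by case=> _ /(_ v)[C]; exact: dir_lip_continuous. Qed.

Lemma dlip_integrable v f z : dlip f ->
  gam.-integrable setT (EFin \o (fun s => f (z + s *: v))).
Proof.
move=> df; have [[B fB] _] := df.
apply: (@integrable_bounded_prob _ _ _ gam _ B) => //.
by apply: continuous_measurable_fun; exact: dlip_continuous.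
Qed.

Lemma gT_le_add v f g (e : R) z : dlip f -> dlip g ->
  (forall y, f y <= g y + e) -> gT v f z <= gT v g z + e.
Proof.
move=> df dg fg; rewrite /gT -[X in _ <= _ + X](@Rintegral_prob_cst _ _ _ gam).
have ic : gam.-integrable setT (EFin \o (fun _ : R => e)).
  by apply: (@integrable_bounded_prob _ _ _ gam _ `|e|).
rewrite -RintegralD//; last exact: dlip_integrable.
apply: le_Rintegral => //; first exact: dlip_integrable.
exact: (integrableD measurableT (dlip_integrable v z dg) ic).
Qed.

Lemma gT_dist v f g (e : R) z : dlip f -> dlip g ->
  (forall y, `|f y - g y| <= e) -> `|gT v f z - gT v g z| <= e.
Proof.
move=> df dg fg.
have h1 : gT v f z <= gT v g z + e.
  by apply: gT_le_add => // y; have := fg y; rewrite ler_norml => /andP[_ ?]; lra.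
have h2 : gT v g z <= gT v f z + e.
  by apply: gT_le_add => // y; have := fg y; rewrite ler_norml => /andP[? _]; lra.
by rewrite ler_norml; apply/andP; split; lra.
Qed.

Lemma dlip_cst (c : R) : dlip (fun _ : Z => c).
Proof.
split=> [|w]; first by exists `|c|.
by exists 0 => y s; rewrite subrr normr0 mul0r.
Qed.

Lemma gT_bound v f (B : R) z : dlip f -> (forall y, `|f y| <= B) -> `|gT v f z| <= B.
Proof.
move=> df fB; have d0 := dlip_cst 0.
have -> : gT v f z = gT v f z - gT v (fun=> 0) z by rewrite /gT Rintegral_prob_cst subr0.
by apply: gT_dist => // y; rewrite subr0.
Qed.

Lemma dlip_shift w f : dlip f -> dlip (fun z => f (z + w)).
Proof.
case=> -[B fB] fL; split; first by exists B => z; exact: fB.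
by move=> v; have [C h] := fL v; exists C => z s; rewrite addrAC; exact: h.
Qed.

Lemma gT_shift w v f z : gT v f (z + w) = gT v (fun y => f (y + w)) z.
Proof. by apply: eq_Rintegral => s _; rewrite addrAC. Qed.

Lemma gT_dir_lip w C v f : dlip f -> dir_lip w C f -> dir_lip w C (gT v f).
Proof.
move=> df h z s; rewrite gT_shift; apply: gT_dist => //; exact: dlip_shift.
Qed.

Lemma gT_dlip v f : dlip f -> dlip (gT v f).
Proof.
move=> df; have [[B fB] fL] := df; split.
  by exists B => z; exact: gT_bound.
by move=> w; have [C h] := fL w; exists C; exact: gT_dir_lip.
Qed.

(** The analogue of gT for the discretised normal law: a finite sum, so that
    two directions commute for trivial reasons. *)
Definition gS (M : nat) v f z : R :=
  \sum_(i < (M * M + M * M).+1) grid_wt i * f (z + grid_pt i *: v).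

Lemma gT_gS M v C f z : (0 < M)%N -> dlip f -> dir_lip v C f ->
  `|gT v f z - gS M v f z| <= C * (1 + var01) / M%:R.
Proof.
move=> M0 df h; have MR : 0 < M%:R :> R by rewrite ltr0n.
have -> : gS M v f z = \int[gam]_s f (z + grid_pt (grid_idx M s) *: v).
  rewrite (@Rintegral_grid _ _ (fun i => f (z + grid_pt i *: v)))//.
  by apply: eq_bigr => i _; rewrite mulrC.
have ig : gam.-integrable setT (EFin \o (fun s => f (z + grid_pt (grid_idx M s) *: v))).
  have [[B fB] _] := df.
  apply: (@integrable_bounded_prob _ _ _ gam _ B) => //.
  rewrite (_ : (fun s => _) = (fun s => \sum_i f (z + grid_pt i *: v) * \1_(grid_idx M @^-1` [set i]) s)).
    apply: measurable_sum => i; apply: measurable_funM => //.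
    by apply: measurable_indic; exact: measurable_grid.
  by apply/funext => s; exact: (@grid_fun_sum _ _ (fun i => f (z + grid_pt i *: v))).
have iT : gam.-integrable setT (EFin \o (fun s => f (z + s *: v))) by exact: dlip_integrable.
rewrite /gT -RintegralB//.
have iB : gam.-integrable setT (EFin \o (fun s => f (z + s *: v) - f (z + grid_pt (grid_idx M s) *: v))).
  by exact: (integrableB measurableT iT ig).
apply: (le_trans (le_normr_Rintegral _ iB)) => //.
have i2 : gam.-integrable setT (EFin \o (fun s : R => 1 + s ^+ 2)).
  have i1 : gam.-integrable setT (EFin \o (fun s : R => 1)).
    by apply: (@integrable_bounded_prob _ _ _ gam _ 1) => // x; rewrite normr1.
  exact: (integrableD measurableT i1 (integrable_sqr01 (R := R))).
have -> : C * (1 + var01) / M%:R = \int[gam]_s (C / M%:R * (1 + s ^+ 2)).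
  rewrite RintegralZl// RintegralD//; last 2 first.
  - by apply: (@integrable_bounded_prob _ _ _ gam _ 1) => // x; rewrite normr1.
  - exact: integrable_sqr01.
  by rewrite Rintegral_prob_cst mulrAC.
apply: le_Rintegral => //.
- exact: (integrable_abse iB).
- exact: integrableZr.
move=> s _; have -> : z + s *: v = z + grid_pt (grid_idx M s) *: v + (s - grid_pt (grid_idx M s)) *: v.
  by rewrite -addrA -scalerDl addrCA subrr addr0.
apply: (le_trans (h _ _)).
have C0 : 0 <= C by have := le_trans (normr_ge0 _) (h 0 1); rewrite normr1 mulr1.
by rewrite -mulrA ler_wpM2l// mulrC; exact: grid_dist.
Qed.

Lemma grid_wt_sum M : (0 < M)%N -> \sum_i @grid_wt R M i = 1.
Proof.
move=> M0; have := @Rintegral_grid R M (fun=> 1) M0.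
by rewrite (@Rintegral_prob_cst _ _ _ gam) => ->; apply: eq_bigr => i _; rewrite mul1r.
Qed.

Lemma gS_dist M v f g (e : R) z : (0 < M)%N ->
  (forall y, `|f y - g y| <= e) -> `|gS M v f z - gS M v g z| <= e.
Proof.
move=> M0 fg; rewrite /gS -sumrB; apply: (le_trans (ler_norm_sum _ _ _)).
rewrite -[leRHS]mul1r -(grid_wt_sum M0) mulr_suml; apply: ler_sum => i _.
by rewrite -mulrBr normrM ger0_norm ?grid_wt_ge0// ler_wpM2l ?grid_wt_ge0.
Qed.

Lemma gS_comm M v w f z : gS M v (gS M w f) z = gS M w (gS M v f) z.
Proof.
rewrite /gS; under eq_bigr do rewrite mulr_sumr.
rewrite exchange_big/=; apply: eq_bigr => i _; rewrite mulr_sumr.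
by apply: eq_bigr => j _; rewrite mulrCA addrAC.
Qed.

Lemma eq0_le_div (x K : R) : (forall M : nat, (0 < M)%N -> `|x| <= K / M%:R) -> x = 0.
Proof.
move=> h; apply/eqP; rewrite -normr_le0; apply/ler_addgt0Pl => e e0; rewrite addr0.
have K0 : 0 <= K by have := le_trans (normr_ge0 _) (h 1 isT); rewrite divr1.
have [M hM] : exists M : nat, K / e < M%:R by exists (Num.truncn (K / e)).+1; exact: truncnS_gt.
have M0 : (0 < M)%N by rewrite -(ltr_nat R) (le_lt_trans _ hM)// divr_ge0// ltW.
apply: (le_trans (h M M0)); rewrite ler_pdivrMr ?ltr0n//.
by rewrite mulrC -ler_pdivrMr// ltW.
Qed.

(** Both orders of integration are limits of the commuting finite sums gS, and
    the error bounds K / M do not depend on the order.  This avoids the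
    joint measurability in the two parameters that Fubini's theorem asks for. *)
Lemma gT_comm v w f : dlip f -> gT v (gT w f) = gT w (gT v f).
Proof.
move=> df; apply/funext => z; apply/eqP; rewrite -subr_eq0; apply/eqP.
have [_ fL] := df; have [C hC] := fL v; have [D hD] := fL w.
apply: (@eq0_le_div _ (2 * ((C + D) * (1 + var01)))) => M M0.
have half a b Ca Cb : dir_lip a Ca f -> dir_lip b Cb f ->
    `|gT a (gT b f) z - gS M a (gS M b f) z| <= (Ca + Cb) * (1 + var01) / M%:R.
  move=> ha hb.
  apply: (@le_trans _ _ (`|gT a (gT b f) z - gS M a (gT b f) z| +
      `|gS M a (gT b f) z - gS M a (gS M b f) z|)).
    by rewrite -[X in `|X|](subrKA (gS M a (gT b f) z)); exact: ler_normD.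
  rewrite mulrDl mulrDl; apply: lerD.
    by apply: gT_gS => //; [exact: gT_dlip|exact: gT_dir_lip].
  by apply: gS_dist => // y; exact: gT_gS.
have h1 := half _ _ _ _ hC hD; have h2 := half _ _ _ _ hD hC.
rewrite gS_comm in h2.
rewrite -(subrKA (gS M v (gS M w f) z)) (le_trans (ler_normD _ _))//.
rewrite [X in _ + X <= _]distrC.
rewrite [D + C]addrC in h2; apply: (le_trans (lerD h1 h2)).
by rewrite -[leRHS]mulrA mulr_natl mulr2n.
Qed.

(** [normal_halve] along a line; adding the bound B makes the integrand
    nonnegative. *)
Lemma gT_halve v f : dlip f ->
  gT ((Num.sqrt 2)^-1 *: v) (gT ((Num.sqrt 2)^-1 *: v) f) = gT v f.
Proof.
move=> df; apply/funext => z; have [[B fB] _] := df.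
pose F (s : R) := f (z + s *: v) + B.
have cF : continuous F.
  by move=> s; apply: cvgD; [exact: (dlip_continuous df)|exact: cvg_cst].
have F0 s : 0 <= F s.
  by have := fB (z + s *: v); rewrite ler_norml /F => /andP[? _]; lra.
have ic : gam.-integrable setT (EFin \o (fun _ : R => B)).
  by apply: (@integrable_bounded_prob _ _ _ gam _ `|B|).
have h1 : \int[gam]_s F s = gT v f z + B.
  by rewrite /F RintegralD// ?Rintegral_prob_cst//; exact: dlip_integrable.
have hin (s : R) : \int[gam]_t F ((Num.sqrt 2)^-1 * (s + t)) =
    gT ((Num.sqrt 2)^-1 *: v) f (z + s *: ((Num.sqrt 2)^-1 *: v)) + B.
  rewrite /F RintegralD// ?Rintegral_prob_cst//.
    congr (_ + _); apply: eq_Rintegral => t _.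
    by rewrite -addrA !scalerA -scalerDl -mulrDl [_^-1 * _]mulrC.
  rewrite (_ : _ \o _ = EFin \o (fun t => f ((z + s *: ((Num.sqrt 2)^-1 *: v)) + t *: ((Num.sqrt 2)^-1 *: v)))).
    exact: dlip_integrable.
  apply/funext => t /=; congr (f _)%:E.
  by rewrite -addrA !scalerA -scalerDl -mulrDl [_^-1 * _]mulrC.
apply: (@addIr _ B); rewrite -h1.
have -> : gT ((Num.sqrt 2)^-1 *: v) (gT ((Num.sqrt 2)^-1 *: v) f) z + B =
    \int[gam]_s (\int[gam]_t F ((Num.sqrt 2)^-1 * (s + t))).
  under [RHS]eq_Rintegral do rewrite hin.
  rewrite RintegralD// ?Rintegral_prob_cst//.
  exact/dlip_integrable/gT_dlip.
rewrite /Rintegral -(normal_halve cF F0); congr fine.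
apply: eq_integral => s _ /=; rewrite fineK//.
have iF : gam.-integrable setT (EFin \o (fun t : R => F ((Num.sqrt 2)^-1 * (s + t)))).
  apply: (@integrable_bounded_prob _ _ _ gam (fun t => F ((Num.sqrt 2)^-1 * (s + t))) (B + B)).
    apply: continuous_measurable_fun => t.
    apply: (@continuous_comp _ _ _ (fun t => (Num.sqrt 2)^-1 * (s + t)) F); last exact: cF.
    by apply: cvgMr; apply: cvgD; [exact: cvg_cst|exact: cvg_id].
  move=> t; rewrite ger0_norm// /F lerD2r.
  exact: (le_trans (ler_norm _) (fB _)).
exact: (integrable_fin_num measurableT iF).
Qed.

End gauss_op.

(** * Comparison of two families of Gaussian directions *)

Section lindeberg.
Context {R : realType} {Z : lmodType R}.
Local Notation gam := (@normal_prob R 0 1).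
Implicit Types (f g : Z -> R) (z v w : Z) (vs us : seq Z).

Definition gTs vs f : Z -> R := foldr (fun v => gT v) f vs.

Lemma gTs_dlip vs f : dlip f -> dlip (gTs vs f).
Proof. by move=> df; elim: vs => //= v vs IH; exact: gT_dlip. Qed.

Lemma gTs_le_add vs f g (e : R) : dlip f -> dlip g ->
  (forall y, f y <= g y + e) -> forall z, gTs vs f z <= gTs vs g z + e.
Proof.
move=> df dg h; elim: vs => //= v vs IH z; apply: gT_le_add => //; exact: gTs_dlip.
Qed.

Lemma gT_gTs v us f : dlip f -> gT v (gTs us f) = gTs us (gT v f).
Proof.
move=> df; elim: us => //= u us IH; rewrite gT_comm ?IH//; exact: gTs_dlip.
Qed.

Lemma gTs_comm vs us f : dlip f -> gTs vs (gTs us f) = gTs us (gTs vs f).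
Proof.
move=> df; elim: vs => //= v vs IH; rewrite IH gT_gTs//; exact: gTs_dlip.
Qed.

Lemma gTs_halve vs f : dlip f ->
  let hs := [seq (Num.sqrt 2)^-1 *: v | v <- vs] in gTs hs (gTs hs f) = gTs vs f.
Proof.
move=> df; elim: vs => //= v vs <-.
rewrite -[RHS]gT_halve; last by do 2 apply: gTs_dlip.
by congr gT; rewrite -gT_gTs//; exact: gTs_dlip.
Qed.

Lemma dlip_lin f g (c : R) : dlip f -> dlip g -> dlip (fun z => f z + c * g z).
Proof.
case=> -[B fB] fL [[D gD] gL]; split.
  exists (B + `|c| * D) => z; rewrite (le_trans (ler_normD _ _))// lerD// normrM.
  by rewrite ler_wpM2l.
move=> v; have [C hC] := fL v; have [E hE] := gL v.
exists (C + `|c| * E) => z s.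
have -> : f (z + s *: v) + c * g (z + s *: v) - (f z + c * g z) =
  (f (z + s *: v) - f z) + c * (g (z + s *: v) - g z) by ring.
rewrite (le_trans (ler_normD _ _))// mulrDl lerD// normrM -mulrA.
by rewrite ler_wpM2l.
Qed.

Lemma gT_lin v f g (c : R) z : dlip f -> dlip g ->
  gT v (fun z => f z + c * g z) z = gT v f z + c * gT v g z.
Proof.
move=> df dg; rewrite /gT RintegralD//; last 2 first.
- exact: dlip_integrable.
- by apply: integrableZr; exact: dlip_integrable.
by rewrite RintegralZl//; exact: dlip_integrable.
Qed.

(** The constant comes from `|s| <= 1 + s ^ 2. *)
Lemma gT_near v f (C e : R) z : dlip f -> dir_lip v C f -> 0 <= e ->
  `|gT (e *: v) f z - f z| <= C * (1 + var01) * e.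
Proof.
move=> df h e0; rewrite /gT -[X in _ - X](@Rintegral_prob_cst _ _ _ gam).
have ic : gam.-integrable setT (EFin \o (fun _ : R => f z)).
  by apply: (@integrable_bounded_prob _ _ _ gam _ `|f z|).
have i1 : gam.-integrable setT (EFin \o (fun s : R => 1)).
  by apply: (@integrable_bounded_prob _ _ _ gam _ 1) => // x; rewrite normr1.
have ia := dlip_integrable (e *: v) z df.
rewrite -RintegralB//.
have iB := integrableB measurableT ia ic.
apply: (le_trans (le_normr_Rintegral _ iB)) => //.
have i2 : gam.-integrable setT (EFin \o (fun s : R => 1 + s ^+ 2)).
  exact: (integrableD measurableT i1 (integrable_sqr01 (R := R))).
have -> : C * (1 + var01) * e = \int[gam]_s (C * e * (1 + s ^+ 2)).
  rewrite RintegralZl// RintegralD//; last exact: integrable_sqr01.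
  by rewrite Rintegral_prob_cst mulrAC.
apply: le_Rintegral => //.
- exact: (integrable_abse iB).
- exact: integrableZr.
move=> s _; rewrite scalerA (le_trans (h _ _))//.
have C0 : 0 <= C by have := le_trans (normr_ge0 _) (h 0 1); rewrite normr1 mulr1.
rewrite normrM (ger0_norm e0) -mulrA ler_wpM2l// mulrC ler_wpM2l//.
have := sqr_ge0 (`|s| - 1); have := normr_ge0 s.
by rewrite -[X in _ <= 1 + X]real_normK ?num_real//; nra.
Qed.

(** Here h plays the role of the second derivative of f along
    v; the first derivative is left existential because its contribution
    averages to 0. *)
Definition taylor2 v f h := exists g : Z -> R, exists C : R, forall z s,
  `|f (z + s *: v) - f z - s * g z - s ^+ 2 / 2 * h z| <= C * `|s| ^+ 3.

(** The linear term integrates to 0 by symmetry and the cubic remainder is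
    controlled by the third absolute moment. *)
Lemma gT_taylor v f h : dlip f -> taylor2 v f h -> exists K : R, forall e z, 0 <= e ->
  `|gT (e *: v) f z - (f z + e ^+ 2 * var01 / 2 * h z)| <= K * e ^+ 3.
Proof.
move=> df [g [C hC]]; exists (C * abs3) => e z e0.
have C0 : 0 <= C by have := le_trans (normr_ge0 _) (hC 0 1); rewrite normr1 expr1n mulr1.
pose q (s : R) := f z + (e * g z * s + e ^+ 2 / 2 * h z * s ^+ 2).
have ic : gam.-integrable setT (EFin \o (fun _ : R => f z)).
  by apply: (@integrable_bounded_prob _ _ _ gam _ `|f z|).
have i1 := integrableZr (e * g z) (integrable_id01 (R := R)).
have i2 := integrableZr (e ^+ 2 / 2 * h z) (integrable_sqr01 (R := R)).
have i12 := integrableD measurableT i1 i2.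
have iq : gam.-integrable setT (EFin \o q) := integrableD measurableT ic i12.
have -> : f z + e ^+ 2 * var01 / 2 * h z = \int[gam]_s q s.
  rewrite /q RintegralD// RintegralD// Rintegral_prob_cst !RintegralZl//.
  - by rewrite Rintegral_normal_id mulr0 add0r /var01; congr (_ + _); ring.
  - exact: integrable_sqr01.
  - exact: integrable_id01.
have ia := dlip_integrable (e *: v) z df.
rewrite /gT -RintegralB//.
have iB := integrableB measurableT ia iq.
apply: (le_trans (le_normr_Rintegral _ iB)) => //.
have i3 := integrableZr (C * e ^+ 3) (integrable_abs3 (R := R)).
have -> : C * abs3 * e ^+ 3 = \int[gam]_s (C * e ^+ 3 * `|s| ^+ 3).
  rewrite RintegralZl; [|exact: measurableT|exact: integrable_abs3].
  by rewrite mulrAC.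
apply: le_Rintegral => //.
  exact: (integrable_abse iB).
move=> s _; have H := hC z (s * e).
rewrite normrM (ger0_norm e0) in H; rewrite scalerA.
have -> : f (z + (s * e) *: v) - q s =
    f (z + (s * e) *: v) - f z - s * e * g z - (s * e) ^+ 2 / 2 * h z.
  by rewrite /q; ring.
have -> : C * e ^+ 3 * `|s| ^+ 3 = C * (`|s| * e) ^+ 3 by ring.
exact: H.
Qed.

Definition sum_dir (h : Z -> Z -> R) vs z := \sum_(v <- vs) h v z.

Lemma sum_dir_dlip h vs : (forall v, v \in vs -> dlip (h v)) -> dlip (sum_dir h vs).
Proof.
elim: vs => [|v vs IH] H.
  rewrite (_ : sum_dir _ _ = fun=> 0); first exact: dlip_cst.
  by apply/funext => z; rewrite /sum_dir big_nil.
rewrite (_ : sum_dir _ _ = fun z => h v z + 1 * sum_dir h vs z); last first.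
  by apply/funext => z; rewrite /sum_dir big_cons mul1r.
apply: dlip_lin; first by apply: H; rewrite inE eqxx.
by apply: IH => w wv; apply: H; rewrite inE wv orbT.
Qed.

(** Smoothing one more direction adds its own second-order term; moving it
    across the accumulated term costs e ^ 2 times the first-order bound of
    [gT_near], which is again of order e ^ 3. *)
Lemma gTs_taylor h vs f : dlip f ->
  (forall v, v \in vs -> taylor2 v f (h v)) ->
  (forall v, v \in vs -> dlip (h v)) ->
  exists K : R, forall e z, 0 <= e -> e <= 1 ->
  `|gTs [seq e *: v | v <- vs] f z - (f z + e ^+ 2 * var01 / 2 * sum_dir h vs z)|
     <= K * e ^+ 3.
Proof.
move=> df; elim: vs => [|v vs IH] Ht Hd.
  by exists 0 => e z _ _; rewrite /sum_dir big_nil /= mulr0 addr0 subrr normr0 mul0r.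
have [|w wv|K hK] := IH; [by move=> w wv; apply: Ht; rewrite inE wv orbT
  |by apply: Hd; rewrite inE wv orbT|].
have dH : dlip (sum_dir h vs).
  by apply: sum_dir_dlip => w wv; apply: Hd; rewrite inE wv orbT.
have [K1 hK1] : exists K : R, forall e z, 0 <= e ->
  `|gT (e *: v) f z - (f z + e ^+ 2 * var01 / 2 * h v z)| <= K * e ^+ 3.
  by apply: gT_taylor => //; apply: Ht; rewrite inE eqxx.
have [_ /(_ v)[C hC]] := dH.
exists (K + K1 + var01 / 2 * (C * (1 + var01))) => e z e0 e1.
rewrite /= {1}/sum_dir big_cons -/(sum_dir h vs z).
set G := gTs _ f; set H := sum_dir h vs; set c := e ^+ 2 * var01 / 2.
have dG : dlip G by exact: gTs_dlip.
have dF : dlip (fun y => f y + c * H y) by exact: dlip_lin.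
have t1 : `|gT (e *: v) G z - gT (e *: v) (fun y => f y + c * H y) z| <= K * e ^+ 3.
  by apply: gT_dist => // y; exact: hK.
have t2 := hK1 e z e0.
have t3 := gT_near z dH hC e0.
rewrite gT_lin// in t1.
have c0 : 0 <= c by rewrite /c !mulr_ge0// ?sqr_ge0// var01_ge0.
have t4 : `|c * (gT (e *: v) H z - H z)| <= var01 / 2 * (C * (1 + var01)) * e ^+ 3.
  rewrite normrM (ger0_norm c0).
  have -> : var01 / 2 * (C * (1 + var01)) * e ^+ 3 = c * (C * (1 + var01) * e).
    by rewrite /c; ring.
  by rewrite ler_wpM2l.
have -> : gT (e *: v) G z - (f z + c * (h v z + H z)) =
   (gT (e *: v) G z - (gT (e *: v) f z + c * gT (e *: v) H z)) +
   ((gT (e *: v) f z - (f z + c * h v z)) + c * (gT (e *: v) H z - H z)) by ring.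
apply: (le_trans (ler_normD _ _)).
have -> : (K + K1 + var01 / 2 * (C * (1 + var01))) * e ^+ 3 =
  K * e ^+ 3 + (K1 * e ^+ 3 + var01 / 2 * (C * (1 + var01)) * e ^+ 3) by ring.
apply: lerD => //; apply: (le_trans (ler_normD _ _)); exact: lerD.
Qed.

Lemma le0_le_div (x K : R) : (forall M : nat, (0 < M)%N -> x <= K / M%:R) -> x <= 0.
Proof.
move=> h; rewrite leNgt; apply/negP => x0.
have : x = 0; last by move=> x1; rewrite x1 ltxx in x0.
by apply: (@eq0_le_div _ _ K) => M M0; rewrite gtr0_norm ?h.
Qed.

(** Scaling all directions by e makes the two sides differ by the nonnegative
    second-order term up to (K + L) e ^ 3, see [gTs_taylor].  By stability of
    the normal law, smoothing with e v is smoothing twice with e v / sqrt 2, so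
    an error D at scale e / sqrt 2 gives an error 2 D at scale e.  Going from
    scale 2 ^ (-M) to scale 1 takes 2 M halvings and multiplies the error
    (K + L) 2 ^ (-3 M) by 2 ^ (2 M): what remains is (K + L) 2 ^ (-M). *)
Theorem lindeberg_comparison h vs us f : dlip f ->
  (forall v, v \in vs ++ us -> taylor2 v f (h v)) ->
  (forall v, v \in vs ++ us -> dlip (h v)) ->
  (forall z, sum_dir h us z <= sum_dir h vs z) ->
  forall z, gTs us f z <= gTs vs f z.
Proof.
move=> df Ht Hd hle; set r : R := (Num.sqrt 2)^-1.
have r0 : 0 < r by rewrite invr_gt0 sqrtr_gt0.
have r2 : r ^+ 2 = 2^-1 by rewrite /r exprVn sqr_sqrtr.
have r1 : r <= 1 by rewrite -(@ler_pXn2r _ 2)// ?nnegrE// ?(ltW r0)// r2 expr1n; lra.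
pose Pr (e D : R) := forall z,
  gTs [seq e *: v | v <- us] f z <= gTs [seq e *: v | v <- vs] f z + D.
have step e D : Pr (r * e) D -> Pr e (2 * D).
  move=> H z.
  have hs ws : [seq r *: v | v <- [seq e *: v | v <- ws]] = [seq (r * e) *: v | v <- ws].
    by rewrite -map_comp; apply: eq_map => v /=; rewrite scalerA.
  rewrite -(gTs_halve [seq e *: v | v <- us] df).
  rewrite -(gTs_halve [seq e *: v | v <- vs] df) -/r !hs.
  set us' := map _ us; set vs' := map _ vs.
  apply: (@le_trans _ _ (gTs us' (gTs vs' f) z + D)).
    by apply: gTs_le_add => //; exact: gTs_dlip.
  rewrite gTs_comm// mulr_natl mulr2n addrA lerD2r.
  by apply: gTs_le_add => //; exact: gTs_dlip.
have steps j e D : Pr (r ^+ j * e) D -> Pr e (2 ^+ j * D).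
  elim: j e D => [|j IH] e D; first by rewrite !expr0 !mul1r.
  rewrite exprSr -mulrA => /IH /step; by rewrite mulrA -exprS.
have [v vv|v vv|K hK] := @gTs_taylor h vs f df.
- by apply: Ht; rewrite mem_cat vv.
- by apply: Hd; rewrite mem_cat vv.
have [v vv|v vv|L hL] := @gTs_taylor h us f df.
- by apply: Ht; rewrite mem_cat vv orbT.
- by apply: Hd; rewrite mem_cat vv orbT.
have base e : 0 <= e -> e <= 1 -> Pr e ((K + L) * e ^+ 3).
  move=> e0 e1 z; have := hK e z e0 e1; have := hL e z e0 e1.
  rewrite !ler_norml => /andP[_ h1] /andP[h2 _].
  have : e ^+ 2 * var01 / 2 * sum_dir h us z <= e ^+ 2 * var01 / 2 * sum_dir h vs z.
    by rewrite ler_wpM2l// !mulr_ge0// ?sqr_ge0// var01_ge0.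
  rewrite mulrDl; lra.
move=> z; rewrite -subr_le0; apply: (@le0_le_div _ (K + L)) => M M0.
have rj0 j : 0 <= r ^+ j by rewrite exprn_ge0 ?ltW.
have rj1 j : r ^+ j <= 1 by rewrite exprn_ile1// ltW.
have := steps (2 * M)%N 1 _ _ z; rewrite mulr1 => /(_ _ (base _ (rj0 _) (rj1 _))).
have e1 ws : [seq 1 *: v | v <- ws] = ws :> seq Z.
  by rewrite -[RHS]map_id; apply: eq_map => v /=; rewrite scale1r.
rewrite !e1 => H; rewrite lerBlDl (le_trans H)// lerD2l.
have -> : 2 ^+ (2 * M) * ((K + L) * r ^+ (2 * M) ^+ 3) = (K + L) * 2^-1 ^+ M.
  rewrite !exprM r2 -(exprM _ M 3) (mulnC M) (exprM _ 3 M) mulrCA -exprMn.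
  by congr (_ * _ ^+ _); field.
have KL0 : 0 <= K + L.
  have := le_trans (normr_ge0 _) (hK 1 z ler01 (lexx _)).
  have := le_trans (normr_ge0 _) (hL 1 z ler01 (lexx _)).
  by rewrite expr1n !mulr1 => *; exact: addr_ge0.
rewrite ler_wpM2l// exprVn lef_pV2 ?posrE ?exprn_gt0 ?ltr0n//.
by rewrite -natrX ler_nat ltnW// ltn_expl.
Qed.

End lindeberg.

(** * Functions of independent normal variables *)

Section law.
Context {R : realType} {d : measure_display} {T : measurableType d} {P : probability T R}.
Local Notation gam := (@normal_prob R 0 1).

Let idTR : measurableTypeR R -> R := idfun.

(** The identity of R as a random variable on (R, gam): its distribution is gam,
    which lets two laws on R be compared through integrals. *)
#[local] HB.instance Definition _ :=
  @isMeasurableFun.Build _ _ _ _ idTR (@measurable_id _ _ setT).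

Lemma integral_std_normal (X : {RV P >-> R}) (f : R -> R) :
  (forall B, measurable B -> distribution P X B = gam B) ->
  measurable_fun setT f -> (forall x, 0 <= f x) ->
  (\int[P]_w (f (X w))%:E = \int[gam]_s (f s)%:E)%E.
Proof.
move=> law mf f0.
have mE : measurable_fun setT (EFin \o f) by exact/measurable_EFinP.
rewrite -(@ge0_integral_distribution _ _ _ _ _ P X (EFin \o f))//.
rewrite -(@ge0_integral_distribution _ _ _ _ _ gam (idTR : {RV gam >-> R}) (EFin \o f))//.
by apply: eq_measure_integral => A mA _; exact: law.
Qed.

End law.

Section transfer.
Context {R : realType} {Z : lmodType R}.
Local Notation gam := (@normal_prob R 0 1).

Local Notation gidx M := 'I_(M * M + M * M).+1.

Definition gSs M (vs : seq Z) (f : Z -> R) : Z -> R := foldr (fun v => gS M v) f vs.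

Lemma gTs_dir_lip w C vs (f : Z -> R) : dlip f -> dir_lip w C f -> dir_lip w C (gTs vs f).
Proof.
move=> df h; elim: vs => //= v vs IH; apply: gT_dir_lip => //; exact: gTs_dlip.
Qed.

Lemma gTs_gSs vs (f : Z -> R) : dlip f -> exists K : R, forall M z, (0 < M)%N ->
  `|gTs vs f z - gSs M vs f z| <= K / M%:R.
Proof.
move=> df; elim: vs => [|v vs [K hK]].
  by exists 0 => M z _; rewrite /= subrr normr0 mul0r.
have [_ /(_ v)[C hC]] := df.
exists (C * (1 + var01) + K) => M z M0 /=.
rewrite -(subrKA (gS M v (gTs vs f) z)) (le_trans (ler_normD _ _))// mulrDl lerD//.
  by apply: gT_gS => //; [exact: gTs_dlip|exact: gTs_dir_lip].
by apply: gS_dist => // y; exact: hK.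
Qed.

Context {d : measure_display} {T : measurableType d} {P : probability T R}.
Context {I : finType} (X : I -> {RV P >-> R}) (V : I -> Z).
Hypothesis Xiid : iid_std_normal X.
Variable F : Z -> R.
Hypothesis dF : dlip F.

Let cell M (i : I) (l : gidx M) (w : T) : R := \1_(grid_idx M @^-1` [set l]) (X i w).
Let pt M (i : I) (w : T) : R := grid_pt (grid_idx M (X i w)).
Let arg M (r : seq I) (w : T) : Z := \sum_(i <- r) pt M i w *: V i.

Let measurable_cell M i (l : gidx M) : (0 < M)%N -> measurable_fun setT (cell i l).
Proof.
move=> M0; rewrite (_ : cell i l = \1_(X i @^-1` (grid_idx M @^-1` [set l])))//.
by apply: measurable_indic; apply: measurable_funPTI => //; exact: measurable_grid.
Qed.

Let split_cell M i r z w :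
  F (z + arg M (i :: r) w) =
  \sum_(l : gidx M) cell i l w * F (z + grid_pt l *: V i + arg M r w).
Proof.
rewrite /arg big_cons addrA.
rewrite (@grid_fun_sum _ M (fun l : gidx M => F (z + grid_pt l *: V i + _))).
by apply: eq_bigr => l _; rewrite mulrC.
Qed.

Let measurable_arg M r z : (0 < M)%N ->
  measurable_fun setT (fun w => F (z + arg M r w)).
Proof.
move=> M0; elim: r z => [|i r IH] z.
  rewrite (_ : (fun _ => _) = (fun=> F z)) //.
  by apply/funext => w; rewrite /arg big_nil addr0.
rewrite (_ : (fun _ => _) = (fun w => \sum_(l : gidx M) cell i l w * F (z + grid_pt l *: V i + arg M r w))).
  by apply: measurable_sum => l; apply: measurable_funM => //; exact: measurable_cell.
by apply/funext => w; rewrite split_cell.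
Qed.

Let cell01 M i (l : gidx M) w : 0 <= cell i l w <= 1.
Proof. by rewrite /cell indicE; case: (_ \in _); rewrite ?lexx ?ler01. Qed.

Let prod_cell M (J : {set I}) (k : I -> gidx M) w :
  \prod_(j in J) cell j (k j) w =
  \1_(\bigcap_(j in [set` J]) (X j @^-1` (grid_idx M @^-1` [set k j]))) w.
Proof.
set E := (X in \1_X); rewrite [RHS]indicE.
case: (pselect (E w)) => h; [rewrite mem_set//|rewrite memNset//].
  rewrite big1// => j jJ; rewrite /cell indicE mem_set//.
  exact: h.
have [j jJ /negP nj] : exists2 j, j \in J & ~~ (grid_idx M (X j w) == k j).
  apply: contrapT => hn; apply: h => j /= jJ; apply/eqP; apply: contrapT => /negP hj.
  by apply: hn; exists j.
rewrite (bigD1 j)//= /cell indicE memNset ?mul0r//= => /eqP; exact: nj.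
Qed.

(** Induction on the list r of variables still to be averaged.  Splitting
    according to the cell of X i turns one smoothing step gS into a sum over
    cells and moves i into the set J of variables whose cell is fixed; at the
    end only the probability of an intersection over J is left, and this is
    where independence enters. *)
Let integral_disc M r z (J : {set I}) (k : I -> gidx M) : (0 < M)%N -> uniq r ->
  (forall i, i \in r -> i \notin J) ->
  \int[P]_w ((\prod_(j in J) cell j (k j) w) * F (z + arg M r w)) =
  (\prod_(j in J) grid_wt (k j)) * gSs M [seq V i | i <- r] F z.
Proof.
move=> M0; elim: r z J k => [|i r IH] z J k /=.
  move=> _ _.
  have mJ : measurable (\bigcap_(j in [set` J]) (X j @^-1` (grid_idx M @^-1` [set k j]))).
    apply: fin_bigcap_measurable => // j _.
    by apply: measurable_funPTI => //; exact: measurable_grid.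
  under eq_Rintegral do rewrite /arg big_nil addr0 prod_cell.
  rewrite RintegralZr//; last exact: (integrable_indic P mJ).
  rewrite Rintegral_indic_prob//; congr (_ * _).
  have [ind law] := Xiid.
  rewrite ind; last by move=> j _; exact: measurable_grid.
  rewrite (eq_bigr (fun j => (grid_wt (k j))%:E)).
    by rewrite -(big_morph EFin (@EFinM R) erefl).
  move=> j _; rewrite /grid_wt -(law j) ?fineK//; last exact: measurable_grid.
  by apply: fin_num_measure; exact: measurable_grid.
move=> /andP[ir ur] hJ.
have iJ : i \notin J by apply: hJ; rewrite inE eqxx.
have mC j l := @measurable_cell M j l M0.
have [[B hB] _] := dF.
have int (k' : I -> gidx M) z' : P.-integrable setT
  (EFin \o (fun w => (\prod_(j in i |: J) cell j (k' j) w) * F (z' + arg M r w))).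
  apply: (@integrable_bounded_prob _ _ _ P _ B).
    apply: measurable_funM; last exact: measurable_arg.
    by under eq_fun do rewrite -big_enum/=; apply: measurable_prod => j _.
  move=> w; rewrite normrM -[leRHS]mul1r ler_pM//.
  rewrite ger0_norm; first by apply: prodr_ile1 => j _; exact: cell01.
  by apply: prodr_ge0 => j _; case/andP: (cell01 j (k' j) w).
pose k1 (l : gidx M) j := if j == i then l else k j.
have prodk1 (G : forall j : I, gidx M -> R) l :
  \prod_(j in i |: J) G j (k1 l j) = G i l * \prod_(j in J) G j (k j).
  rewrite big_setU1//= /k1 eqxx; congr (_ * _); apply: eq_bigr => j jJ.
  by case: eqP => // ji; rewrite ji (negbTE iJ) in jJ.
transitivity (\int[P]_w (\sum_(l : gidx M) (\prod_(j in i |: J) cell j (k1 l j) w) *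
    F (z + grid_pt l *: V i + arg M r w))).
  apply: eq_Rintegral => w _; rewrite split_cell mulr_sumr; apply: eq_bigr => l _.
  by rewrite (prodk1 (fun j (l : gidx M) => cell j l w)) mulrA; congr (_ * _); rewrite mulrC.
rewrite Rintegral_sum; last by move=> l; exact: int.
rewrite /gS mulr_sumr; apply: eq_bigr => l _.
rewrite IH//.
  by rewrite (prodk1 (fun j (l : gidx M) => grid_wt l)) mulrA; congr (_ * _); rewrite mulrC.
move=> j jr; rewrite in_setU1 negb_or hJ ?inE ?jr ?orbT// andbT.
by apply: contraNneq ir => <-.
Qed.

Let lipF : exists C : R, 0 <= C /\ forall z (a b : I -> R),
  `|F (z + \sum_i a i *: V i) - F (z + \sum_i b i *: V i)| <= C * \sum_i `|a i - b i|.
Proof.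
have [_ fL] := dF.
have /choice[C hC] : forall i, exists c : R, dir_lip (V i) c F by move=> i; exact: fL.
have C0 i : 0 <= C i by have := le_trans (normr_ge0 _) (hC i 0 1); rewrite normr1 mulr1.
exists (\sum_i C i); split; first exact: sumr_ge0.
move=> z a b; rewrite mulr_sumr.
have gen (r : seq I) z' : `|F (z' + \sum_(i <- r) a i *: V i) - F (z' + \sum_(i <- r) b i *: V i)|
   <= \sum_(i <- r) C i * `|a i - b i|.
  elim: r z' => [|i r IH] z'; first by rewrite !big_nil subrr normr0.
  rewrite !big_cons -(subrKA (F (z' + b i *: V i + \sum_(j <- r) a j *: V j))).
  rewrite (le_trans (ler_normD _ _))// lerD//.
    have -> : z' + (a i *: V i + \sum_(j <- r) a j *: V j) =
       (z' + b i *: V i + \sum_(j <- r) a j *: V j) + (a i - b i) *: V i.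
      rewrite scalerBl [RHS]addrAC -(addrA z' (b i *: V i)) [b i *: V i + _]addrCA.
      by rewrite subrr addr0 addrA.
    exact: hC.
  by rewrite addrA; exact: IH.
apply: (le_trans (gen _ _)); apply: ler_sum => i _; rewrite ler_wpM2r//.
by rewrite (bigD1 i)//= lerDl sumr_ge0.
Qed.

(** Replacing every X i by its grid point changes the value of F by at most a
    constant times the sum of the (1 + X i ^ 2) / M, which has finite
    expectation; for the discretised variables the identity is the finite
    computation [integral_disc], up to the error of [gTs_gSs]. *)
Theorem gaussian_law z :
  measurable_fun setT (fun w => F (z + \sum_i X i w *: V i)) /\
  \int[P]_w F (z + \sum_i X i w *: V i) = gTs [seq V i | i <- index_enum I] F z.
Proof.
have [C [C0 hC]] := lipF.
pose Y w : R := \sum_i (1 + X i w ^+ 2).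
have Y0 w : 0 <= Y w by apply: sumr_ge0 => i _; rewrite addr_ge0// sqr_ge0.
have near M w : (0 < M)%N ->
  `|F (z + \sum_i X i w *: V i) - F (z + arg M (index_enum I) w)| <= C * Y w / M%:R.
  move=> M0; apply: (le_trans (hC _ _ _)); rewrite -mulrA ler_wpM2l// mulr_suml.
  by apply: ler_sum => i _; exact: grid_dist.
have mF : measurable_fun setT (fun w => F (z + \sum_i X i w *: V i)).
  apply: (@measurable_fun_cvg _ _ _ _ (fun M w => F (z + arg M.+1 (index_enum I) w))).
    by move=> M; exact: measurable_arg.
  move=> w _; apply/cvgrPdist_le => e e0; near=> M.
  apply: (le_trans (near M.+1 w isT)); rewrite ler_pdivrMr ?ltr0n// [e * _]mulrC -ler_pdivrMr//.
  near: M; exists (Num.truncn (C * Y w / e)) => // M /= hM.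
  by rewrite (le_trans (ltW (truncnS_gt _)))// ler_nat.
split=> //.
have [[B hB] _] := dF.
have iF : P.-integrable setT (EFin \o (fun w => F (z + \sum_i X i w *: V i))).
  by apply: (@integrable_bounded_prob _ _ _ P _ B).
have mX2 i : measurable_fun setT (fun w => (1 + X i w ^+ 2 : R)).
  by apply: measurable_funD => //; exact: measurable_funX.
have intX i : \int[P]_w (1 + X i w ^+ 2) = 1 + var01 /\
  P.-integrable setT (EFin \o (fun w => 1 + X i w ^+ 2)).
  have [_ law] := Xiid.
  have i1 : gam.-integrable setT (EFin \o (fun s : R => 1)).
    by apply: (@integrable_bounded_prob _ _ _ gam _ 1) => // x; rewrite normr1.
  have i2 : gam.-integrable setT (EFin \o (fun s : R => 1 + s ^+ 2)).
    exact: (integrableD measurableT i1 (integrable_sqr01 (R := R))).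
  have eX : (\int[P]_w (1 + X i w ^+ 2)%:E = \int[gam]_s (1 + s ^+ 2)%:E)%E.
    apply: (@integral_std_normal _ _ _ _ (X i) (fun s => 1 + s ^+ 2)) => //.
    - exact: law.
    - by apply: measurable_funD => //; exact: measurable_funX.
    - by move=> y; rewrite addr_ge0// sqr_ge0.
  split.
    rewrite /Rintegral eX -/(Rintegral gam setT (fun s => 1 + s ^+ 2)).
    by rewrite RintegralD ?Rintegral_prob_cst//; exact: integrable_sqr01.
  apply/integrableP; split; first exact/measurable_EFinP.
  under eq_integral do rewrite /= ger0_norm ?addr_ge0 ?sqr_ge0//.
  rewrite eX -ge0_fin_numE; first exact: (integrable_fin_num measurableT i2).
  by apply: integral_ge0 => s _; rewrite lee_fin addr_ge0// sqr_ge0.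
have iY : P.-integrable setT (EFin \o Y).
  rewrite (_ : _ \o _ = (fun w => \sum_i (1 + X i w ^+ 2)%:E)%E).
    by apply: integrable_sum => // i _; case: (intX i).
  by apply/funext => w; rewrite /Y /= -sumEFin.
have eY : \int[P]_w Y w = \sum_(i : I) (1 + var01).
  by rewrite Rintegral_sum => [|i]; [apply: eq_bigr => i _|]; case: (intX i).
have [K hK] := gTs_gSs [seq V i | i <- index_enum I] dF.
apply/eqP; rewrite -subr_eq0; apply/eqP.
apply: (@eq0_le_div _ _ (C * (\sum_(i : I) (1 + var01)) + K)) => M M0.
have H := @integral_disc M (index_enum I) z finset.set0 (fun=> ord0) M0 (index_enum_uniq I).
rewrite big_set0 mul1r in H.
rewrite -(subrKA (gSs M [seq V i | i <- index_enum I] F z)) (le_trans (ler_normD _ _))//.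
rewrite mulrDl lerD//; last by rewrite distrC; exact: hK.
rewrite -H; last by move=> i _; rewrite inE.
under [X in _ - X]eq_Rintegral do rewrite big_set0 mul1r.
have iA : P.-integrable setT (EFin \o (fun w => F (z + arg M (index_enum I) w))).
  by apply: (@integrable_bounded_prob _ _ _ P _ B) => //; exact: measurable_arg.
rewrite -RintegralB//.
have iB := integrableB measurableT iF iA.
apply: (le_trans (le_normr_Rintegral _ iB)) => //.
rewrite -eY mulrAC -RintegralZl//.
apply: le_Rintegral => //.
- exact: (integrable_abse iB).
- exact: integrableZr.
by move=> w _; rewrite mulrAC; exact: near.
Unshelve. all: by end_near. Qed.

End transfer.

(** * A smooth step function *)

Section spline.
Context {R : realType}.
Implicit Types u t : R.

Definition pos_part u : R := Num.max u 0.

Lemma pos_partP u : (pos_part u = u /\ 0 <= u) \/ (pos_part u = 0 /\ u <= 0).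
Proof. by rewrite /pos_part; case: (lerP u 0) => h; [right|left; rewrite ltW]. Qed.

(** The distribution function of the sum of three independent uniform
    variables on [0, 1]: the simplest piecewise cubic function of class C^2
    that is 0 before 0 and 1 after 3.  The functions rho1 and rho2 below are its
    first two derivatives. *)
Definition rho u : R :=
  (pos_part u ^+ 3 - 3 * pos_part (u - 1) ^+ 3 + 3 * pos_part (u - 2) ^+ 3 - pos_part (u - 3) ^+ 3) / 6.
Definition rho1 u : R :=
  (pos_part u ^+ 2 - 3 * pos_part (u - 1) ^+ 2 + 3 * pos_part (u - 2) ^+ 2 - pos_part (u - 3) ^+ 2) / 2.
Definition rho2 u : R :=
  pos_part u - 3 * pos_part (u - 1) + 3 * pos_part (u - 2) - pos_part (u - 3).

Let five u : u <= 0 \/ (0 <= u /\ u <= 1) \/ (1 <= u /\ u <= 2) \/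
  (2 <= u /\ u <= 3) \/ 3 <= u.
Proof.
case: (lerP u 0) => h0; [by left|right].
case: (lerP u 1) => h1; [by left; split => //; exact: ltW|right].
case: (lerP u 2) => h2; [by left; split => //; exact: ltW|right].
by case: (lerP u 3) => h3; [left; split => //|right]; exact: ltW.
Qed.

Let pos_part0 u : u <= 0 -> pos_part u = 0. Proof. by rewrite /pos_part => h; apply/max_idPr. Qed.
Let pos_part_id u : 0 <= u -> pos_part u = u. Proof. by rewrite /pos_part => h; apply/max_idPl. Qed.

Lemma rho_le0 u : u <= 0 -> rho u = 0.
Proof. by move=> h; rewrite /rho !pos_part0 ?expr0n/= ?mulr0 ?subr0 ?addr0 ?mul0r//; lra. Qed.

Lemma rho_ge3 u : 3 <= u -> rho u = 1.
Proof. by move=> h; rewrite /rho !pos_part_id; [field|lra..]. Qed.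

Lemma rho_bound u : 0 <= rho u <= 1.
Proof.
rewrite /rho; case: (five u) => [h|[[h h']|[[h h']|[[h h']|h]]]].
- rewrite !pos_part0; nra.
- rewrite (pos_part_id h) !pos_part0; [|lra..]; apply/andP; split; nra.
- rewrite (pos_part_id (u := u)) ?(pos_part_id (u := u - 1)) ?(pos_part0 (u := u - 2)) ?(pos_part0 (u := u - 3)); [|lra..].
  have -> : u = 1 + (u - 1) by ring. have : 0 <= u - 1 <= 1 by lra.
  move: (u - 1) => x /andP[x0 x1]; apply/andP; split; nra.
- rewrite (pos_part_id (u := u)) ?(pos_part_id (u := u - 1)) ?(pos_part_id (u := u - 2)) ?(pos_part0 (u := u - 3)); [|lra..].
  have -> : u = 3 - (3 - u) by ring. have : 0 <= 3 - u <= 1 by lra.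
  move: (3 - u) => x /andP[x0 x1]; apply/andP; split; nra.
- by rewrite !pos_part_id; [|lra..]; apply/andP; split; nra.
Qed.

Lemma rho1_bound u : 0 <= rho1 u <= 1.
Proof.
rewrite /rho1; case: (five u) => [h|[[h h']|[[h h']|[[h h']|h]]]].
- rewrite !pos_part0; nra.
- rewrite (pos_part_id h) !pos_part0; [|lra..]; apply/andP; split; nra.
- rewrite (pos_part_id (u := u)) ?(pos_part_id (u := u - 1)) ?(pos_part0 (u := u - 2)) ?(pos_part0 (u := u - 3)); [|lra..].
  have -> : u = 1 + (u - 1) by ring. have : 0 <= u - 1 <= 1 by lra.
  move: (u - 1) => x /andP[x0 x1]; apply/andP; split; nra.
- rewrite (pos_part_id (u := u)) ?(pos_part_id (u := u - 1)) ?(pos_part_id (u := u - 2)) ?(pos_part0 (u := u - 3)); [|lra..].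
  have -> : u = 3 - (3 - u) by ring. have : 0 <= 3 - u <= 1 by lra.
  move: (3 - u) => x /andP[x0 x1]; apply/andP; split; nra.
- by rewrite !pos_part_id; [|lra..]; apply/andP; split; nra.
Qed.

Lemma rho2_bound u : `|rho2 u| <= 1.
Proof.
rewrite ler_norml /rho2; case: (five u) => [h|[[h h']|[[h h']|[[h h']|h]]]].
- rewrite !pos_part0; lra.
- rewrite (pos_part_id h) !pos_part0; lra.
- rewrite (pos_part_id (u := u)) ?(pos_part_id (u := u - 1)) ?(pos_part0 (u := u - 2)) ?(pos_part0 (u := u - 3)); lra.
- rewrite (pos_part_id (u := u)) ?(pos_part_id (u := u - 1)) ?(pos_part_id (u := u - 2)) ?(pos_part0 (u := u - 3)); lra.
- rewrite !pos_part_id; lra.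
Qed.

Let pos_part_lip u t : `|pos_part (u + t) - pos_part u| <= `|t|.
Proof.
have t1 := ler_norm t; have t2 := lerNnormlW (lexx `|t|).
rewrite ler_norml.
case: (pos_partP u) => -[-> h]; case: (pos_partP (u + t)) => -[-> h']; lra.
Qed.

Lemma rho2_lip u t : `|rho2 (u + t) - rho2 u| <= 8 * `|t|.
Proof.
have h0 := pos_part_lip u t; have h1 := pos_part_lip (u - 1) t.
have h2 := pos_part_lip (u - 2) t; have h3 := pos_part_lip (u - 3) t.
rewrite /rho2 -[u + t - 1]addrAC -[u + t - 2]addrAC -[u + t - 3]addrAC.
move: h0 h1 h2 h3; rewrite !ler_norml; lra.
Qed.

(** The cubic truncated power is of class C^2 with Lipschitz second
    derivative; the only case that needs work is that of a sign change between
    the two points. *)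
Let pos_part3_taylor u t :
  `|pos_part (u + t) ^+ 3 - pos_part u ^+ 3 - t * (3 * pos_part u ^+ 2) - t ^+ 2 / 2 * (6 * pos_part u)| <= 7 * `|t| ^+ 3.
Proof.
have [t0|t0] := lerP 0 t.
  rewrite (ger0_norm t0) ler_norml.
  case: (pos_partP u) => -[-> h]; case: (pos_partP (u + t)) => -[-> h']; apply/andP; split; try nra.
  have : u + t <= t by lra.
  move: (u + t) h' => x x0 xt.
  have : x ^+ 3 <= t ^+ 3 by rewrite lerXn2r// nnegrE.
  have : 0 <= t ^+ 3 by rewrite exprn_ge0.
  rewrite expr0n/=; lra.
rewrite (ltr0_norm t0); have {t0} : 0 < - t by lra.
have -> : u + t = u - (- t) by ring.
have -> : t ^+ 2 = (- t) ^+ 2 by rewrite sqrrN.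
have -> : t * (3 * pos_part u ^+ 2) = - ((- t) * (3 * pos_part u ^+ 2)) by ring.
move: (- t) => y y0; rewrite ler_norml.
have y3 : 0 <= y ^+ 3 by rewrite exprn_ge0// ltW.
case: (pos_partP u) => -[-> h]; case: (pos_partP (u - y)) => -[-> h']; try lra.
- have uy : u <= y by lra.
  have e1 : u ^+ 2 <= y * u by nra.
  have e2 : y * u <= y ^+ 2 by nra.
  have e3 : u ^+ 3 <= y ^+ 3 by rewrite lerXn2r// nnegrE// ltW.
  have e4 : 0 <= u ^+ 3 by rewrite exprn_ge0.
  have e5 : y * u ^+ 2 <= y ^+ 3.
    by rewrite [y ^+ 3]exprS ler_wpM2l ?(ltW y0)//; exact: (le_trans e1 e2).
  have e6 : y ^+ 2 * u <= y ^+ 3.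
    by rewrite [y ^+ 3]exprSr ler_wpM2l ?sqr_ge0.
  have e7 : 0 <= y * u ^+ 2 by rewrite mulr_ge0 ?sqr_ge0// ltW.
  have e8 : 0 <= y ^+ 2 * u by rewrite mulr_ge0 ?sqr_ge0.
  rewrite !expr0n/=.
  have -> : 0 - u ^+ 3 - - (y * (3 * u ^+ 2)) - y ^+ 2 / 2 * (6 * u) =
    - u ^+ 3 + 3 * (y * u ^+ 2) - 3 * (y ^+ 2 * u) by field.
  apply/andP; split; lra.
Qed.

Let pos_part2_taylor u t :
  `|pos_part (u + t) ^+ 2 - pos_part u ^+ 2 - t * (2 * pos_part u)| <= t ^+ 2.
Proof.
rewrite ler_norml.
case: (pos_partP u) => -[-> h]; case: (pos_partP (u + t)) => -[-> h']; apply/andP; split; nra.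
Qed.

Lemma rho_taylor u t :
  `|rho (u + t) - rho u - t * rho1 u - t ^+ 2 / 2 * rho2 u| <= 14 * `|t| ^+ 3.
Proof.
have h0 := pos_part3_taylor u t; have h1 := pos_part3_taylor (u - 1) t.
have h2 := pos_part3_taylor (u - 2) t; have h3 := pos_part3_taylor (u - 3) t.
rewrite /rho /rho1 /rho2 -[u + t - 1]addrAC -[u + t - 2]addrAC -[u + t - 3]addrAC.
move: h0 h1 h2 h3; rewrite !ler_norml.
move=> /andP[a0 b0] /andP[a1 b1] /andP[a2 b2] /andP[a3 b3].
have t3 : 0 <= `|t| ^+ 3 by rewrite exprn_ge0.
apply/andP; split; lra.
Qed.

(** Expansions are used for `|t| <= 1; beyond that the bounds on rho1
    suffice. *)
Lemma rho1_lip u t : `|rho1 (u + t) - rho1 u| <= 20 * `|t|.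
Proof.
have t0 := normr_ge0 t.
have [t1|t1] := lerP `|t| 1; last first.
  have := rho1_bound (u + t); have := rho1_bound u; rewrite ler_norml.
  by move=> /andP[? ?] /andP[? ?]; apply/andP; split; lra.
have h0 := pos_part2_taylor u t; have h1 := pos_part2_taylor (u - 1) t.
have h2 := pos_part2_taylor (u - 2) t; have h3 := pos_part2_taylor (u - 3) t.
have c := rho2_bound u.
have h4 : `|t * rho2 u| <= `|t| by rewrite normrM ler_piMr.
have t2 : t ^+ 2 <= `|t|.
  by rewrite -(ger0_norm (sqr_ge0 t)) normrX expr2 ler_piMr.
move: h4; rewrite /rho1 /rho2 -[u + t - 1]addrAC -[u + t - 2]addrAC -[u + t - 3]addrAC.
move: h0 h1 h2 h3; rewrite !ler_norml.
move=> /andP[a0 b0] /andP[a1 b1] /andP[a2 b2] /andP[a3 b3] /andP[a4 b4].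
apply/andP; split; lra.
Qed.

Lemma rho_lip u t : `|rho (u + t) - rho u| <= 20 * `|t|.
Proof.
have t0 := normr_ge0 t.
have [t1|t1] := lerP `|t| 1; last first.
  have := rho_bound (u + t); have := rho_bound u; rewrite ler_norml.
  by move=> /andP[? ?] /andP[? ?]; apply/andP; split; lra.
have h := rho_taylor u t.
have /andP[a b] := rho1_bound u; have c := rho2_bound u.
have -> : rho (u + t) - rho u = (rho (u + t) - rho u - t * rho1 u - t ^+ 2 / 2 * rho2 u) +
  (t * rho1 u + t ^+ 2 / 2 * rho2 u) by ring.
apply: (le_trans (ler_normD _ _)).
have h1 : `|t * rho1 u + t ^+ 2 / 2 * rho2 u| <= `|t| + `|t|.
  have p1 : `|t * rho1 u| <= `|t|.
    by rewrite (normrM t) ler_piMr// ger0_norm.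
  have t2 : t ^+ 2 <= `|t|.
    by rewrite -(ger0_norm (sqr_ge0 t)) normrX expr2 ler_piMr.
  have p2 : `|t ^+ 2 / 2 * rho2 u| <= `|t|.
    rewrite (normrM (t ^+ 2 / 2)) ger0_norm ?divr_ge0 ?sqr_ge0//.
    apply: (@le_trans _ _ (t ^+ 2 / 2 * 1)).
      by rewrite ler_wpM2l// divr_ge0 ?sqr_ge0.
    by have := sqr_ge0 t; lra.
  exact: (le_trans (ler_normD _ _) (lerD p1 p2)).
have h2 : `|t| ^+ 3 <= `|t| by rewrite exprS ler_piMr// exprn_ile1.
lra.
Qed.

End spline.

(** * Functions with a uniform second-order expansion *)

Section smooth.
Context {R : realType} {Z : lmodType R}.
Implicit Types (f : Z -> R) (z v w : Z).

(** The functions g v and h v stand for the first and second derivatives of f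
    along v.  Mixed second derivatives are absent: the comparison theorem only
    sees the sums of the h v over the two families of directions. *)
Record C2 (f : Z -> R) (g h : Z -> Z -> R) : Prop := MkC2 {
  C2f : dlip f;
  C2g : forall v, dlip (g v);
  C2h : forall v, dlip (h v);
  C2t : forall v, exists C : R, forall z s,
    `|f (z + s *: v) - f z - s * g v z - s ^+ 2 / 2 * h v z| <= C * `|s| ^+ 3 }.

Lemma dir_lip_ge0 v C f : dir_lip v C f -> 0 <= C.
Proof. by move=> h; have := le_trans (normr_ge0 _) (h 0 1); rewrite normr1 mulr1. Qed.

Lemma dlipM f1 f2 : dlip f1 -> dlip f2 -> dlip (fun z => f1 z * f2 z).
Proof.
move=> [[B1 b1] L1] [[B2 b2] L2]; split.
  by exists (B1 * B2) => z; rewrite normrM ler_pM.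
move=> v; have [C1 c1] := L1 v; have [C2 c2] := L2 v.
exists (C1 * B2 + B1 * C2) => z s.
have -> : f1 (z + s *: v) * f2 (z + s *: v) - f1 z * f2 z =
  (f1 (z + s *: v) - f1 z) * f2 (z + s *: v) + f1 z * (f2 (z + s *: v) - f2 z) by ring.
rewrite (le_trans (ler_normD _ _))// [leRHS]mulrDl lerD// normrM.
  by rewrite mulrAC ler_pM.
by rewrite -mulrA ler_pM.
Qed.

Lemma dlipD f1 f2 : dlip f1 -> dlip f2 -> dlip (fun z => f1 z + f2 z).
Proof.
move=> d1 d2; rewrite (_ : (fun _ => _) = (fun z => f1 z + 1 * f2 z)); first exact: dlip_lin.
by apply/funext => z; rewrite mul1r.
Qed.

Lemma dlip_comp (r : R -> R) (B L : R) (u : Z -> R) :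
  (forall x, `|r x| <= B) -> (forall x t, `|r (x + t) - r x| <= L * `|t|) ->
  (forall v, exists C : R, dir_lip v C u) -> dlip (fun z => r (u z)).
Proof.
move=> rB rL uL; split; first by exists B => z; exact: rB.
move=> v; have [C c] := uL v; exists (L * C) => z s.
have L0 : 0 <= L by have := le_trans (normr_ge0 _) (rL 0 1); rewrite normr1 mulr1.
have := rL (u z) (u (z + s *: v) - u z); rewrite [u z + _]addrC subrK => /le_trans; apply.
by rewrite -mulrA ler_wpM2l.
Qed.

Lemma norm_div_le (x k : R) : 1 <= k -> `|x / k| <= `|x|.
Proof.
move=> k1; have k0 : 0 < k by exact: lt_le_trans ltr01 k1.
by rewrite normrM normfV (gtr0_norm k0) ler_pdivrMr// ler_peMr.
Qed.

(** For 1 < `|s| every term is bounded by a multiple of `|s| ^ 3, so that only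
    small increments have to be examined. *)
Lemma taylor_local f (g h : Z -> R) v (C : R) : dlip f -> dlip g -> dlip h -> 0 <= C ->
  (forall z s, `|s| <= 1 ->
    `|f (z + s *: v) - f z - s * g z - s ^+ 2 / 2 * h z| <= C * `|s| ^+ 3) ->
  exists K : R, forall z s,
    `|f (z + s *: v) - f z - s * g z - s ^+ 2 / 2 * h z| <= K * `|s| ^+ 3.
Proof.
move=> [[Bf bf] _] [[Bg bg] _] [[Bh bh] _] C0 loc.
have Bf0 := le_trans (normr_ge0 _) (bf 0); have Bg0 := le_trans (normr_ge0 _) (bg 0).
have Bh0 := le_trans (normr_ge0 _) (bh 0).
exists (C + (Bf + Bf + Bg + Bh)) => z s; rewrite mulrDl.
have t3 : 0 <= `|s| ^+ 3 by rewrite exprn_ge0.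
have [s1|s1] := lerP `|s| 1.
  by apply: (le_trans (loc z s s1)); rewrite lerDl mulr_ge0// !addr_ge0.
have e1 : 1 <= `|s| ^+ 3 by rewrite exprn_ege1// ltW.
have e2 : `|s| <= `|s| ^+ 3 by rewrite exprS ler_peMr// exprn_ege1// ltW.
have e3 : `|s| ^+ 2 <= `|s| ^+ 3 by rewrite [leRHS]exprS ler_peMl ?exprn_ge0// ltW.
apply: (@le_trans _ _ ((Bf + Bf + Bg + Bh) * `|s| ^+ 3)); last by rewrite lerDr mulr_ge0.
have a1 : `|f (z + s *: v)| <= Bf * `|s| ^+ 3 by rewrite (le_trans (bf _))// ler_peMr.
have a2 : `|f z| <= Bf * `|s| ^+ 3 by rewrite (le_trans (bf _))// ler_peMr.
have a3 : `|s * g z| <= Bg * `|s| ^+ 3 by rewrite normrM mulrC ler_pM.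
have a4 : `|s ^+ 2 / 2 * h z| <= Bh * `|s| ^+ 3.
  rewrite normrM mulrC ler_pM// (le_trans _ e3)// -normrX.
  by rewrite norm_div_le// ler1n.
rewrite !mulrDl; apply: (le_trans (ler_normB _ _)); apply: lerD => //.
apply: (le_trans (ler_normB _ _)); apply: lerD => //.
by apply: (le_trans (ler_normB _ _)); apply: lerD.
Qed.

Lemma taylor_le1 f (g h : Z -> R) v : dlip f -> dlip g -> dlip h ->
  (exists C : R, forall z s, `|s| <= 1 ->
    `|f (z + s *: v) - f z - s * g z - s ^+ 2 / 2 * h z| <= C * `|s| ^+ 3) ->
  exists K : R, forall z s,
    `|f (z + s *: v) - f z - s * g z - s ^+ 2 / 2 * h z| <= K * `|s| ^+ 3.
Proof.
move=> df dg dh [C hC]; apply: (@taylor_local f g h v C) => //.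
by have := le_trans (normr_ge0 _) (hC 0 1 _); rewrite normr1 expr1n mulr1; apply.
Qed.

Lemma C2M f1 g1 h1 f2 g2 h2 : C2 f1 g1 h1 -> C2 f2 g2 h2 ->
  C2 (fun z => f1 z * f2 z) (fun v z => g1 v z * f2 z + f1 z * g2 v z)
     (fun v z => h1 v z * f2 z + (2 * (g1 v z * g2 v z) + f1 z * h2 v z)).
Proof.
move=> [F1 G1 H1 T1] [F2 G2 H2 T2].
have dg v : dlip (fun z => g1 v z * f2 z + f1 z * g2 v z).
  by apply: dlipD; apply: dlipM.
have dh v : dlip (fun z => h1 v z * f2 z + (2 * (g1 v z * g2 v z) + f1 z * h2 v z)).
  apply: dlipD; first exact: dlipM.
  apply: dlipD; last exact: dlipM.
  by apply: dlipM; [exact: dlip_cst|exact: dlipM].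
split => //; first exact: dlipM.
move=> v; apply: taylor_le1 => //; first exact: dlipM.
have [[A0 a0] _] := F1; have [[B0 b0] _] := F2.
have [[A1 a1] _] := G1 v; have [[B1 b1] _] := G2 v.
have [[A2 a2] _] := H1 v; have [[B2 b2] _] := H2 v.
have [C c] := T1 v; have [D dd] := T2 v.
exists (A1 * B2 + A2 * B1 + A2 * B2 + C * B0 + (A0 + A1 + A2) * D) => z s s1.
have p0 := a0 z; have q0 := b0 (z + s *: v).
have p1 := a1 z; have q1 := b1 z; have p2 := a2 z; have q2 := b2 z.
have r1 := c z s; have r2 := dd z s.
set x1 := f1 (z + s *: v) - f1 z - s * g1 v z - s ^+ 2 / 2 * h1 v z in r1.
set x2 := f2 (z + s *: v) - f2 z - s * g2 v z - s ^+ 2 / 2 * h2 v z in r2.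
have -> : f1 (z + s *: v) * f2 (z + s *: v) - f1 z * f2 z -
   s * (g1 v z * f2 z + f1 z * g2 v z) -
   s ^+ 2 / 2 * (h1 v z * f2 z + (2 * (g1 v z * g2 v z) + f1 z * h2 v z)) =
   s ^+ 3 / 2 * (g1 v z * h2 v z) + s ^+ 3 / 2 * (h1 v z * g2 v z) +
   s ^+ 4 / 4 * (h1 v z * h2 v z) + x1 * f2 (z + s *: v) +
   (f1 z + s * g1 v z + s ^+ 2 / 2 * h1 v z) * x2.
  by rewrite /x1 /x2; field.
have s0 := normr_ge0 s.
have s3 : 0 <= `|s| ^+ 3 by rewrite exprn_ge0.
have h3 : `|s ^+ 3 / 2| <= `|s| ^+ 3.
  by rewrite -normrX norm_div_le// ler1n.
have h4 : `|s ^+ 4 / 4| <= `|s| ^+ 3.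
  rewrite (le_trans (norm_div_le _ _)) ?ler1n// normrX.
  by rewrite exprS ler_piMl.
have h2' : `|s ^+ 2 / 2| <= 1.
  by rewrite (le_trans (norm_div_le _ _)) ?ler1n// normrX exprn_ile1.
rewrite [leRHS]mulrDl [X in _ <= X + _]mulrDl [X in _ <= X + _ + _]mulrDl [X in _ <= X + _ + _ + _]mulrDl.
apply: (le_trans (ler_normD _ _)); apply: lerD.
  apply: (le_trans (ler_normD _ _)); apply: lerD.
    apply: (le_trans (ler_normD _ _)); apply: lerD.
      apply: (le_trans (ler_normD _ _)); apply: lerD.
        by rewrite !normrM -!normrM mulrC normrM ler_pM// normrM ler_pM.
      by rewrite mulrC normrM ler_pM// normrM ler_pM.
    by rewrite mulrC normrM ler_pM// normrM ler_pM.
  by rewrite normrM mulrAC ler_pM.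
rewrite normrM -[leRHS]mulrA ler_pM//.
apply: (le_trans (ler_normD _ _)); apply: lerD.
  apply: (le_trans (ler_normD _ _)); apply: lerD => //.
  by rewrite normrM -[leRHS]mul1r ler_pM.
by rewrite normrM -[leRHS]mul1r ler_pM.
Qed.

(** With D the increment of u, the remainder splits into the remainder of rho
    at D, the remainder of u times rho1, and
    rho2 (u z) * (D ^ 2 - (s g) ^ 2) / 2, where D - s g is of order s ^ 2 and
    D + s g of order s. *)
Lemma C2_rho (u : Z -> R) (g h : Z -> Z -> R) :
  (forall v, exists C : R, dir_lip v C u) ->
  (forall v, dlip (g v)) -> (forall v, dlip (h v)) ->
  (forall v, exists C : R, forall z s,
    `|u (z + s *: v) - u z - s * g v z - s ^+ 2 / 2 * h v z| <= C * `|s| ^+ 3) ->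
  C2 (fun z => rho (u z)) (fun v z => rho1 (u z) * g v z)
     (fun v z => rho2 (u z) * (g v z * g v z) + rho1 (u z) * h v z).
Proof.
move=> uL dg dh uT.
have d0 : dlip (fun z => rho (u z)).
  apply: (@dlip_comp _ 1 20) => // [x|x t]; last exact: rho_lip.
  by have /andP[? ?] := rho_bound x; rewrite ger0_norm.
have d1 : dlip (fun z => rho1 (u z)).
  apply: (@dlip_comp _ 1 20) => // [x|x t]; last exact: rho1_lip.
  by have /andP[? ?] := rho1_bound x; rewrite ger0_norm.
have d2 : dlip (fun z => rho2 (u z)).
  by apply: (@dlip_comp _ 1 8) => // [x|x t]; [exact: rho2_bound|exact: rho2_lip].
have D1 v : dlip (fun z => rho1 (u z) * g v z) by exact: dlipM.
have D2 v : dlip (fun z => rho2 (u z) * (g v z * g v z) + rho1 (u z) * h v z).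
  by apply: dlipD; apply: dlipM => //; exact: dlipM.
split => // v; apply: taylor_le1 => //.
have [L hL] := uL v; have [C hC] := uT v.
have L0 := dir_lip_ge0 hL.
have [[G hG] _] := dg v; have [[H hH] _] := dh v.
have G0 := le_trans (normr_ge0 _) (hG 0); have H0 := le_trans (normr_ge0 _) (hH 0).
have C0 : 0 <= C by have := le_trans (normr_ge0 _) (hC 0 1); rewrite normr1 expr1n mulr1.
exists (14 * L ^+ 3 + C + (H + C) * (L + G)) => z s s1.
set D := u (z + s *: v) - u z.
have s0 := normr_ge0 s.
have eD : u (z + s *: v) = u z + D by rewrite /D [u z + _]addrC subrK.
have r0 := rho_taylor (u z) D.
have rU := hC z s; rewrite -/D in rU.
set x0 := (X in `|X| <= _) in r0.
set xU := (X in `|X| <= _) in rU.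
have bD : `|D| <= L * `|s| by exact: hL.
have -> : rho (u (z + s *: v)) - rho (u z) - s * (rho1 (u z) * g v z) -
    s ^+ 2 / 2 * (rho2 (u z) * (g v z * g v z) + rho1 (u z) * h v z) =
    x0 + rho1 (u z) * xU + rho2 (u z) * ((D - s * g v z) * (D + s * g v z) / 2).
  by rewrite /x0 /xU -/D eD; field.
have /andP[b0 b1] := rho1_bound (u z); have b2 := rho2_bound (u z).
have e1 : `|x0| <= 14 * L ^+ 3 * `|s| ^+ 3.
  apply: (le_trans r0); rewrite -mulrA ler_wpM2l// -exprMn lerXn2r// nnegrE//.
  by rewrite mulr_ge0.
have e2 : `|rho1 (u z) * xU| <= C * `|s| ^+ 3.
  by rewrite normrM -[leRHS]mul1r ler_pM// ger0_norm.
have f1 : `|D - s * g v z| <= (H + C) * `|s| ^+ 2.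
  have -> : D - s * g v z = xU + s ^+ 2 / 2 * h v z by rewrite /xU; ring.
  rewrite addrC (le_trans (ler_normD _ _))// mulrDl lerD//.
    by rewrite normrM mulrC ler_pM// -normrX norm_div_le// ler1n.
  by apply: (le_trans rU); rewrite ler_wpM2l// [leLHS]exprS ler_piMl ?exprn_ge0.
have f2 : `|D + s * g v z| <= (L + G) * `|s|.
  rewrite (le_trans (ler_normD _ _))// mulrDl lerD// normrM mulrC ler_wpM2r//.
have e3 : `|rho2 (u z) * ((D - s * g v z) * (D + s * g v z) / 2)| <= (H + C) * (L + G) * `|s| ^+ 3.
  rewrite normrM -[leRHS]mul1r ler_pM//.
  have -> : (H + C) * (L + G) * `|s| ^+ 3 = ((H + C) * `|s| ^+ 2) * ((L + G) * `|s|) by ring.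
  rewrite (le_trans (norm_div_le _ _)) ?ler1n//.
  by rewrite normrM ler_pM.
rewrite [leRHS]mulrDl [X in _ <= X + _]mulrDl.
apply: (le_trans (ler_normD _ _)); apply: lerD => //.
by apply: (le_trans (ler_normD _ _)); apply: lerD.
Qed.

End smooth.

(** * The smoothed Euclidean norm *)

Section cs.
Context {R : realType}.

Lemma cauchy_schwarz (I : finType) (a b : I -> R) :
  (\sum_i a i * b i) ^+ 2 <= (\sum_i a i ^+ 2) * (\sum_i b i ^+ 2).
Proof.
set A := \sum_i a i ^+ 2; set B := \sum_i b i ^+ 2; set D := \sum_i a i * b i.
have B0 : 0 <= B by apply: sumr_ge0 => i _; exact: sqr_ge0.
have [B1|B1] := eqVneq B 0.
  have b0 i : b i = 0.
    have /eqP := B1; rewrite psumr_eq0; last by move=> j _; exact: sqr_ge0.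
    by move=> /allP/(_ i (mem_index_enum i))/=; rewrite sqrf_eq0 => /eqP.
  by rewrite /D B1 mulr0 big1 ?expr0n// => i _; rewrite b0 mulr0.
have Bp : 0 < B by rewrite lt_neqAle eq_sym B1.
have : 0 <= \sum_i (B * a i - D * b i) ^+ 2 by apply: sumr_ge0 => i _; exact: sqr_ge0.
have -> : \sum_i (B * a i - D * b i) ^+ 2 = B * (A * B - D ^+ 2).
  transitivity (\sum_i (B ^+ 2 * a i ^+ 2 - 2 * B * D * (a i * b i) + D ^+ 2 * b i ^+ 2)).
    by apply: eq_bigr => i _; ring.
  rewrite big_split sumrB/= -!mulr_sumr -/A -/B -/D; ring.
by rewrite pmulr_rge0// subr_ge0.
Qed.

End cs.

Section normpart.
Context {R : realType} {Z : lmodType R} {I : finType}.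
Variables (L : I -> Z -> R) (w : Z -> R) (tau : R).
Hypothesis Llin : forall i z s v, L i (z + s *: v) = L i z + s * L i v.
Hypothesis wlin : forall z s v, w (z + s *: v) = w z + s * w v.
Implicit Types (z v : Z).

(** The squared Euclidean norm of the image (L_i z)_i of z; the forms L_i later
    read off one row of a matrix. *)
Definition sqn z := \sum_i L i z ^+ 2.
Definition dot z v := \sum_i L i z * L i v.
(** The Euclidean norm is not differentiable at 0; sqrt (1 + |.|^2) is smooth,
    1-Lipschitz, and exceeds the norm by at most 1, which is negligible against
    the order sqrt n of the quantities compared. *)
Definition snorm z := Num.sqrt (1 + sqn z).
Definition seminorm v := Num.sqrt (sqn v).

Lemma sqn_ge0 z : 0 <= sqn z. Proof. by apply: sumr_ge0 => i _; exact: sqr_ge0. Qed.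

Lemma snorm2 z : snorm z ^+ 2 = 1 + sqn z.
Proof. by rewrite sqr_sqrtr// addr_ge0// sqn_ge0. Qed.

Lemma seminorm2 z : seminorm z ^+ 2 = sqn z.
Proof. by rewrite sqr_sqrtr// sqn_ge0. Qed.

Lemma seminorm_ge0 z : 0 <= seminorm z. Proof. exact: sqrtr_ge0. Qed.

Lemma snorm_ge1 z : 1 <= snorm z.
Proof. by rewrite -[X in X <= _]sqrtr1 ler_wsqrtr// lerDl sqn_ge0. Qed.

Lemma snorm_gt0 z : 0 < snorm z. Proof. exact: lt_le_trans ltr01 (snorm_ge1 z). Qed.

Lemma sqn_shift z s v : sqn (z + s *: v) = sqn z + 2 * s * dot z v + s ^+ 2 * sqn v.
Proof.
rewrite /sqn /dot !mulr_sumr -!big_split; apply: eq_bigr => i _ /=.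
by rewrite Llin; ring.
Qed.

Lemma dot_shift z s v u : dot (z + s *: v) u = dot z u + s * dot v u.
Proof.
rewrite /dot mulr_sumr -big_split; apply: eq_bigr => i _ /=; by rewrite Llin; ring.
Qed.

Lemma dot_seminorm z v : `|dot z v| <= seminorm z * seminorm v.
Proof.
rewrite -ler_sqr ?nnegrE ?mulr_ge0 ?seminorm_ge0// real_normK ?num_real//.
by rewrite exprMn !seminorm2; exact: cauchy_schwarz.
Qed.

Lemma seminorm_le_snorm z : seminorm z <= snorm z.
Proof. by rewrite ler_wsqrtr// lerDr. Qed.

Lemma dot_snorm z v : `|dot z v| <= snorm z * seminorm v.
Proof. by rewrite (le_trans (dot_seminorm z v))// ler_wpM2r ?seminorm_ge0 ?seminorm_le_snorm. Qed.

Lemma snorm_lip v : dir_lip v (seminorm v) snorm.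
Proof.
have half z s : snorm (z + s *: v) <= snorm z + seminorm v * `|s|.
  have a0 : 0 <= snorm z + seminorm v * `|s| by rewrite addr_ge0 ?mulr_ge0 ?seminorm_ge0// ltW ?snorm_gt0.
  rewrite -ler_sqr ?nnegrE ?(ltW (snorm_gt0 _))// snorm2 sqn_shift.
  have := dot_snorm z v; have := snorm2 z; have := seminorm2 v => e1 e2 h.
  have -> : (snorm z + seminorm v * `|s|) ^+ 2 = 1 + sqn z + 2 * `|s| * (snorm z * seminorm v) + s ^+ 2 * sqn v.
    by rewrite -e2 -e1 -[s ^+ 2]real_normK ?num_real//; ring.
  have h1 : s * dot z v <= `|s| * (snorm z * seminorm v).
    by rewrite (le_trans (ler_norm _))// normrM ler_wpM2l.
  by move: h1; lra.
move=> z s; have h1 := half z s; have := half (z + s *: v) (- s).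
rewrite scaleNr addrK normrN => h2.
by rewrite ler_norml; apply/andP; split; lra.
Qed.

Definition dsnorm v z := dot z v / snorm z.
(** First derivative <z, v> / N and second derivative
    |v|^2 / N - <z, v>^2 / N^3 of N = sqrt (1 + |z|^2), the latter written in
    terms of the former. *)
Definition ddsnorm v z := sqn v / snorm z - dsnorm v z * dsnorm v z / snorm z.

Lemma dsnorm_bound v z : `|dsnorm v z| <= seminorm v.
Proof.
rewrite /dsnorm normrM normfV (gtr0_norm (snorm_gt0 z)) ler_pdivrMr ?snorm_gt0// mulrC.
exact: dot_snorm.
Qed.

Lemma snormV_bound z : 0 <= (snorm z)^-1 <= 1.
Proof. by rewrite invr_ge0 ltW ?snorm_gt0//= invf_le1 ?snorm_gt0// snorm_ge1. Qed.

Lemma dlip_snormV : dlip (fun z => (snorm z)^-1).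
Proof.
split.
  by exists 1 => z; have /andP[? ?] := snormV_bound z; rewrite ger0_norm.
move=> v; exists (seminorm v) => z s.
have n0 := snorm_gt0 z; have n1 := snorm_gt0 (z + s *: v).
have -> : (snorm (z + s *: v))^-1 - (snorm z)^-1 = (snorm z - snorm (z + s *: v)) * ((snorm z)^-1 * (snorm (z + s *: v))^-1).
  by field; rewrite !gt_eqF.
rewrite normrM distrC -[leRHS]mulr1 ler_pM//; first exact: snorm_lip.
have /andP[? ?] := snormV_bound z; have /andP[? ?] := snormV_bound (z + s *: v).
by rewrite ger0_norm ?mulr_ge0// mulr_ile1.
Qed.

Lemma dlip_dsnorm v : dlip (dsnorm v).
Proof.
split; first by exists (seminorm v) => z; exact: dsnorm_bound.
move=> u; exists (`|dot u v| + seminorm v * seminorm u) => z s.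
have n0 := snorm_gt0 z; have n1 := snorm_gt0 (z + s *: u).
have -> : dsnorm v (z + s *: u) - dsnorm v z =
   s * dot u v * (snorm (z + s *: u))^-1 - dsnorm v z * (snorm (z + s *: u) - snorm z) * (snorm (z + s *: u))^-1.
  by rewrite /dsnorm dot_shift; field; rewrite !gt_eqF.
have /andP[i0 i1] := snormV_bound (z + s *: u).
rewrite (le_trans (ler_normB _ _))// mulrDl lerD//.
  by rewrite normrM (ger0_norm i0) (normrM s) [leRHS]mulrC ler_piMr// mulr_ge0.
rewrite normrM (ger0_norm i0) (@le_trans _ _ (`|dsnorm v z * (snorm (z + s *: u) - snorm z)|))//.
  by rewrite ler_piMr.
by rewrite normrM -mulrA ler_pM//; [exact: dsnorm_bound|exact: snorm_lip].
Qed.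

Lemma ddsnorm_bound v z : 0 <= ddsnorm v z <= seminorm v ^+ 2.
Proof.
have /andP[i0 i1] := snormV_bound z; have b := dsnorm_bound v z.
have b2 : dsnorm v z * dsnorm v z <= seminorm v ^+ 2.
  by rewrite -expr2 -[leLHS]real_normK ?num_real// lerXn2r// nnegrE ?seminorm_ge0.
rewrite /ddsnorm -seminorm2 -mulrBl mulr_ge0 ?subr_ge0//=.
rewrite (@le_trans _ _ (seminorm v ^+ 2 - dsnorm v z * dsnorm v z))//.
  by rewrite ler_piMr// subr_ge0.
by rewrite gerBl -expr2 sqr_ge0.
Qed.

Lemma dlip_ddsnorm v : dlip (ddsnorm v).
Proof.
have -> : ddsnorm v = (fun z => sqn v * (snorm z)^-1 + (-1) * ((dsnorm v z * dsnorm v z) * (snorm z)^-1)).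
  by apply/funext => z; rewrite /ddsnorm mulN1r.
apply: dlipD; apply: dlipM; try exact: dlip_cst; try exact: dlip_snormV.
by apply: dlipM; [apply: dlipM; exact: dlip_dsnorm|exact: dlip_snormV].
Qed.

(** Put x = |v| |s|.  If x > 1 each term is at most x ^ 3.  Otherwise multiply
    the remainder D by the conjugate sum N(z + s v) + N(z) + p + k / 2, which is
    at least 1: the product is a difference of squares in which everything up
    to order 2 cancels. *)
Lemma snorm_taylor v z s :
  `|snorm (z + s *: v) - snorm z - s * dsnorm v z - s ^+ 2 / 2 * ddsnorm v z| <= 5 * seminorm v ^+ 3 * `|s| ^+ 3.
Proof.
have n0 := snorm_gt0 z; have n1 := snorm_ge1 (z + s *: v); have n2 := snorm_ge1 z.
have /andP[k0 k1] := ddsnorm_bound v z; have b := dsnorm_bound v z; have v0 := seminorm_ge0 v.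
have s0 := normr_ge0 s.
set x := seminorm v * `|s|; have x0 : 0 <= x by rewrite mulr_ge0.
have -> : 5 * seminorm v ^+ 3 * `|s| ^+ 3 = 5 * x ^+ 3 by rewrite /x; ring.
have bx : `|s * dsnorm v z| <= x by rewrite normrM /x mulrC ler_wpM2r.
have hx : s ^+ 2 * ddsnorm v z <= x ^+ 2.
  by rewrite /x exprMn mulrC real_normK ?num_real// ler_wpM2r// sqr_ge0.
have hx0 : 0 <= s ^+ 2 * ddsnorm v z by rewrite mulr_ge0// sqr_ge0.
have [x1|x1] := lerP x 1; last first.
  have l := snorm_lip v z s; rewrite -/x in l.
  have e2 : x <= x ^+ 3 by rewrite exprS ler_peMr// exprn_ege1// ltW.
  have e3 : x ^+ 2 <= x ^+ 3 by rewrite [leRHS]exprS ler_peMl ?exprn_ge0// ltW.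
  move: l bx; rewrite !ler_norml => /andP[? ?] /andP[? ?]; apply/andP; split; lra.
set k := s ^+ 2 * ddsnorm v z; set p := s * dsnorm v z.
have -> : s ^+ 2 / 2 * ddsnorm v z = k / 2 by rewrite /k; ring.
set D := snorm (z + s *: v) - snorm z - p - k / 2.
have eq : D * (snorm (z + s *: v) + snorm z + p + k / 2) = - (k * p + k ^+ 2 / 4).
  have -> : D * (snorm (z + s *: v) + snorm z + p + k / 2) =
    snorm (z + s *: v) ^+ 2 - (snorm z + p + k / 2) ^+ 2 by rewrite /D; ring.
  have eN : snorm (z + s *: v) ^+ 2 = snorm z ^+ 2 + 2 * s * dot z v + s ^+ 2 * sqn v.
    by rewrite !snorm2 sqn_shift; ring.
  rewrite eN.
  have ep : s * dot z v = p * snorm z by rewrite /p /dsnorm; field; rewrite gt_eqF.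
  have ek : k * snorm z = s ^+ 2 * sqn v - p ^+ 2.
    by rewrite /k /ddsnorm /p /dsnorm; field; rewrite gt_eqF.
  have -> : s ^+ 2 * sqn v = k * snorm z + p ^+ 2 by rewrite ek; ring.
  have -> : 2 * s * dot z v = 2 * (p * snorm z) by rewrite -ep; ring.
  by field.
have p1 : - x <= p by move: bx; rewrite ler_norml => /andP[].
have den : 1 <= snorm (z + s *: v) + snorm z + p + k / 2 by rewrite -/k in hx0; lra.
have : `|D| * 1 <= `|- (k * p + k ^+ 2 / 4)|.
  by rewrite -eq normrM ler_wpM2l// (le_trans den)// ler_norm.
rewrite mulr1 normrN => /le_trans; apply.
apply: (le_trans (ler_normD _ _)).
have h1 : `|k * p| <= x ^+ 3.
  by rewrite normrM ger0_norm// [leRHS]exprSr ler_pM.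
have h2 : `|k ^+ 2 / 4| <= x ^+ 3.
  rewrite (le_trans (norm_div_le _ _)) ?ler1n// ger0_norm ?sqr_ge0//.
  apply: (@le_trans _ _ (x ^+ 2 * x ^+ 2)); first by rewrite expr2 ler_pM.
  by rewrite [leRHS]exprSr ler_wpM2l ?sqr_ge0// expr2 ler_piMr.
have : 0 <= x ^+ 3 by rewrite exprn_ge0.
lra.
Qed.

Definition margin z := snorm z + w z - tau.

Lemma C2_margin : C2 (fun z => rho (margin z)) (fun v z => rho1 (margin z) * (dsnorm v z + w v))
  (fun v z => rho2 (margin z) * ((dsnorm v z + w v) * (dsnorm v z + w v)) + rho1 (margin z) * ddsnorm v z).
Proof.
have w0 z s v : w (z + s *: v) - w z = s * w v by rewrite wlin addrC addKr.
apply: (@C2_rho _ _ margin (fun v z => dsnorm v z + w v) ddsnorm).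
- move=> v; exists (seminorm v + `|w v|) => z s.
  have -> : margin (z + s *: v) - margin z = (snorm (z + s *: v) - snorm z) + s * w v.
    by rewrite -(w0 z) /margin; ring.
  rewrite (le_trans (ler_normD _ _))// mulrDl lerD//; first exact: snorm_lip.
  by rewrite normrM mulrC.
- by move=> v; apply: dlipD; [exact: dlip_dsnorm|exact: dlip_cst].
- exact: dlip_ddsnorm.
- move=> v; exists (5 * seminorm v ^+ 3) => z s.
  have -> : margin (z + s *: v) - margin z - s * (dsnorm v z + w v) - s ^+ 2 / 2 * ddsnorm v z =
     snorm (z + s *: v) - snorm z - s * dsnorm v z - s ^+ 2 / 2 * ddsnorm v z.
    by rewrite mulrDr -(w0 z s) /margin; ring.
  exact: snorm_taylor.
Qed.

End normpart.

(** * Gordon's comparison *)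

Section gordon.
Context {R : realType} (r m n : nat).
Variable X : 'I_r -> 'cV[R]_n.
Hypothesis Xunit : forall a, \sum_j X a j 0 ^+ 2 = 1.
Variable tau : R.

Local Notation Z := ('M[R]_(r, m) * 'cV[R]_r)%type.
Implicit Types (z v : Z) (a b : 'I_r).

Definition rowV a (i : 'I_m) z : R := z.1 a i.
Definition rowW a z : R := z.2 a 0.

Lemma rowV_lin a i z s v : rowV a i (z + s *: v) = rowV a i z + s * rowV a i v.
Proof. by rewrite /rowV !mxE. Qed.

Lemma rowW_lin a z s v : rowW a (z + s *: v) = rowW a z + s * rowW a v.
Proof. by rewrite /rowW !mxE. Qed.

(** A point z = (V, w) consists of one vector V_a of R^m and one scalar w_a for
    each index a.  Independent normal coefficients A_ij along the v_ij together
    with g along v_0 produce V_a = A x_a and w_a = g; independent normal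
    coefficients along the u_i and u'_j produce V_a = g (the same vector for
    all a) and w_a = <h, x_a>.  These are Gordon's two processes. *)
Definition vL (ij : 'I_m * 'I_n) : Z :=
  (\matrix_(a, k) (X a ij.2 0 * (k == ij.1)%:R), 0).
Definition v0 : Z := (0, const_mx 1).
Definition uV (i : 'I_m) : Z := (\matrix_(a, k) (k == i)%:R, 0).
Definition uW (j : 'I_n) : Z := (0, \col_a X a j 0).

Definition dirsL : seq Z := v0 :: [seq vL ij | ij <- index_enum ('I_m * 'I_n)%type].
Definition dirsR : seq Z :=
  [seq uV i | i <- index_enum 'I_m] ++ [seq uW j | j <- index_enum 'I_n].

(* The factor of index a, its derivative along v (gg is the derivative of its
   margin) and its second derivative along v. *)
Let f a z := rho (margin (rowV a) (rowW a) tau z).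
Let gg a v z := dsnorm (rowV a) v z + rowW a v.
Let g a v z := rho1 (margin (rowV a) (rowW a) tau z) * gg a v z.
Let h a v z := rho2 (margin (rowV a) (rowW a) tau z) * (gg a v z * gg a v z) +
  rho1 (margin (rowV a) (rowW a) tau z) * ddsnorm (rowV a) v z.

Let C2a a : C2 (f a) (g a) (h a).
Proof. by apply: C2_margin; [exact: rowV_lin|exact: rowW_lin]. Qed.

(** A smooth lower approximation of the indicator that every margin is
    positive; prodG and prodH are its first and second derivatives in a
    direction v, by the Leibniz rule. *)
Fixpoint prodF (s : seq 'I_r) z : R := if s is a :: s' then f a z * prodF s' z else 1.
Fixpoint prodG (s : seq 'I_r) v z : R :=
  if s is a :: s' then g a v z * prodF s' z + f a z * prodG s' v z else 0.
Fixpoint prodH (s : seq 'I_r) v z : R :=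
  if s is a :: s' then h a v z * prodF s' z +
    (2 * (g a v z * prodG s' v z) + f a z * prodH s' v z) else 0.

Let C2prod s : C2 (prodF s) (prodG s) (prodH s).
Proof.
elim: s => [|a s IH] /=; last exact: C2M.
split=> [|v|v|v]; try exact: dlip_cst.
by exists 0 => z t; rewrite subrr !mulr0 !subr0 normr0 mul0r.
Qed.

Lemma dlip_prodF s : dlip (prodF s). Proof. by case: (C2prod s). Qed.

Let yy a z (i : 'I_m) : R := z.1 a i / snorm (rowV a) z.

Let ggvL a z ij : gg a (vL ij) z = yy a z ij.1 * X a ij.2 0.
Proof.
rewrite /gg /dsnorm /rowW /= mxE addr0 /dot /rowV /=.
rewrite (bigD1 ij.1)//= big1 => [|k kj]; last by rewrite mxE (negbTE kj) !mulr0.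
by rewrite mxE eqxx mulr1 addr0 /yy; ring.
Qed.

Let ggv0 a z : gg a v0 z = 1.
Proof.
rewrite /gg /dsnorm /rowW /= mxE /dot big1 ?mul0r ?add0r// => i _.
by rewrite /rowV /= mxE mulr0.
Qed.

Let gguV a z i : gg a (uV i) z = yy a z i.
Proof.
rewrite /gg /dsnorm /rowW /= mxE addr0 /dot /rowV /=.
rewrite (bigD1 i)//= big1 => [|k kj]; last by rewrite mxE (negbTE kj) mulr0.
by rewrite mxE eqxx mulr1 addr0.
Qed.

Let gguW a z j : gg a (uW j) z = X a j 0.
Proof.
rewrite /gg /dsnorm /rowW /= mxE /dot big1 ?mul0r ?add0r// => i _.
by rewrite /rowV /= mxE mulr0.
Qed.

Let dsnormE a v z : dsnorm (rowV a) v z = gg a v z - rowW a v. Proof. by rewrite /gg addrK. Qed.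

Let dsnorm_v0 a z : dsnorm (rowV a) v0 z = 0.
Proof. by rewrite dsnormE ggv0 /rowW /= mxE subrr. Qed.

Let dsnorm_uW a z j : dsnorm (rowV a) (uW j) z = 0.
Proof. by rewrite dsnormE gguW /rowW /= mxE subrr. Qed.

Let dsnorm_uV a z i : dsnorm (rowV a) (uV i) z = yy a z i.
Proof. by rewrite dsnormE gguV /rowW /= mxE subr0. Qed.

Let dsnorm_vL a z ij : dsnorm (rowV a) (vL ij) z = yy a z ij.1 * X a ij.2 0.
Proof. by rewrite dsnormE ggvL /rowW /= mxE subr0. Qed.

Let sqn_vL a ij : sqn (rowV a) (vL ij) = X a ij.2 0 ^+ 2.
Proof.
rewrite /sqn /rowV (bigD1 ij.1)//= big1 => [|k kj]; last by rewrite mxE (negbTE kj) mulr0 expr0n.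
by rewrite mxE eqxx mulr1 addr0.
Qed.

Let sqn_v0 a : sqn (rowV a) v0 = 0.
Proof. by rewrite /sqn /rowV big1 // => k _; rewrite mxE expr0n. Qed.

Let sqn_uV a i : sqn (rowV a) (uV i) = 1.
Proof.
rewrite /sqn /rowV (bigD1 i)//= big1 => [|k kj]; last by rewrite mxE (negbTE kj) expr0n.
by rewrite mxE eqxx expr1n addr0.
Qed.

Let sqn_uW a j : sqn (rowV a) (uW j) = 0.
Proof. by rewrite /sqn /rowV big1 // => k _; rewrite mxE expr0n. Qed.

Let xx a b : R := \sum_j X a j 0 * X b j 0.
Let yd a b z : R := \sum_i yy a z i * yy b z i.

Let sumL_gg a b z : \sum_(v <- dirsL) gg a v z * gg b v z = 1 + yd a b z * xx a b.
Proof.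
rewrite big_cons !ggv0 mulr1 big_map; congr (_ + _).
rewrite /yd /xx mulr_suml; under [RHS]eq_bigr do rewrite mulr_sumr.
by rewrite pair_bigA/=; apply: eq_bigr => ij _; rewrite !ggvL; ring.
Qed.

Let sumR_gg a b z : \sum_(v <- dirsR) gg a v z * gg b v z = yd a b z + xx a b.
Proof.
rewrite big_cat !big_map/=; congr (_ + _); apply: eq_bigr => i _; first by rewrite !gguV.
by rewrite !gguW.
Qed.

Let xx_le1 a b : xx a b <= 1.
Proof.
have := cauchy_schwarz (fun j => X a j 0) (fun j => X b j 0).
rewrite !Xunit mulr1 -/(xx a b) => h1.
have := sqr_ge0 (xx a b - 1); nra.
Qed.

Let yd_le1 a b z : yd a b z <= 1.
Proof.
have yle c : \sum_i yy c z i ^+ 2 <= 1.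
  have n0 := snorm_gt0 (rowV c) z.
  have -> : \sum_i yy c z i ^+ 2 = sqn (rowV c) z / snorm (rowV c) z ^+ 2.
    by rewrite /sqn mulr_suml; apply: eq_bigr => i _; rewrite /yy expr_div_n.
  by rewrite ler_pdivrMr ?exprn_gt0// mul1r snorm2 lerDr.
have h1 := cauchy_schwarz (yy a z) (yy b z); rewrite -/(yd a b z) in h1.
have h2 : (\sum_i yy a z i ^+ 2) * (\sum_i yy b z i ^+ 2) <= 1.
  by rewrite mulr_ile1// ?yle// sumr_ge0// => i _; exact: sqr_ge0.
have := sqr_ge0 (yd a b z - 1); nra.
Qed.

(** Gordon's covariance inequality: for two indices a and b the difference of
    the two sums is rho' rho' (1 - <x_a, x_b>) (1 - <y_a, y_b>), where
    y_a = V_a / N_a has norm at most 1. *)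
Let cross a b z : \sum_(v <- dirsR) g a v z * g b v z <= \sum_(v <- dirsL) g a v z * g b v z.
Proof.
have e (s : seq Z) : \sum_(v <- s) g a v z * g b v z =
   rho1 (margin (rowV a) (rowW a) tau z) * rho1 (margin (rowV b) (rowW b) tau z) * \sum_(v <- s) gg a v z * gg b v z.
  by rewrite mulr_sumr; apply: eq_bigr => v _; rewrite /g; ring.
rewrite !e sumL_gg sumR_gg ler_wpM2l//.
  by rewrite mulr_ge0//; [have /andP[] := rho1_bound (margin (rowV a) (rowW a) tau z)|have /andP[] := rho1_bound (margin (rowV b) (rowW b) tau z)].
have := xx_le1 a b; have := yd_le1 a b z; nra.
Qed.

(** For a single index the two processes have the same covariance, because
    the x_a are unit vectors; so the terms with a second derivative of one
    factor cancel. *)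
Let diag a z : \sum_(v <- dirsR) h a v z = \sum_(v <- dirsL) h a v z.
Proof.
have xa : xx a a = 1.
  by rewrite -(Xunit a); apply: eq_bigr => j _; rewrite expr2.
have e (s : seq Z) : \sum_(v <- s) h a v z =
   rho2 (margin (rowV a) (rowW a) tau z) * (\sum_(v <- s) gg a v z * gg a v z) +
   rho1 (margin (rowV a) (rowW a) tau z) * ((\sum_(v <- s) sqn (rowV a) v) / snorm (rowV a) z -
     (\sum_(v <- s) dsnorm (rowV a) v z * dsnorm (rowV a) v z) / snorm (rowV a) z).
  rewrite !mulr_suml -sumrB !mulr_sumr -big_split/=.
  by apply: eq_bigr => v _; rewrite /h /ddsnorm.
rewrite !e sumL_gg sumR_gg xa mulr1 [yd a a z + 1]addrC; congr (_ + _ * (_ / _ - _ / _)).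
- rewrite big_cat !big_map big_cons big_map sqn_v0 add0r /=.
  rewrite [X in _ + X]big1 ?addr0; last by move=> j _; exact: sqn_uW.
  rewrite -(pair_bigA _ (fun i j => sqn (rowV a) (vL (i, j))))/=.
  by apply: eq_bigr => i _; rewrite sqn_uV -(Xunit a); apply: eq_bigr => j _; rewrite sqn_vL.
- rewrite big_cat !big_map big_cons big_map /=.
  rewrite [X in _ + X]big1 ?addr0; last by move=> j _; rewrite dsnorm_uW mulr0.
  rewrite dsnorm_v0 mulr0 add0r.
  rewrite -(pair_bigA _ (fun i j => dsnorm (rowV a) (vL (i, j)) z * dsnorm (rowV a) (vL (i, j)) z))/=.
  apply: eq_bigr => i _; rewrite dsnorm_uV -[LHS]mulr1 -(Xunit a) mulr_sumr.
  by apply: eq_bigr => j _; rewrite dsnorm_vL /=; ring.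
Qed.

Let f01 a z : 0 <= f a z <= 1. Proof. exact: rho_bound. Qed.

Lemma prodF01 s z : 0 <= prodF s z <= 1.
Proof.
elim: s => [|a s /andP[IH0 IH1]] /=; first by rewrite ler01 lexx.
have /andP[a0 a1] := f01 a z; by rewrite mulr_ge0// mulr_ile1.
Qed.

Let crossG b s z : \sum_(v <- dirsR) g b v z * prodG s v z <= \sum_(v <- dirsL) g b v z * prodG s v z.
Proof.
elim: s => [|a s IH] /=; first by rewrite !big1// => v _; rewrite mulr0.
have e (t : seq Z) : \sum_(v <- t) g b v z * (g a v z * prodF s z + f a z * prodG s v z) =
   prodF s z * (\sum_(v <- t) g b v z * g a v z) + f a z * (\sum_(v <- t) g b v z * prodG s v z).
  by rewrite !mulr_sumr -big_split/=; apply: eq_bigr => v _; ring.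
have /andP[p0 _] := prodF01 s z; have /andP[q0 _] := f01 a z.
by rewrite !e lerD// ler_wpM2l.
Qed.

Let sumH s z : \sum_(v <- dirsR) prodH s v z <= \sum_(v <- dirsL) prodH s v z.
Proof.
elim: s => [|a s IH] /=; first by rewrite !big1.
have e (t : seq Z) : \sum_(v <- t) (h a v z * prodF s z + (2 * (g a v z * prodG s v z) + f a z * prodH s v z)) =
   prodF s z * (\sum_(v <- t) h a v z) + (2 * (\sum_(v <- t) g a v z * prodG s v z) +
     f a z * (\sum_(v <- t) prodH s v z)).
  by rewrite !mulr_sumr -!big_split/=; apply: eq_bigr => v _; ring.
have /andP[p0 _] := prodF01 s z; have /andP[q0 _] := f01 a z.
rewrite !e diag lerD2l lerD// ler_wpM2l//.
Qed.

(** The terms h of prodH agree on both sides and the products g_a g_b are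
    larger for dirsL; the remaining factors are nonnegative.  Hence the second
    derivatives compare as [lindeberg_comparison] requires. *)
Theorem gordon_comparison s z :
  gTs dirsR (prodF s) z <= gTs dirsL (prodF s) z.
Proof.
have [cf cg ch ct] := C2prod s.
apply: (@lindeberg_comparison _ _ (prodH s)) => //.
  by move=> v _; have [C hC] := ct v; exists (prodG s v), C.
by move=> y; exact: sumH.
Qed.

End gordon.

(** * The matrix side of the comparison *)

Section lower.
Context {R : realType} (r m n : nat).
Variable X : 'I_r -> 'cV[R]_n.
Context {d : measure_display} {T : measurableType d} {P : probability T R}.
Variable A : 'I_m * 'I_n -> {RV P >-> R}.
Hypothesis A_iid : iid_std_normal A.
Local Notation gam := (@normal_prob R 0 1).
Local Notation Z := ('M[R]_(r, m) * 'cV[R]_r)%type.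

Lemma measurable_l2norm (x : 'cV[R]_n) :
  measurable_fun setT (fun w => l2norm (random_mx A w *m x)).
Proof.
rewrite /l2norm; apply: (@measurableT_comp _ _ _ _ _ _ (@Num.sqrt R)).
  exact: continuous_measurable_fun (@sqrt_continuous R).
apply: measurable_sum => i; apply: measurable_funX.
rewrite (_ : (fun _ => _) = (fun w => \sum_j A (i, j) w * x j 0)).
  by apply: measurable_sum => j; apply: measurable_funM.
by apply/funext => w; rewrite mxE; apply: eq_bigr => j _; rewrite mxE.
Qed.

Definition small_event (t : R) : set T :=
  [set w | exists a, l2norm (random_mx A w *m X a) < t].

Lemma measurable_small t : measurable (small_event t).
Proof.
rewrite (_ : small_event t = \bigcup_(a in [set: 'I_r]) [set w | l2norm (random_mx A w *m X a) < t]).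
  apply: fin_bigcup_measurable => // a _.
  rewrite -[X in measurable X]setTI; apply: measurable_fun_ltr => //.
  exact: measurable_l2norm.
by apply/seteqP; split=> w /=; [case=> a h; exists a|case=> a _ h; exists a].
Qed.

Let arg (s : R) w : Z := s *: v0 r m + \sum_ij A ij w *: vL X ij.

Let argV s w a i : (arg s w).1 a i = (random_mx A w *m X a) i 0.
Proof.
rewrite /arg /= scaler0 add0r.
rewrite (big_morph (fun z : Z => z.1) (id1 := 0) (op1 := +%R))//.
rewrite summxE mxE.
rewrite (eq_bigr (fun k => (A (k.1, k.2) w *: vL X (k.1, k.2)).1 a i)); last by case.
rewrite -(pair_bigA _ (fun i' j => (A (i', j) w *: vL X (i', j)).1 a i))/=.
rewrite (bigD1 i)//= [X in _ + X]big1 ?addr0.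
  by apply: eq_bigr => j _; rewrite !mxE eqxx mulr1.
by move=> k ki; apply: big1 => j _; rewrite !mxE eq_sym (negbTE ki) !mulr0.
Qed.

Let argW s w a : (arg s w).2 a 0 = s.
Proof.
rewrite /arg /= (big_morph (fun z : Z => z.2) (id1 := 0) (op1 := +%R))//.
rewrite big1 ?addr0 ?mxE ?mulr1// => ij _; by rewrite /= scaler0.
Qed.

Lemma prodF_eq0 tau (s : seq 'I_r) (z : Z) a : a \in s ->
  margin (rowV a) (rowW (m := m) a) tau z <= 0 -> prodF tau s z = 0.
Proof.
move=> + h; elim: s => // b s IH; rewrite inE => /orP[/eqP <-|/IH] /=.
  by rewrite (rho_le0 h) mul0r.
by move=> ->; rewrite mulr0.
Qed.

(** If some |A x_a| < t and the additional normal variable g is at most -s0,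
    then the margin of index a is at most 1 + |A x_a| + g - tau <= 0 and the
    product vanishes.  The two events are independent, so the product of their
    probabilities is at most the mean of 1 - prodF. *)
Lemma small_event_bound t s0 :
  fine (P (small_event t)) * fine (gam `]-oo, (- s0)]) <=
  1 - gTs (dirsL m X) (prodF (m := m) (1 + t - s0) (index_enum 'I_r)) 0.
Proof.
set tau := 1 + t - s0; set F := prodF _ _; set E := small_event t.
have dF : dlip F by exact: dlip_prodF.
have F01 z : 0 <= F z <= 1 by exact: prodF01.
pose vs := [seq vL X ij | ij <- index_enum ('I_m * 'I_n)%type].
have mE := measurable_small t.
have inner s : gTs vs F (0 + s *: v0 r m) <=
   1 - fine (P E) * \1_(`]-oo, (- s0)] : set R) s.
  rewrite add0r; have [mF <-] := gaussian_law (vL X) A_iid dF (s *: v0 r m).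
  have iF : P.-integrable setT (EFin \o (fun w => F (s *: v0 r m + \sum_i A i w *: vL X i))).
    apply: (@integrable_bounded_prob _ _ _ P _ 1) => // w.
    by have /andP[? ?] := F01 (s *: v0 r m + \sum_i A i w *: vL X i); rewrite ger0_norm.
  have i1 : P.-integrable setT (EFin \o (fun _ : T => 1 : R)).
    by apply: (@integrable_bounded_prob _ _ _ P _ 1) => // w; rewrite normr1.
  have iE := integrable_indic P mE.
  rewrite indicE; case: (boolP (s \in _)) => hs.
    rewrite mulr1 -(Rintegral_indic_prob mE) -[X in X - _](@Rintegral_prob_cst _ _ _ P).
    rewrite -RintegralB//; apply: le_Rintegral => //.
      exact: (integrableB measurableT i1 iE).
    move=> w _; rewrite indicE; case: (boolP (w \in E)) => hw; last first.
      by rewrite subr0; case/andP: (F01 (s *: v0 r m + \sum_i A i w *: vL X i)).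
    rewrite subrr; move: hw; rewrite inE => -[a ha].
    rewrite le_eqVlt; apply/orP; left; apply/eqP.
    rewrite -/(arg s w); apply: (@prodF_eq0 _ _ _ a); first exact: mem_index_enum.
    rewrite /margin /rowW argW /snorm.
    have -> : sqn (rowV a) (arg s w) = l2norm (random_mx A w *m X a) ^+ 2.
      rewrite /l2norm sqr_sqrtr; last by apply: sumr_ge0 => i _; exact: sqr_ge0.
      by apply: eq_bigr => i _; rewrite /rowV argV.
    set x := l2norm _ in ha *.
    have x0 : 0 <= x by exact: sqrtr_ge0.
    have : Num.sqrt (1 + x ^+ 2) <= 1 + x.
      rewrite -[leRHS]ger0_norm ?addr_ge0// -sqrtr_sqr ler_wsqrtr//; nra.
    move: hs; rewrite inE /= in_itv /= /tau; lra.
  rewrite mulr0 subr0 -[leRHS](@Rintegral_prob_cst _ _ _ P).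
  apply: le_Rintegral => // w _.
  by case/andP: (F01 (s *: v0 r m + \sum_i A i w *: vL X i)).
have mI : measurable (`]-oo, (- s0)] : set R) by exact: measurable_itv.
have iI := integrable_indic gam mI.
rewrite /dirsL /= -/vs lerBrDl -lerBrDr /gT.
rewrite -(Rintegral_indic_prob (P := gam) mI) -RintegralZl//.
rewrite -[X in X - _](@Rintegral_prob_cst _ _ _ gam).
have i1 : gam.-integrable setT (EFin \o (fun _ : R => 1 : R)).
  by apply: (@integrable_bounded_prob _ _ _ gam _ 1) => // w; rewrite normr1.
have i2 := integrableZr (fine (P E)) iI.
rewrite -RintegralB//; apply: le_Rintegral => //.
- by apply: dlip_integrable; exact: gTs_dlip.
- exact: (integrableB measurableT i1 i2).
Qed.

End lower.

(** * The decoupled side of the comparison *)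

Section prod_bound.
Context {R : realType} {Z : lmodType R}.
Local Notation gam := (@normal_prob R 0 1).

(** Tonelli for products of functions of one variable, one direction at a
    time. *)
Lemma gTs_prod_bound (I : finType) (us : seq Z) (G : Z -> R) z
    (K : I -> R) (b : I -> nat -> R -> R) : dlip G ->
  (forall l i, gam.-integrable setT (EFin \o b l i)) ->
  (forall s : nat -> R, G (z + \sum_(i < size us) s i *: us`_i) <=
     \sum_l K l * \prod_(i < size us) b l i (s i)) ->
  gTs us G z <= \sum_l K l * \prod_(i < size us) \int[gam]_x b l i x.
Proof.
move=> dG; elim: us z K b => [|u us IH] z K b ib H.
  have := H (fun=> 0); rewrite /= big_ord0 addr0 => /le_trans; apply.
  by apply: ler_sum => l _; rewrite !big_ord0.
rewrite /=.
apply: (@le_trans _ _ (\int[gam]_x (\sum_l (K l * \prod_(i < size us) \int[gam]_y b l i.+1 y) * b l 0%N x))).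
  apply: le_Rintegral => //.
  - by apply: dlip_integrable; exact: gTs_dlip.
  - rewrite (_ : _ \o _ = (fun x => \sum_l ((K l * \prod_(i < size us) \int[gam]_y b l i.+1 y) * b l 0%N x)%:E)%E).
      by apply: integrable_sum => // l _; apply: integrableZr.
    by apply/funext => x; rewrite /= -sumEFin.
  move=> x _.
  have := IH (z + x *: u) (fun l => K l * b l 0%N x) (fun l i => b l i.+1) (fun l i => ib l i.+1).
  rewrite (eq_bigr (fun l => K l * \prod_(i < size us) \int[gam]_y b l i.+1 y * b l 0%N x)); last by move=> l _; rewrite mulrAC.
  apply => s.
  have := H (fun i => if i is j.+1 then s j else x).
  rewrite /= big_ord_recl /= addrA => /le_trans; apply.
  by apply: ler_sum => l _; rewrite big_ord_recl mulrA.
rewrite Rintegral_sum => [|l]; last exact: integrableZr.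
apply: ler_sum => l _; rewrite RintegralZl// big_ord_recl.
by rewrite -mulrA [X in _ * X]mulrC.
Qed.

End prod_bound.

Section idx.
Context {R : realType} {Z : lmodType R}.

Lemma index_enum_ord k : index_enum 'I_k = enum 'I_k.
Proof. by rewrite [index_enum _]unlock enumT. Qed.

Lemma sum_nth_cat (f : nat -> Z -> Z) (s1 s2 : seq Z) :
  \sum_(i < size (s1 ++ s2)) f i (s1 ++ s2)`_i =
  \sum_(i < size s1) f i s1`_i + \sum_(i < size s2) f (size s1 + i)%N s2`_i.
Proof.
rewrite -(big_mkord xpredT (fun i => f i (s1 ++ s2)`_i)) size_cat big_mkord big_split_ord /=.
congr (_ + _); apply: eq_bigr => i _; rewrite nth_cat; first by rewrite ltn_ord.
by rewrite ltnNge leq_addr /= addKn.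
Qed.

Lemma sum_nth_map_ord k (f : nat -> Z -> Z) (F : 'I_k -> Z) :
  \sum_(i < size [seq F i | i <- index_enum 'I_k]) f i [seq F i | i <- index_enum 'I_k]`_i =
  \sum_(i < k) f i (F i).
Proof.
have -> : [seq F i | i <- index_enum 'I_k] = [seq F i | i <- enum 'I_k] by rewrite index_enum_ord.
rewrite -(big_mkord xpredT (fun i => f i [seq F i | i <- enum 'I_k]`_i)).
rewrite size_map size_enum_ord big_mkord; apply: eq_bigr => i _.
by rewrite (nth_map i) ?size_enum_ord// nth_ord_enum.
Qed.

End idx.

Section pointwise.
Context {R : realType}.

(** The radii l / N, 1 <= l <= L, at which the norm is linearised; the index
    None stands for the region beyond the largest radius, where a constant
    bound is enough. *)
Definition grid_radius (N : nat) (l : nat) : R := l.+1%:R / N%:R.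
Definition tan_slope (c : R) (N L : nat) (o : option 'I_L) : R :=
  if o is Some l then c / grid_radius N l else 0.
Definition tan_const (c n : R) (N L : nat) (o : option 'I_L) : R :=
  if o is Some l then c * n / (2 * N%:R) - c * n * grid_radius N l / 2
  else - (c * n * (L%:R / N%:R)).

Lemma grid_radius_gt0 N l : (0 < N)%N -> 0 < grid_radius N l.
Proof. by move=> N0; rewrite divr_gt0 ?ltr0n. Qed.

(** Write x = y S.  For positive r,
    - y = - y ^ 2 / (2 r) - r / 2 + (r - y) ^ 2 / (2 r).  Choosing r = l / N just above y makes
    the error at most 1 / (2 N).  The gain is that expR (- c S |g|) is bounded by
    a finite sum of exponentials of - |g| ^ 2, which factor over coordinates.
    In the limit the best r yields I_sph. *)
Lemma norm_tangent (S x c : R) N L : (0 < N)%N -> 0 < S -> 0 <= x -> 0 < c ->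
  exists o : option 'I_L, - (c * S * x) <=
    tan_const c (S ^+ 2) N o - tan_slope c N o * x ^+ 2 / 2.
Proof.
move=> N0 S0 x0 c0; have NR : 0 < N%:R :> R by rewrite ltr0n.
set y := x / S; have ex : x = y * S by rewrite /y divfK// gt_eqF.
have y0 : 0 <= y by rewrite divr_ge0// ltW.
have [yL|yL] := lerP (L%:R / N%:R) y.
  exists None; rewrite /tan_const /tan_slope mul0r mul0r subr0 lerN2 ex.
  have -> : c * S * (y * S) = c * S ^+ 2 * y by ring.
  by rewrite ler_wpM2l// mulr_ge0 ?sqr_ge0// ltW.
have yN0 : 0 <= y * N%:R by rewrite mulr_ge0// ltW.
have /andP[t1 t2] := truncn_itv yN0.
have lL : (Num.truncn (y * N%:R) < L)%N.
  by rewrite -(ltr_nat R) (le_lt_trans t1)// -ltr_pdivlMr.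
exists (Some (Ordinal lL)); rewrite /tan_const /tan_slope /=.
set l := Num.truncn _ in t1 t2 *.
have r0 := grid_radius_gt0 l N0; set r := grid_radius N l in r0 *.
have er : r * N%:R = l%:R + 1 by rewrite /r /grid_radius divfK ?gt_eqF// -natr1.
have h1 : (r - y) * N%:R <= 1 by rewrite mulrBl er; lra.
have h2 : 0 <= (r - y) * N%:R by rewrite mulrBl er; move: t2; rewrite -natr1; lra.
have h3 : 1 <= r * N%:R by rewrite er lerDr.
have key : ((r - y) * N%:R) ^+ 2 <= r * N%:R.
  by rewrite (@le_trans _ _ 1)// expr2 mulr_ile1.
have : (r - y) ^+ 2 * N%:R <= r.
  rewrite -(ler_pM2r NR) (le_trans _ key)// le_eqVlt; apply/orP; left; apply/eqP; ring.
move=> key2.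
have : 0 <= c * S ^+ 2 * (r - (r - y) ^+ 2 * N%:R) / (2 * N%:R * r).
  rewrite divr_ge0//; last by rewrite !mulr_ge0// ltW.
  by rewrite mulr_ge0 ?subr_ge0// mulr_ge0 ?sqr_ge0// ltW.
have -> : c * S ^+ 2 * (r - (r - y) ^+ 2 * N%:R) / (2 * N%:R * r) =
   (c * S ^+ 2 / (2 * N%:R) - c * S ^+ 2 * r / 2 - c / r * x ^+ 2 / 2) + c * S * x.
  by rewrite ex; field; rewrite !gt_eqF.
lra.
Qed.

Definition excess (g nv s : R) : R := Num.max (s ^+ 2 / (4 * g) - nv) 0.

(** Lagrangian duality for the maximum of - <h, x> over sparse unit vectors:
    g prices the constraint |x| = 1 and nv the number of nonzero entries.  On
    the support, - S h_j x_j <= h_j ^ 2 / (4 g) + g S ^ 2 x_j ^ 2; off the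
    support both sides are handled by the positive part in [excess]. *)
Lemma sparse_bound n (x : 'cV[R]_n) (hh : 'I_n -> R) (S c g nv : R) (k : nat) :
  0 < c -> 0 < g -> 0 <= nv ->
  \sum_j x j 0 ^+ 2 = 1 -> l0norm x = k ->
  - (c * S * \sum_j hh j * x j 0) <=
    c * k%:R * nv + c * S ^+ 2 * g + \sum_j c * excess g nv (hh j).
Proof.
move=> c0 g0 nv0 x1 xk.
have e0 s : 0 <= excess g nv s by rewrite /excess le_max lexx orbT.
have ek : k%:R = \sum_j (x j 0 != 0)%:R :> R.
  rewrite -xk /l0norm -sum1_card natr_sum big_mkcond/=; apply: eq_bigr => j _.
  by rewrite inE; case: (x j 0 != 0).
rewrite ek.
have -> : c * (\sum_j (x j 0 != 0)%:R) * nv + c * S ^+ 2 * g + \sum_j c * excess g nv (hh j) =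
   \sum_j (c * (x j 0 != 0)%:R * nv + c * S ^+ 2 * g * x j 0 ^+ 2 + c * excess g nv (hh j)).
  rewrite !big_split/= -[\sum_i c * S ^+ 2 * g * _]mulr_sumr x1 mulr1.
  by rewrite mulr_sumr mulr_suml.
rewrite mulr_sumr -sumrN; apply: ler_sum => j _.
have [->|xj] := eqVneq (x j 0) 0.
  rewrite !mulr0 expr0n/= oppr0 mulr0 !mul0r !add0r.
  by apply: mulr_ge0 => //; exact: ltW.
rewrite /= mulr1.
have h1 : hh j ^+ 2 / (4 * g) - nv <= excess g nv (hh j) by rewrite /excess le_max lexx.
have h2 : 0 <= (hh j / (2 * g) + S * x j 0) ^+ 2 * g by rewrite mulr_ge0 ?sqr_ge0// ltW.
have h3 : (hh j / (2 * g) + S * x j 0) ^+ 2 * g = hh j ^+ 2 / (4 * g) + S * (hh j * x j 0) + S ^+ 2 * g * x j 0 ^+ 2.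
  by field; rewrite gt_eqF.
have : 0 <= c * (excess g nv (hh j) + nv + S * (hh j * x j 0) + S ^+ 2 * g * x j 0 ^+ 2).
  by apply: mulr_ge0; [exact: ltW|rewrite h3 in h2; lra].
lra.
Qed.

End pointwise.

Section compl.
Context {R : realType} {Z : lmodType R}.

Lemma gTs_compl (us : seq Z) (F : Z -> R) z : dlip F ->
  gTs us (fun y => 1 + (-1) * F y) z = 1 - gTs us F z.
Proof.
move=> dF; elim: us z => [|u us IH] z /=; first by rewrite mulN1r.
have -> : gTs us (fun y => 1 + (-1) * F y) = (fun y => 1 + (-1) * gTs us F y).
  by apply/funext => y; rewrite IH mulN1r.
rewrite gT_lin//; [|exact: dlip_cst|exact: gTs_dlip].
by rewrite /gT Rintegral_prob_cst mulN1r.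
Qed.

End compl.

Section upper.
Context {R : realType} (r m n k : nat).
Variable X : 'I_r -> 'cV[R]_n.
Hypothesis Xunit : forall a, \sum_j X a j 0 ^+ 2 = 1.
Hypothesis Xk : forall a, l0norm (X a) = k.
Variables (S c g nv tau : R) (N L : nat).
Hypotheses (S0 : 0 < S) (c0 : 0 < c) (cg : c / 2 < g) (nv0 : 0 <= nv) (N0 : (0 < N)%N).
Local Notation gam := (@normal_prob R 0 1).

Let g0 : 0 < g. Proof. by rewrite (lt_trans _ cg)// divr_gt0. Qed.

Definition exp_excess (s : R) : R := expR (c * excess g nv s).

Lemma measurable_excess : measurable_fun setT (excess g nv).
Proof.
rewrite /excess; apply: measurable_maxr => //; apply: measurable_funB => //.
by apply: measurable_funM => //; exact: measurable_funX.
Qed.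

Lemma integrable_expquad (l : R) : -1 < l ->
  gam.-integrable setT (EFin \o (fun x => expR (- (l * x ^+ 2 / 2)))).
Proof.
move=> l1; apply/integrableP; split.
  apply/measurable_EFinP; apply: measurableT_comp => //; apply: measurableT_comp => //.
  by apply: measurable_funM => //; apply: measurable_funM.
under eq_integral do rewrite /= ger0_norm ?expR_ge0//.
by rewrite normal_expquad// ltry.
Qed.

Lemma integrable_exp_excess : gam.-integrable setT (EFin \o exp_excess).
Proof.
have l1 : -1 < - (c / (2 * g)).
  by rewrite ltrN2 ltr_pdivrMr ?mulr_gt0// mul1r mulrC -ltr_pdivrMr.
apply: (le_integrable measurableT _ _ (integrable_expquad l1)).
  apply/measurable_EFinP; apply: measurableT_comp => //.
  by apply: measurable_funM => //; exact: measurable_excess.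
move=> s _; rewrite lee_fin !ger0_norm ?expR_ge0// ler_expR.
have -> : - (- (c / (2 * g)) * s ^+ 2 / 2) = c * (s ^+ 2 / (4 * g)).
  by field; rewrite gt_eqF.
apply: ler_wpM2l; first exact: ltW.
rewrite /excess ge_max; apply/andP; split; first by rewrite gerBl.
by rewrite divr_ge0 ?sqr_ge0// mulr_ge0// ltW.
Qed.

(** The factor attached to the i-th direction of dirsR: a Gaussian weight for
    the m coordinates of the vector part, the exponential of the excess for the
    n coordinates of the linear part. *)
Definition direction_bound (o : option 'I_L) (i : nat) : R -> R :=
  if (i < m)%N then fun s => expR (- (tan_slope c N o * s ^+ 2 / 2)) else exp_excess.

Lemma tan_slope_ge0 (o : option 'I_L) : 0 <= tan_slope c N o.
Proof.
by case: o => //= l; rewrite divr_ge0 ?(ltW c0)// ltW// grid_radius_gt0.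
Qed.

Lemma integrable_direction_bound o i : gam.-integrable setT (EFin \o direction_bound o i).
Proof.
rewrite /direction_bound; case: ifP => _; last exact: integrable_exp_excess.
by apply: integrable_expquad; have := tan_slope_ge0 o; lra.
Qed.

(** Everything in the exponential bound that does not depend on the Gaussian
    variables: c S (tau + 3) from Markov's inequality, the Lagrangian terms of
    [sparse_bound], and the constant of the chosen tangent. *)
Definition tangent_weight (o : option 'I_L) : R :=
  expR (c * S * (tau + 3) + c * k%:R * nv + c * S ^+ 2 * g + tan_const c (S ^+ 2) N o).

Local Notation us := (dirsR m X).

Lemma size_dirsR : size us = (m + n)%N.
Proof. by rewrite size_cat !size_map !index_enum_ord !size_enum_ord. Qed.

Lemma prodF_eq1 (s : seq 'I_r) z :
  (forall a, 3 <= margin (rowV (m := m) a) (rowW a) tau z) -> prodF tau s z = 1.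
Proof.
move=> h; elim: s => //= a s ->; by rewrite rho_ge3 ?mulr1.
Qed.

(** If all margins are at least 3 the left side is 0.  Otherwise it is at most 1
    and some index a satisfies |g| + <h, x_a> <= tau + 3, so that
    expR (c S (tau + 3 - |g| - <h, x_a>)) >= 1; [norm_tangent] and [sparse_bound]
    turn this into a bound that no longer depends on a and has product
    form. *)
Lemma pointwise_bound (s : nat -> R) :
  1 - prodF tau (index_enum 'I_r) (0 + \sum_(i < size us) s i *: us`_i) <=
  \sum_o tangent_weight o * \prod_(i < size us) direction_bound o i (s i).
Proof.
have pos o : 0 <= tangent_weight o * \prod_(i < size us) direction_bound o i (s i).
  rewrite mulr_ge0 ?expR_ge0// prodr_ge0// => i _.
  by rewrite /direction_bound; case: ifP => _; exact: expR_ge0.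
set z := 0 + _.
have ez : z = \sum_(i < m) s i *: uV r i + \sum_(j < n) s (m + j)%N *: uW m X j.
  rewrite /z add0r (sum_nth_cat (fun i v => s i *: v)) (sum_nth_map_ord (fun i v => s i *: v)).
  congr (_ + _).
  have -> : size [seq uV (R := R) r i | i <- index_enum 'I_m] = m.
    by rewrite size_map (index_enum_ord m) size_enum_ord.
  exact: (sum_nth_map_ord (fun i v => s (m + i)%N *: v)).
have z1 a i : z.1 a i = s i.
  rewrite ez /= !(big_morph (fun y : 'M[R]_(r, m) * 'cV[R]_r => y.1) (id1 := 0) (op1 := +%R))//.
  rewrite mxE !summxE (bigD1 i)//= !mxE eqxx mulr1 !big1 ?addr0// => [j _|j ji].
    by rewrite !mxE mulr0.
  by rewrite !mxE eq_sym (negbTE ji) mulr0.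
have z2 a : z.2 a 0 = \sum_(j < n) s (m + j)%N * X a j 0.
  rewrite ez /= !(big_morph (fun y : 'M[R]_(r, m) * 'cV[R]_r => y.2) (id1 := 0) (op1 := +%R))//.
  rewrite mxE !summxE [X in X + _]big1 ?add0r; last by move=> i _; rewrite !mxE mulr0.
  by apply: eq_bigr => j _; rewrite !mxE.
have [h|] := pselect (forall a, 3 <= margin (rowV (m := m) a) (rowW a) tau z).
  by rewrite prodF_eq1// subrr sumr_ge0.
move=> /existsNP[a /negP]; rewrite -ltNge => ha.
apply: (@le_trans _ _ 1).
  by rewrite gerBl; case/andP: (prodF01 tau (index_enum 'I_r) z).
set x := Num.sqrt (\sum_(i < m) s i ^+ 2).
have x0 : 0 <= x by exact: sqrtr_ge0.
have x2 : x ^+ 2 = \sum_(i < m) s i ^+ 2.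
  by rewrite sqr_sqrtr// sumr_ge0// => i _; exact: sqr_ge0.
have [ol ho] := norm_tangent L N0 S0 x0 c0.
rewrite (bigD1 ol)//= -[leLHS]addr0 lerD ?sumr_ge0//.
have hs := sparse_bound (fun j : 'I_n => s (m + j)%N) S c0 g0 nv0 (Xunit a) (Xk a).
have xN : x <= snorm (rowV a) z.
  have eV : sqn (rowV a) z = \sum_(i < m) s i ^+ 2.
    by apply: eq_bigr => i _; rewrite /rowV z1.
  by rewrite /snorm eV ler_wsqrtr// lerDr.
rewrite /margin /rowW z2 in ha.
set w := \sum_(j < n) s (m + j)%N * X a j 0 in ha hs.
rewrite size_dirsR big_split_ord /=.
rewrite (eq_bigr (fun i : 'I_m => expR (- (tan_slope c N ol * s i ^+ 2 / 2)))); last first.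
  by move=> i _; rewrite /direction_bound ltn_ord.
rewrite [X in _ * (_ * X)](eq_bigr (fun j : 'I_n => expR (c * excess g nv (s (m + j)%N)))); last first.
  by move=> i _; rewrite /direction_bound ltnNge leq_addr.
rewrite -!expR_sum /tangent_weight -!expRD -[leLHS]expR0 ler_expR.
have -> : \sum_(i < m) - (tan_slope c N ol * s i ^+ 2 / 2) = - (tan_slope c N ol * x ^+ 2 / 2).
  by rewrite sumrN x2 mulr_sumr mulr_suml.
have : c * S * (x + w) <= c * S * (tau + 3).
  by apply: ler_wpM2l; [rewrite mulr_ge0// ltW|lra].
rewrite mulrDr; lra.
Qed.

(** Taking means in [pointwise_bound] replaces each factor by a
    one-dimensional integral. *)
Lemma upper_bound :
  1 - gTs us (prodF tau (index_enum 'I_r)) 0 <=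
  \sum_o tangent_weight o * ((Num.sqrt (1 + tan_slope c N o))^-1 ^+ m * (\int[gam]_x exp_excess x) ^+ n).
Proof.
have dF := dlip_prodF m tau (index_enum 'I_r).
have d1 : dlip (fun z : 'M[R]_(r, m) * 'cV[R]_r => 1 + (-1) * prodF tau (index_enum 'I_r) z).
  by apply: dlip_lin => //; exact: dlip_cst.
have e1 : gTs us (fun z : 'M[R]_(r, m) * 'cV[R]_r => 1 + (-1) * prodF tau (index_enum 'I_r) z) 0 =
   1 - gTs us (prodF tau (index_enum 'I_r)) 0.
  exact: gTs_compl.
rewrite -e1.
have := @gTs_prod_bound R _ _ us _ 0 tangent_weight direction_bound d1 integrable_direction_bound.
move=> /(_ _)/le_trans; apply.
  by move=> s; rewrite mulN1r; exact: pointwise_bound.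
apply: ler_sum => o _; rewrite size_dirsR big_split_ord /= le_eqVlt; apply/orP; left.
apply/eqP; congr (_ * (_ * _)).
- rewrite -[in RHS](card_ord m) -prodr_const; apply: eq_bigr => i _.
  rewrite /direction_bound ltn_ord /Rintegral normal_expquad//; have := tan_slope_ge0 o; lra.
- rewrite -[in RHS](card_ord n) -prodr_const; apply: eq_bigr => i _.
  by rewrite /direction_bound ltnNge leq_addr.
Qed.

End upper.

(** * Closed forms of the one-dimensional integrals *)

Section tails.
Context {R : realType}.
Local Notation gam := (@normal_prob R 0 1).
Local Notation phi := (@normal_pdf R 0 1).
Local Notation mu := lebesgue_measure.

(** The interval [-s0 - 1, -s0] has length 1 and the density is smallest at
    its left end. *)
Lemma normal_tail_ge (s0 : R) : 0 <= s0 ->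
  (Num.sqrt (pi *+ 2))^-1 * expR (- ((s0 + 1) ^+ 2 / 2)) <= fine (gam `]-oo, (- s0)]).
Proof.
move=> s00; set K := _ * _.
have mI : measurable (`[- s0 - 1, - s0] : set R) by exact: measurable_itv.
have sub : (gam `[(- s0 - 1)%R, (- s0)%R]%classic <= gam `]-oo, (- s0)%R]%classic)%E.
  apply: le_measure; rewrite ?inE; try exact: measurable_itv.
  by move=> x /=; rewrite !in_itv/= => /andP[].
have fin : gam `]-oo, (- s0)%R]%classic \is a fin_num.
  by apply: fin_num_measure; exact: measurable_itv.
rewrite -lee_fin fineK//; apply: le_trans sub.
rewrite /normal_prob.
apply: (@le_trans _ _ (\int[mu]_(x in `[(- s0 - 1)%R, (- s0)%R]) K%:E)%E).
  rewrite integral_cst//= lebesgue_measure_itv/= lte_fin ifT; last by lra.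
  rewrite -EFinD (_ : - s0 + - (- s0 - 1) = 1); last by ring.
  by rewrite mule1.
apply: ge0_le_integral => //.
- by move=> x _; rewrite lee_fin mulr_ge0 ?expR_ge0// invr_ge0 sqrtr_ge0.
- by apply/measurable_EFinP; apply: measurable_funTS; exact: measurable_normal_pdf.
move=> x /=; rewrite in_itv/= => /andP[x1 x2].
rewrite lee_fin normal01E ler_wpM2l ?invr_ge0 ?sqrtr_ge0// ler_expR lerN2.
rewrite ler_pM2r ?invr_gt0//; nra.
Qed.

Lemma gauss_tail (y : R) : 0 <= y ->
  (\int[mu]_(x in `[y, +oo[) (gauss_fun x)%:E = (Num.sqrt pi / 2 * erfc y)%:E)%E.
Proof.
move=> y0.
have mg : measurable_fun setT (gauss_fun (R := R)) := measurable_gauss_fun.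
have e1 : (\int[mu]_(x in `[0%R, +oo[) (gauss_fun x)%:E = (Num.sqrt pi / 2)%:E :> \bar R)%E.
  exact: integral0y_gauss.
have split : [set` `[0, +oo[] = [set` `[0, y[] `|` [set` `[y, +oo[].
  by rewrite -itv_bndbnd_setU// bnd_simp.
have e2 : (\int[mu]_(x in `[0%R, +oo[) (gauss_fun x)%:E =
   \int[mu]_(x in `[0%R, y]) (gauss_fun x)%:E + \int[mu]_(x in `[y, +oo[) (gauss_fun x)%:E)%E.
  rewrite split ge0_integral_setU//=.
  - congr (_ + _)%E; apply: integral_itv_bndo_bndc.
    by apply/measurable_EFinP/measurable_funTS.
  - by apply/measurable_EFinP/measurable_funTS.
  - by move=> x _; rewrite lee_fin gauss_fun_ge0.
  - apply/disj_setPS => x [] /=; rewrite !in_itv/= andbT => /andP[_ x1] x2.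
    by move: x1; rewrite ltNge x2.
have erfE : erf y = 2 / Num.sqrt pi * fine (\int[mu]_(x in `[0%R, y]) (gauss_fun x)%:E)%E.
  rewrite /erf; have -> : Rintegral mu `[y, 0] (fun t : R => expR (- t ^+ 2)) = 0.
    move: y0; rewrite le_eqVlt => /orP[/eqP <-|y0]; first by rewrite set_itv1 Rintegral_set1.
    by rewrite set_itv_ge ?Rintegral_set0// bnd_simp -ltNge.
  by rewrite subr0.
have sp : 0 < Num.sqrt (pi : R) by rewrite sqrtr_gt0 pi_gt0.
have g0 (D : set R) : (0 <= \int[mu]_(x in D) (gauss_fun x)%:E)%E.
  by apply: integral_ge0 => x _; rewrite lee_fin gauss_fun_ge0.
rewrite /erfc erfE; move: e2 (g0 `[0%R, y]%classic) (g0 `[y, +oo[%classic); rewrite e1.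
move: (\int[mu]_(x in `[0%R, y]) _)%E (\int[mu]_(x in `[y, +oo[) _)%E => [a||] [b||]//=.
move=> [] h _ _; congr EFin.
have -> : b = Num.sqrt pi / 2 - a by rewrite h; ring.
by field; rewrite gt_eqF.
Qed.

(** Scaling the Gaussian integral that defines erfc. *)
Lemma phi_tail (q b : R) : 0 < q -> 0 <= b ->
  (\int[mu]_(x in `[b, +oo[) (phi (q * x))%:E = ((2 * q)^-1 * erfc (q * b / Num.sqrt 2))%:E)%E.
Proof.
move=> q0 b0; have s2 : 0 < Num.sqrt 2 :> R by rewrite sqrtr_gt0.
have sp : 0 < Num.sqrt (pi : R) by rewrite sqrtr_gt0 pi_gt0.
pose k := q / Num.sqrt 2; have k0 : 0 < k by rewrite divr_gt0.
have y0 : 0 <= q * b / Num.sqrt 2 by rewrite divr_ge0 ?mulr_ge0// ltW.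
have := gauss_tail y0.
have -> : q * b / Num.sqrt 2 = k * b by rewrite /k mulrAC.
pose F (x : R) := k * x.
have dF (x : R) : is_derive x (1 : R) F k.
  by rewrite /F; apply: is_derive_eq; rewrite /GRing.scale/= mulr1.
have dFE : F^`()%classic = cst k.
  by apply/funext => x; rewrite derive1E; apply: derive_val.
rewrite -/(F b) (@increasing_ge0_integration_by_substitutiony _ F gauss_fun b).
- move=> h.
  have -> : (\int[mu]_(x in `[b, +oo[) (phi (q * x))%:E =
     \int[mu]_(x in `[b, +oo[) (((q * Num.sqrt pi)^-1)%:E * ((gauss_fun \o F) x * k)%:E))%E.
    apply: eq_integral => x _; rewrite -EFinM; congr EFin.
    rewrite normal01E /gauss_fun /= /F.
    have -> : - (k * x) ^+ 2 = - ((q * x) ^+ 2 / 2).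
      by rewrite /k mulrAC expr_div_n sqr_sqrtr.
    have -> : Num.sqrt (pi *+ 2) = Num.sqrt pi * Num.sqrt 2 :> R.
      by rewrite -[pi *+ 2]mulr_natr sqrtrM ?pi_ge0.
    by rewrite /k; field; rewrite !gt_eqF.
  rewrite ge0_integralZl//.
  + have -> : (\int[mu]_(x in `[b, +oo[) ((gauss_fun \o F) x * k)%:E =
       (Num.sqrt pi / 2 * erfc (F b))%:E)%E.
      by rewrite -h; apply: eq_integral => x _; rewrite dFE.
    by rewrite -EFinM; congr EFin; field; rewrite !gt_eqF.
  + apply/measurable_EFinP; apply: measurable_funTS; apply: measurable_funM => //.
    apply: measurableT_comp; first exact: measurable_gauss_fun.
    exact: measurable_funM.
  + by move=> x _; rewrite lee_fin mulr_ge0 ?gauss_fun_ge0// ltW.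
  + by rewrite lee_fin invr_ge0 mulr_ge0 ?sqrtr_ge0// ltW.
- by move=> x y _ _ xy; rewrite /F ltr_pM2l.
- by rewrite dFE => x _; exact: cvg_cst.
- by rewrite dFE; exact: is_cvg_cst.
- by rewrite dFE; exact: is_cvg_cst.
- split; first by move=> x _; apply: ex_derive.
  apply: cvg_at_right_filter; apply: cvgMr; exact: cvg_id.
- have -> : F = (fun x => x * k) by apply/funext => x; rewrite /F mulrC.
  by apply: (gt0_cvgMly k0); exact: cvg_id.
- by apply: continuous_subspaceT => x; exact: continuous_gauss_fun.
- by move=> x _; exact: gauss_fun_ge0.
Qed.

Lemma continuous_exp_excess (c g nv : R) : continuous (exp_excess c g nv).
Proof.
rewrite /exp_excess /excess => x.
apply: (@continuous_comp _ _ _ (fun s : R => c * Num.max (s ^+ 2 / (4 * g) - nv) 0)); last exact: continuous_expR.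
have h : continuous (fun s : R => s ^+ 2 / (4 * g) - nv).
  by move=> y; apply: cvgB; [apply: cvgMl; exact: exprn_continuous|exact: cvg_cst].
have -> : (fun s : R => c * Num.max (s ^+ 2 / (4 * g) - nv) 0) =
  (fun s : R => c * ((s ^+ 2 / (4 * g) - nv + `|s ^+ 2 / (4 * g) - nv|) / 2)).
  by apply/funext => s; rewrite maxr_absE subr0 addr0.
apply: cvgMr; apply: cvgMl; apply: cvgD; first exact: h.
apply: (@continuous_comp _ _ _ (fun s : R => s ^+ 2 / (4 * g) - nv)); last exact: norm_continuous.
exact: h.
Qed.

(** By symmetry twice the integral over the half-line.  The positive part
    vanishes exactly below b = 2 sqrt (nv g): there the integral is that of the
    density, and beyond b completing the exponent gives the density at q x with
    q = sqrt (1 - 2 p). *)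
Lemma integral_exp_excess (c g nv : R) : 0 < c -> c / 2 < g -> 0 <= nv ->
  \int[gam]_x exp_excess c g nv x = I_uric c g nv.
Proof.
move=> c0 cg nv0.
have g0 : 0 < g by rewrite (lt_trans _ cg)// divr_gt0.
have cb := @continuous_exp_excess c g nv.
have bp x : 0 <= exp_excess c g nv x by exact: expR_ge0.
have mf (D : set R) : measurable D -> measurable_fun D (fun x => (exp_excess c g nv x * phi x)%:E).
  move=> mD; apply/measurable_EFinP; apply: measurable_funTS; apply: measurable_funM.
    exact: continuous_measurable_fun.
  exact: measurable_normal_pdf.
have f0 x : 0 <= exp_excess c g nv x * phi x by rewrite mulr_ge0// normal_pdf_ge0.
rewrite /Rintegral ge0_integral_normal//; last exact: continuous_measurable_fun.
rewrite (ge0_symfun_integralT f0)//; last 2 first.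
- by move=> x; apply: cvgM; [exact: cb|exact: continuous_phi].
- by move=> x; rewrite /= phiN /exp_excess /excess sqrrN.
set b := 2 * Num.sqrt (nv * g).
have b0 : 0 <= b by rewrite mulr_ge0// sqrtr_ge0.
have b2 : b ^+ 2 = 4 * (nv * g) by rewrite exprMn sqr_sqrtr ?mulr_ge0// ?(ltW g0)// -natrX.
have split : [set` `[0, +oo[] = [set` `[0, b[] `|` [set` `[b, +oo[].
  by rewrite -itv_bndbnd_setU// bnd_simp.
have dis : [disjoint [set` `[0, b[] & [set` `[b, +oo[]].
  apply/disj_setPS => x [] /=; rewrite !in_itv/= andbT => /andP[_ x1] x2.
  by move: x1; rewrite ltNge x2.
have s2 : 0 < Num.sqrt 2 :> R by rewrite sqrtr_gt0.
have phi0 x : 0 <= phi x by exact: normal_pdf_ge0.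
have mphi (D : set R) : measurable D -> measurable_fun D (fun x => (phi x)%:E).
  move=> mD; apply/measurable_EFinP; apply: measurable_funTS; exact: measurable_normal_pdf.
have tail1 y : 0 <= y -> (\int[mu]_(x in `[y, +oo[) (phi x)%:E = (2^-1 * erfc (y / Num.sqrt 2))%:E)%E.
  move=> y0; have := @phi_tail 1 y ltr01 y0; rewrite mulr1 mul1r => <-.
  by apply: eq_integral => x _; rewrite mul1r.
have erfc0 : erfc (0 : R) = 1 by rewrite /erfc /erf subrr mulr0 subr0.
have head : (\int[mu]_(x in `[0%R, b[) (phi x)%:E = (2^-1 * (1 - erfc (b / Num.sqrt 2)))%:E)%E.
  have := tail1 0 (lexx _); rewrite mul0r erfc0 mulr1 split ge0_integral_setU//=; last 2 first.
  - by rewrite -split; apply: mphi.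
  - by move=> x _; rewrite lee_fin.
  rewrite (tail1 b b0).
  have : (0 <= \int[mu]_(x in `[0%R, b[) (phi x)%:E)%E by apply: integral_ge0 => x _; rewrite lee_fin.
  case: (\int[mu]_(x in `[0%R, b[) (phi x)%:E)%E => [a||]//= _ [] h.
  by congr EFin; rewrite mulrBr mulr1 -[X in _ = X - _]h; ring.
set q := Num.sqrt (1 - 2 * (c / (4 * g))).
have cg1 : c / (2 * g) < 1 by rewrite ltr_pdivrMr ?mulr_gt0// mul1r mulrC -ltr_pdivrMr.
have ep : 1 - 2 * (c / (4 * g)) = 1 - c / (2 * g) by field; rewrite gt_eqF.
have q0 : 0 < q by rewrite sqrtr_gt0 ep; lra.
have q2 : q ^+ 2 = 1 - c / (2 * g) by rewrite sqr_sqrtr ep//; lra.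
have -> : [set x : R | 0 <= x] = [set` `[0, +oo[] by rewrite set_itvcy.
rewrite split ge0_integral_setU//=; last 2 first.
- by rewrite -split; apply: mf.
- by move=> x _; rewrite lee_fin.
have -> : (\int[mu]_(x in `[0%R, b[) (exp_excess c g nv x * phi x)%:E =
    \int[mu]_(x in `[0%R, b[) (phi x)%:E)%E.
  apply: eq_integral => x; rewrite inE/= in_itv/= => /andP[x0 xb].
  rewrite /exp_excess /excess (_ : Num.max _ _ = 0) ?mulr0 ?expR0 ?mul1r//.
  apply/max_idPr; rewrite subr_le0 ler_pdivrMr ?mulr_gt0//.
  have : x ^+ 2 <= b ^+ 2 by rewrite lerXn2r ?nnegrE// ltW.
  by rewrite b2; lra.
have -> : (\int[mu]_(x in `[b, +oo[) (exp_excess c g nv x * phi x)%:E =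
    \int[mu]_(x in `[b, +oo[) ((expR (- (c * nv)))%:E * (phi (q * x))%:E))%E.
  apply: eq_integral => x; rewrite inE/= in_itv/= andbT => xb.
  rewrite -EFinM; congr EFin.
  have x0 : 0 <= x := le_trans b0 xb.
  rewrite /exp_excess /excess (_ : Num.max _ _ = x ^+ 2 / (4 * g) - nv); last first.
    apply/max_idPl; rewrite subr_ge0 ler_pdivlMr ?mulr_gt0//.
    have : b ^+ 2 <= x ^+ 2 by rewrite lerXn2r ?nnegrE.
    by rewrite b2; lra.
  rewrite !normal01E [LHS]mulrCA [RHS]mulrCA -!expRD; congr (_ * expR _).
  by rewrite exprMn q2; field; rewrite gt_eqF.
rewrite ge0_integralZl//; last 2 first.
- apply/measurable_EFinP; apply: measurable_funTS; apply: measurableT_comp.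
    exact: measurable_normal_pdf.
  exact: measurable_funM.
- by move=> x _; rewrite lee_fin.
rewrite head (phi_tail q0 b0) /= /I_uric -/q -/b [b * q]mulrC.
have -> : Num.sqrt (2 * nv * g) = b / Num.sqrt 2.
  have -> : 2 * nv * g = 2 * (nv * g) by ring.
  rewrite sqrtrM// /b; set y := Num.sqrt (nv * g).
  have : Num.sqrt 2 ^+ 2 = 2 :> R by rewrite sqr_sqrtr.
  move=> e; have {2}-> : 2 = Num.sqrt 2 ^+ 2 :> R by rewrite e.
  by field; rewrite gt_eqF.
by field; rewrite gt_eqF.
Qed.

(** I_sph is the maximum over r of the left side.  The maximiser r1, obtained
    from gamma_hat = - r1 / 2, satisfies alpha = r1 (r1 + c); with ln x <= x - 1
    the difference of the two sides is at least
    (r - r1) ^ 2 / (2 (r + c)) >= 0. *)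
Lemma I_sph_ge (c alpha r : R) : 0 < c -> 0 < alpha -> 0 < r ->
  - r / 2 - alpha / (2 * c) * ln (1 + c / r) <= I_sph c alpha.
Proof.
move=> c0 a0 r0; rewrite /I_sph /gamma_hat.
set D := Num.sqrt _; set r1 := (D - 2 * c) / 4.
have D2 : D ^+ 2 = 4 * c ^+ 2 + 16 * alpha.
  by rewrite sqr_sqrtr// addr_ge0// mulr_ge0// ?sqr_ge0// ltW.
have Dp : 2 * c < D.
  rewrite -(@ltr_pXn2r _ 2)// ?nnegrE ?sqrtr_ge0// ?mulr_ge0// ?(ltW c0)//.
  by rewrite D2 exprMn -natrX; lra.
have r10 : 0 < r1 by rewrite /r1; lra.
have eD : D = 4 * r1 + 2 * c by rewrite /r1; field.
have ea : alpha = r1 * (r1 + c) by move: D2; rewrite eD; lra.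
have -> : (2 * c - D) / 8 = - r1 / 2 by rewrite eD; field.
have -> : c / (2 * (- r1 / 2)) = - (c / r1) by field; rewrite gt_eqF.
rewrite opprK.
have p1 : 0 < 1 + c / r1 by rewrite addr_gt0// divr_gt0.
have p2 : 0 < 1 + c / r by rewrite addr_gt0// divr_gt0.
set x := (1 + c / r1) / (1 + c / r).
have x0 : 0 < x by rewrite divr_gt0.
have hx : ln x <= x - 1.
  by have := expR_ge1Dx (ln x); rewrite lnK ?posrE//; lra.
have elx : ln x = ln (1 + c / r1) - ln (1 + c / r) by rewrite lnM ?posrE ?invr_gt0// lnV.
rewrite elx in hx.
have k0 : 0 <= alpha / (2 * c) by rewrite divr_ge0 ?mulr_ge0// ltW.
have h2 := ler_wpM2l k0 hx.
have e3 : alpha / (2 * c) * (x - 1) = (r - r1) / 2 * ((r1 + c) / (r + c)).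
  rewrite /x ea; field; rewrite !gt_eqF// addr_gt0//.
have e4 : (r - r1) / 2 * ((r1 + c) / (r + c)) = (r - r1) / 2 - (r - r1) ^+ 2 / (2 * (r + c)).
  by field; rewrite gt_eqF// addr_gt0.
have e5 : 0 <= (r - r1) ^+ 2 / (2 * (r + c)).
  by rewrite divr_ge0 ?sqr_ge0// mulr_ge0// addr_ge0// ltW.
move: h2; rewrite e3 e4; lra.
Qed.

End tails.

(** * The infimum over sparse unit vectors as a random variable *)

Section dense.
Context {R : realType}.

Lemma l2norm_ge0 n (x : 'cV[R]_n) : 0 <= l2norm x. Proof. exact: sqrtr_ge0. Qed.

Lemma l2norm2 n (x : 'cV[R]_n) : l2norm x ^+ 2 = \sum_i x i 0 ^+ 2.
Proof. by rewrite sqr_sqrtr// sumr_ge0// => i _; exact: sqr_ge0. Qed.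

Lemma l2normZ n (a : R) (x : 'cV[R]_n) : 0 <= a -> l2norm (a *: x) = a * l2norm x.
Proof.
move=> a0; rewrite /l2norm -[X in X * _]ger0_norm// -sqrtr_sqr -sqrtrM ?sqr_ge0//.
by rewrite mulr_sumr; congr Num.sqrt; apply: eq_bigr => i _; rewrite mxE exprMn.
Qed.

Lemma l0normZ n (a : R) (x : 'cV[R]_n) : a != 0 -> l0norm (a *: x) = l0norm x.
Proof.
move=> a0; rewrite /l0norm; apply: eq_card => i; rewrite !inE mxE mulf_eq0.
by rewrite (negbTE a0).
Qed.

Lemma l2norm_gt0 n (x : 'cV[R]_n) : (0 < l0norm x)%N -> 0 < l2norm x.
Proof.
rewrite /l0norm => /card_gt0P[i]; rewrite inE => xi.
rewrite sqrtr_gt0 (bigD1 i)//= ltr_wpDr//.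
  by apply: sumr_ge0 => j _; exact: sqr_ge0.
by rewrite lt_neqAle sqr_ge0 eq_sym sqrf_eq0 xi.
Qed.

Lemma S_ric_nonempty n k : (0 < k)%N -> (k <= n)%N -> exists x : 'cV[R]_n, S_ric k x.
Proof.
move=> k0 kn.
pose y : 'cV[R]_n := \col_i (i < k)%N%:R.
have ly : l0norm y = k.
  rewrite /l0norm -[RHS](card_ord k).
  have inj : injective (widen_ord kn) by move=> i j /(congr1 val)/= h; exact: val_inj.
  rewrite -(card_codom inj); apply: eq_card => i; rewrite !inE mxE pnatr_eq0 eqb0 negbK.
  apply/idP/codomP => [ik|[j ->]]; last by rewrite /= ltn_ord.
  by exists (Ordinal ik); apply: val_inj.
have y0 : 0 < l2norm y by apply: l2norm_gt0; rewrite ly.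
exists ((l2norm y)^-1 *: y); split.
  by rewrite l2normZ ?invr_ge0 ?(ltW y0)// mulVf// gt_eqF.
by rewrite l0normZ// invr_eq0 gt_eqF.
Qed.

Lemma continuous_sumr (X : topologicalType) (I : Type) (r : seq I) (F : I -> X -> R) :
  (forall i, continuous (F i)) -> continuous (fun y => \sum_(i <- r) F i y).
Proof.
move=> cF; elim: r => [|i r IH].
  by under eq_fun do rewrite big_nil; move=> x; exact: cvg_cst.
under eq_fun do rewrite big_cons.
by move=> x; apply: cvgD; [exact: cF|exact: IH].
Qed.

(** A rational vector close to x with the same support, divided by its norm.
    The comparison |A y| < t |y| is homogeneous and open in y, so it passes from
    x to nearby rational vectors before normalisation. *)
Lemma dense_family n k : (0 < k)%N -> (k <= n)%N ->
  exists x_ : nat -> 'cV[R]_n, (forall i, S_ric k (x_ i)) /\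
    forall m (A : 'M[R]_(m, n)) t x, S_ric k x -> l2norm (A *m x) < t ->
      exists i, l2norm (A *m x_ i) < t.
Proof.
move=> k0 kn; have [xd hd] := S_ric_nonempty k0 kn.
pose emb (q : 'cV[rat]_n) : 'cV[R]_n := map_mx ratr q.
pose nrm (y : 'cV[R]_n) : 'cV[R]_n := (l2norm y)^-1 *: y.
pose x_ i := if unpickle i is Some q then
   (if l0norm (emb q) == k then nrm (emb q) else xd) else xd.
have nrmS y : l0norm y = k -> S_ric k (nrm y).
  move=> yk; have y0 : 0 < l2norm y by apply: l2norm_gt0; rewrite yk.
  split; first by rewrite l2normZ ?invr_ge0 ?(ltW y0)// mulVf// gt_eqF.
  by rewrite l0normZ// invr_eq0 gt_eqF.
exists x_; split.
  by move=> i; rewrite /x_; case: unpickle => // q; case: eqP => // /nrmS.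
move=> m A t x [x1 xk] Axt.
have t0 : 0 < t := le_lt_trans (l2norm_ge0 _) Axt.
pose f (y : 'cV[R]_n) : R := \sum_i (A *m y) i 0 ^+ 2 - t ^+ 2 * \sum_j y j 0 ^+ 2.
have cf : continuous f.
  have cc j : continuous (fun y : 'cV[R]_n => y j 0) by exact: coord_continuous.
  have cs (X : topologicalType) (g : X -> R) : continuous g -> continuous (fun y => g y ^+ 2).
    move=> cg; rewrite (_ : (fun _ => _) = (fun y => g y * g y)); last first.
      by apply/funext => z; rewrite expr2.
    by move=> y; apply: cvgM; exact: cg.
  have cm (X : topologicalType) (a : R) (g : X -> R) : continuous g -> continuous (fun y => a * g y).
    by move=> cg y; apply: (@cvgM _ _ _ _ (fun=> a) g); [exact: cvg_cst|exact: cg].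
  have c1 : continuous (fun y : 'cV[R]_n => \sum_i (A *m y) i 0 ^+ 2).
    apply: continuous_sumr => i; apply: cs.
    rewrite (_ : (fun _ => _) = (fun y : 'cV[R]_n => \sum_j A i j * y j 0)); last first.
      by apply/funext => z; rewrite mxE.
    by apply: continuous_sumr => j; apply: cm; exact: cc.
  have c2 : continuous (fun y : 'cV[R]_n => \sum_j y j 0 ^+ 2).
    by apply: continuous_sumr => j; apply: cs; exact: cc.
  move=> y; apply: (@cvgB _ _ _ _ _ (fun y : 'cV[R]_n => \sum_i (A *m y) i 0 ^+ 2)
    (fun y : 'cV[R]_n => t ^+ 2 * \sum_j y j 0 ^+ 2)); [exact: nbhs_filter|exact: c1|exact: cm].
have fx : f x < 0.
  rewrite /f -!l2norm2 x1 expr1n mulr1 subr_lt0 ltrXn2r// ?nnegrE ?l2norm_ge0// ltW//.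
have : \forall y \near x, f y < 0 by apply: (cvgr_lt _ (cf x)); exact: fx.
move=> /nbhs_ballP[e /= e0 he].
(* Zero entries stay zero and nonzero entries stay nonzero: the rational
   approximation must keep exactly k nonzero entries. *)
have qex j : exists q : rat, `|x j 0 - ratr q| < e /\ ((q == 0) = (x j 0 == 0)).
  have [->|xj] := eqVneq (x j 0) 0.
    by exists 0; rewrite eqxx rmorph0 subr0 normr0.
  have ax : 0 < `|x j 0| by rewrite normr_gt0.
  pose dl := Num.min e `|x j 0|.
  have dl0 : 0 < dl by rewrite lt_min e0.
  have lo : x j 0 - dl < x j 0 + dl by rewrite ltrBlDr -addrA ltrDl addr_gt0.
  have [q] := rat_in_itvoo lo.
  rewrite in_itv/= => /andP[q1 q2].
  have qd : `|x j 0 - ratr q| < dl by rewrite distrC ltr_distl q1 q2.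
  exists q; split; first by rewrite (lt_le_trans qd)// ge_min lexx.
  apply/negbTE; apply/negP => /eqP q00; move: qd.
  by rewrite q00 rmorph0 subr0 ltNge ge_min lexx orbT.
have /choice[qf hq] := qex.
pose q : 'cV[rat]_n := \col_j qf j.
have eq j : emb q j 0 = ratr (qf j) by rewrite !mxE.
have lq : l0norm (emb q) = k.
  rewrite -xk /l0norm; apply: eq_card => j; rewrite !inE eq fmorph_eq0.
  by have [_ ->] := hq j.
have fq : f (emb q) < 0.
  apply: he; split => // i j; rewrite ord1 eq /ball/=; by have [] := hq i.
exists (pickle q); rewrite /x_ pickleK lq eqxx /nrm.
have y0 : 0 < l2norm (emb q) by apply: l2norm_gt0; rewrite lq.
rewrite -scalemxAr l2normZ ?invr_ge0 ?(ltW y0)// mulrC ltr_pdivrMr//.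
rewrite -(@ltr_pXn2r _ 2)// ?nnegrE ?l2norm_ge0// ?mulr_ge0 ?(ltW t0) ?(ltW y0)//.
by move: fq; rewrite /f -!l2norm2 exprMn subr_lt0.
Qed.

End dense.

Section xi_event.
Context {R : realType} (m n k : nat).
Context {d : measure_display} {T : measurableType d} {P : probability T R}.
Variable A : 'I_m * 'I_n -> {RV P >-> R}.
Hypotheses (k0 : (0 < k)%N) (kn : (k <= n)%N).

Let xi w : R := xi_lric k (random_mx A w).

Lemma xi_lric_ge0 (k' m' n' : nat) (B : 'M[R]_(m', n')) : 0 <= xi_lric k' B.
Proof.
rewrite /xi_lric; set E := [set _ | _ in _].
have E0 : lbound E 0 by move=> y [x _ <-]; exact: l2norm_ge0.
have [ne|/set0P/negP/negPn/eqP ->] := pselect (E !=set0); last by rewrite inf0.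
exact: lb_le_inf.
Qed.

Lemma xi_ltP w t : xi w < t <-> exists2 x, S_ric k x & l2norm (random_mx A w *m x) < t.
Proof.
have [xd hd] := @S_ric_nonempty R n k k0 kn.
have hi : has_inf [set l2norm (random_mx A w *m x) | x in @S_ric R n k].
  split; first by exists (l2norm (random_mx A w *m xd)), xd.
  by exists 0 => y [x _ <-]; exact: l2norm_ge0.
split.
  by move=> /(inf_lt (proj1 hi))[y [x hx <-] yt]; exists x.
move=> [x hx xt]; apply: le_lt_trans xt; apply: ge_inf; first by case: hi.
by exists x.
Qed.

(** The infimum is below t as soon as some vector of the dense family gives a
    value below t, which exhibits the event as an increasing union over finite
    families.  Measurability and probability bounds follow from the finite
    case. *)
Lemma xi_event t : exists x_ : nat -> 'cV[R]_n, (forall i, S_ric k (x_ i)) /\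
  [set w | xi w < t] = \bigcup_r small_event (r := r) (fun a : 'I_r => x_ a) A t.
Proof.
have [x_ [hS hd]] := @dense_family R n k k0 kn.
exists x_; split => //; apply/seteqP; split => w /=.
  move=> /xi_ltP[x hx xt]; have [i hi] := hd _ _ _ _ hx xt.
  by exists i.+1 => //; exists ord_max.
by move=> [r _ [a ha]]; apply/xi_ltP; exists (x_ a).
Qed.

Lemma measurable_xi_lt t : measurable [set w | xi w < t].
Proof.
have [x_ [_ ->]] := xi_event t.
by apply: bigcup_measurable => r _; exact: measurable_small.
Qed.

Lemma measurable_xi : measurable_fun setT xi.
Proof.
apply: (measurability (@RGenInftyO.G R)); first exact: RGenInftyO.measurableE.
move=> _ [_ [t ->] <-]; rewrite setTI.
rewrite (_ : _ @^-1` _ = [set w | xi w < t]); first exact: measurable_xi_lt.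
by apply/seteqP; split => w /=; rewrite in_itv.
Qed.

Lemma prob_xi_le t (B : R) :
  (forall r (x : 'I_r -> 'cV[R]_n), (forall a, S_ric k (x a)) ->
     fine (P (small_event x A t)) <= B) ->
  (P [set w | (xi w < t)%R] <= B%:E)%E.
Proof.
move=> H; have [x_ [hS ->]] := xi_event t.
set E := fun r => small_event (r := r) (fun a : 'I_r => x_ a) A t.
have mE r : measurable (E r) by exact: measurable_small.
have cv : P (E r) @[r --> \oo] --> P (\bigcup_r E r).
  apply: nondecreasing_cvg_mu => //; first exact: bigcup_measurable.
  move=> r s rs; apply/subsetPset => w [a ha]; exists (widen_ord rs a) => //.
apply: (cvge_le _ cv); apply: nearW => r.
rewrite -[P (E r)]fineK ?fin_num_measure// lee_fin.
exact: H.
Qed.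

End xi_event.

(** * The lower tail in fixed dimension *)

Section finite.
Context {R : realType}.
Local Notation gam := (normal_prob (0 : R) 1).

Lemma I_uric_gt0 (c g nv : R) : 0 < c -> c / 2 < g -> 0 <= nv -> 0 < I_uric c g nv.
Proof.
move=> c0 cg nv0; rewrite -integral_exp_excess// (@lt_le_trans _ _ 1)//.
rewrite -[leLHS](Rintegral_prob_cst (P := gam)); apply: le_Rintegral => //.
- by apply: (@integrable_bounded_prob _ _ _ gam _ 1) => // w; rewrite normr1.
- exact: integrable_exp_excess.
- by move=> x _; rewrite /exp_excess -[leLHS]expR0 ler_expR mulr_ge0 ?(ltW c0)// /excess le_max lexx orbT.
Qed.

(** For a finite radius r the product of m factors (1 + c / r) ^ (-1/2) and the
    tangent constant is expR of n c times the left side of [I_sph_ge], up to the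
    discretisation error 1 / (2 N) and the rounding of m; L is taken so large
    that the outer region is no worse. *)
Lemma tan_term_le (c alpha n : R) (m N L : nat) (o : option 'I_L) :
  0 < c -> 0 < alpha -> 0 <= n -> (0 < N)%N -> alpha * n - 1 <= m%:R ->
  - I_sph c alpha <= L%:R / N%:R ->
  expR (tan_const c n N o) * (Num.sqrt (1 + tan_slope c N o))^-1 ^+ m <=
  expR (c * N%:R / 2 + c * n * (I_sph c alpha + (2 * N%:R)^-1)).
Proof.
move=> c0 a0 n0 N0 hm hL.
have N0' : 0 < N%:R :> R by rewrite ltr0n.
case: o => [l|] /=; last first.
  rewrite addr0 sqrtr1 invr1 expr1n mulr1 ler_expR.
  have h1 : - (c * n * (L%:R / N%:R)) <= c * n * I_sph c alpha.
    by rewrite -mulrN ler_wpM2l ?mulr_ge0 ?(ltW c0)// lerNl.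
  have h2 : 0 <= c * N%:R / 2 by rewrite divr_ge0// mulr_ge0// ltW.
  have h3 : 0 <= c * n * (2 * N%:R)^-1.
    by rewrite mulr_ge0 ?mulr_ge0 ?(ltW c0)// invr_ge0 mulr_ge0// ltW.
  rewrite [in leRHS]mulrDr; apply: (le_trans h1); rewrite [leRHS]addrCA lerDl; exact: addr_ge0.
set r := grid_radius N l.
have r0 : 0 < r by rewrite divr_gt0// ltr0n.
have cr0 : 0 < c / r by rewrite divr_gt0.
have pos : 0 < 1 + c / r by rewrite addr_gt0.
set lam := ln (1 + c / r).
have lam0 : 0 <= lam by rewrite ln_ge0// lerDl ltW.
have lamN : lam <= c * N%:R.
  have : lam <= c / r by rewrite -[leRHS]expRK ler_ln ?posrE ?expR_gt0// expR_ge1Dx.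
  move=> /le_trans; apply; rewrite ler_wpM2l ?(ltW c0)// /r invf_div.
  by rewrite ler_pdivrMr ?ltr0n// ler_peMr// ler1n.
have es : (Num.sqrt (1 + c / r))^-1 = expR (- (lam / 2)).
  rewrite expRN; congr (_^-1); apply/eqP.
  rewrite -(@eqrXn2 _ 2) ?sqrtr_ge0 ?expR_ge0//.
  rewrite sqr_sqrtr ?(ltW pos)// -expRM_natl mulr_natl -mulr_natr divfK ?pnatr_eq0//.
  by rewrite lnK// posrE.
rewrite es -expRM_natl -expRD ler_expR.
have hs := I_sph_ge c0 a0 r0; rewrite -/lam in hs.
have h1 : c * n * (- r / 2 - alpha / (2 * c) * lam) <= c * n * I_sph c alpha.
  by rewrite ler_wpM2l// mulr_ge0// ltW.
have h2 : (alpha * n - 1) * lam <= m%:R * lam by rewrite ler_wpM2r.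
have e1 : c * n * (- r / 2 - alpha / (2 * c) * lam) = - (c * n * r / 2) - alpha * n * lam / 2.
  by field; rewrite gt_eqF.
rewrite e1 in h1; rewrite [in leRHS]mulrDr.
set u := (2 * N%:R)^-1; move: h1 h2 lamN; nra.
Qed.

(** Gordon's comparison joins [small_event_bound] and [upper_bound] with
    s0 = c S: lower bounding the Gaussian tail by expR (- (c S + 1) ^ 2 / 2) and
    dividing leaves expR (c ^ 2 n / 2 - c ^ 2 n) = expR (- c ^ 2 n / 2), which is
    the term - c / 2 of the lifted bound. *)
Lemma prob_xi_finite (alpha c g nv t S : R) (N L m n k : nat)
    (d : measure_display) (T : measurableType d) (P : probability T R)
    (A : 'I_m * 'I_n -> {RV P >-> R}) :
  iid_std_normal A -> (0 < k)%N -> (k <= n)%N ->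
  0 < c -> c / 2 < g -> 0 <= nv -> 0 < alpha -> (0 < N)%N ->
  alpha * n%:R - 1 <= m%:R -> - I_sph c alpha <= L%:R / N%:R ->
  S = Num.sqrt n%:R ->
  (P [set w | (xi_lric k (random_mx A w) < t)%R] <=
   (L.+1%:R * Num.sqrt (pi *+ 2) *
    expR ((c * S + 1) ^+ 2 / 2 + (c * S * (4 + t - c * S) + c * k%:R * nv + c * n%:R * g +
      n%:R * ln (I_uric c g nv) +
      (c * N%:R / 2 + c * n%:R * (I_sph c alpha + (2 * N%:R)^-1)))))%:E)%E.
Proof.
move=> Aiid k0 kn c0 cg nv0 a0 N0 hm hL SE.
have n0 : 0 < n%:R :> R by rewrite ltr0n (leq_trans k0).
have S0 : 0 < S by rewrite SE sqrtr_gt0.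
have S2 : S ^+ 2 = n%:R by rewrite SE sqr_sqrtr// ltW.
have I0 := I_uric_gt0 c0 cg nv0.
apply: prob_xi_le => // r x hx.
have Xu a : \sum_j x a j 0 ^+ 2 = 1 by rewrite -l2norm2; case: (hx a) => -> _; rewrite expr1n.
have Xk a : l0norm (x a) = k by case: (hx a).
have h1 := small_event_bound x Aiid t (c * S).
have h2 := gordon_comparison (m := m) Xu (1 + t - c * S) (index_enum 'I_r) 0.
have h3 := upper_bound m Xu Xk (1 + t - c * S) L S0 c0 cg nv0 N0.
have s0 : 0 <= c * S by rewrite mulr_ge0 ?ltW.
have h4 := normal_tail_ge s0.
set p := fine _.
have p0 : 0 <= p by exact: fine_ge0.
set kap := Num.sqrt (pi *+ 2).
have kap0 : 0 < kap :> R by rewrite sqrtr_gt0 mulrn_wgt0// pi_gt0.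
set q := (c * S + 1) ^+ 2 / 2.
set Q := _ + n%:R * ln _ + _.
have h5 : p * (kap^-1 * expR (- q)) <= L.+1%:R * expR Q.
  apply: (@le_trans _ _ (p * fine (gam `]-oo, (- (c * S))%R]%classic))); first by rewrite ler_wpM2l.
  apply: (le_trans h1); apply: (@le_trans _ _ (1 - gTs (dirsR m x) (prodF (1 + t - c * S) (index_enum 'I_r)) 0)).
    by rewrite lerD2l lerN2.
  apply: (le_trans h3).
  have -> : L.+1%:R * expR Q = \sum_(o : option 'I_L) expR Q.
    by rewrite sumr_const card_option card_ord mulr_natl.
  apply: ler_sum => o _.
  have tt := tan_term_le o c0 a0 (ltW n0) N0 hm hL.
  rewrite integral_exp_excess// /tangent_weight expRD S2.
  have -> : I_uric c g nv ^+ n = expR (n%:R * ln (I_uric c g nv)) by rewrite expRM_natl lnK.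
  rewrite [X in _ * X]mulrC mulrACA -expRD.
  have -> : c * S * (1 + t - c * S + 3) = c * S * (4 + t - c * S) by ring.
  rewrite [leRHS]expRD; apply: ler_wpM2l => //; exact: expR_ge0.
have -> : L.+1%:R * kap * expR (q + Q) = kap * expR q * (L.+1%:R * expR Q).
  by rewrite expRD; ring.
apply: le_trans (ler_wpM2l _ h5); last by rewrite mulr_ge0 ?expR_ge0// ltW.
by rewrite expRN mulrCA mulrACA divff ?gt_eqF// mul1r divff ?mulr1// gt_eqF ?expR_gt0.
Qed.

(** With t = y sqrt n and fixed parameters the exponent of [prob_xi_finite] is
    n c G + O (sqrt n), where G < 0 is the left side of the hypothesis, up to
    the error c n / (2 N); N is chosen so that this error uses at most half of
    the gap. *)
Lemma prob_xi_exp (alpha beta c g nv y y1 : R) :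
  0 < c -> c / 2 < g -> 0 <= nv -> 0 < alpha -> 0 <= y1 ->
  y - c / 2 + (nv * beta + g + c^-1 * ln (I_uric c g nv)) + I_sph c alpha < 0 ->
  exists K a b : R, [/\ 0 < K, 0 < a &
    forall (m n k : nat) (d : measure_display) (T : measurableType d) (P : probability T R)
      (A : 'I_m * 'I_n -> {RV P >-> R}) (t : R),
      iid_std_normal A -> (0 < k)%N -> (k <= n)%N ->
      alpha * n%:R - 1 <= m%:R -> k%:R <= beta * n%:R + 1 ->
      t <= y * Num.sqrt n%:R + y1 ->
      (P [set w | (xi_lric k (random_mx A w) < t)%R] <=
       (K * expR (b * Num.sqrt n%:R - a * n%:R))%:E)%E].
Proof.
move=> c0 cg nv0 a0 y10; set G := _ + I_sph _ _ => G0.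
have nG0 : 0 < - G by rewrite oppr_gt0.
pose N := (Num.truncn (- G)^-1).+1.
have N0 : (0 < N)%N by [].
have N0' : 0 < N%:R :> R by rewrite ltr0n.
have Nl : (2 * N%:R)^-1 <= - G / 2.
  rewrite invfM mulrC ler_pM2r ?invr_gt0// -[leRHS]invrK lef_pV2 ?posrE ?invr_gt0//.
  exact/ltW/truncnS_gt.
pose L := (Num.truncn (N%:R * - I_sph c alpha)).+1.
have hL : - I_sph c alpha <= L%:R / N%:R.
  by rewrite ler_pdivlMr// mulrC; exact/ltW/truncnS_gt.
pose D : R := 1 / 2 + c * nv + c * N%:R / 2.
exists (L.+1%:R * Num.sqrt (pi *+ 2) * expR D), (c * (- G) / 2), (c * (5 + y1)).
split.
- by rewrite mulr_gt0 ?expR_gt0// mulr_gt0 ?ltr0n// sqrtr_gt0 mulrn_wgt0// pi_gt0.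
- by rewrite divr_gt0// mulr_gt0.
move=> m n k d T P A t Aiid k0 kn hm hk ht.
set S := Num.sqrt n%:R.
have S2 : S ^+ 2 = n%:R by rewrite sqr_sqrtr.
have S0 : 0 <= S by exact: sqrtr_ge0.
have := @prob_xi_finite alpha c g nv t S N L m n k d T P A Aiid k0 kn c0 cg nv0 a0 N0 hm hL erefl.
move=> /le_trans; apply; rewrite lee_fin -[leRHS]mulrA -expRD.
apply: ler_wpM2l; first by rewrite mulr_ge0 ?sqrtr_ge0.
rewrite ler_expR -/S.
have e1 : c * S * t <= c * S * (y * S + y1) by rewrite ler_wpM2l// mulr_ge0// ltW.
have e2 : c * nv * k%:R <= c * nv * (beta * n%:R + 1) by rewrite ler_wpM2l// mulr_ge0// ltW.
have e3 : c * n%:R * (2 * N%:R)^-1 <= c * n%:R * (- G / 2) by rewrite ler_wpM2l// mulr_ge0// ltW.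
have e4 : c * n%:R * G = c * n%:R * (y - c / 2 + nv * beta + g + I_sph c alpha) + n%:R * ln (I_uric c g nv).
  by rewrite /G; field; rewrite gt_eqF.
rewrite /D; move: e1 e2 e3 e4; rewrite -S2; set u := (2 * N%:R)^-1; set Ish := I_sph _ _; set J := ln _.
move: S0 c0; clear; lra.
Qed.

(** Completing the square, b S - a S ^ 2 <= b ^ 2 / (2 a) - a S ^ 2 / 2. *)
Lemma exp_decay (K a b : R) : 0 <= K -> 0 < a ->
  K * expR (b * Num.sqrt n%:R - a * n%:R) @[n --> \oo] --> (0 : R).
Proof.
move=> K0 a0.
pose z := expR (- (a / 2)).
have z1 : `|z| < 1 by rewrite ger0_norm ?expR_ge0// -[ltRHS]expR0 ltr_expR oppr_lt0 divr_gt0.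
have cz : K * expR (b ^+ 2 / (2 * a)) * z ^+ n @[n --> \oo] --> (0 : R).
  rewrite -[X in _ --> X](mulr0 (K * expR (b ^+ 2 / (2 * a)))).
  by apply: cvgM; [exact: cvg_cst|exact: cvg_expr].
apply: (squeeze_cvgr _ (cvg_cst 0) cz); apply: nearW => n.
rewrite mulr_ge0 ?expR_ge0//= -mulrA ler_wpM2l// /z -expRM_natl -expRD ler_expR.
set S := Num.sqrt n%:R.
have S2 : S ^+ 2 = n%:R by rewrite sqr_sqrtr.
rewrite -S2 -subr_ge0.
have -> : b ^+ 2 / (2 * a) + S ^+ 2 * - (a / 2) - (b * S - a * S ^+ 2) =
   (a * S - b) ^+ 2 / (2 * a) by field; rewrite gt_eqF.
by rewrite divr_ge0 ?sqr_ge0// mulr_ge0// ltW.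
Qed.

End finite.

(** * Inferior limits and expectations *)

Section ereal_limits.
Context {R : realType}.

Lemma lee_real_sub (x y : \bar R) :
  (forall r e : R, (r%:E < x)%E -> 0 < e -> ((r - e)%:E <= y)%E) -> (x <= y)%E.
Proof.
move=> h; case: x h => [x||] h; last by rewrite leNye.
  apply/lee_subgt0Pr => e e0.
  have e20 : 0 < e / 2 by rewrite divr_gt0.
  have := h (x - e / 2) (e / 2); rewrite lte_fin gtrBl => /(_ e20 e20).
  by rewrite -EFinB; congr (_%:E <= _)%E; lra.
suff -> : y = +oo%E by [].
apply/eqyP => M _; have := h (M + 1) 1 (ltry _) ltr01.
by rewrite addrK.
Qed.

Lemma limn_einf_ge (u : nat -> \bar R) (x : \bar R) :
  (\forall n \near \oo, (x <= u n)%E) -> (x <= limn_einf u)%E.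
Proof.
move=> [N _ hN]; rewrite limn_einf_lim; apply: lime_ge; first exact: is_cvg_einfs.
exists N => // n /= Nn; apply: le_ereal_inf_tmp => _ [j /= nj <-]; apply: hN => /=.
exact: leq_trans nj.
Qed.

(** Markov's inequality, for a nonnegative function that is not bundled as a
    random variable. *)
Lemma expectation_ge d (T : measurableType d) (P : probability T R) (X : T -> R) (t : R) :
  measurable_fun setT X -> (forall w, 0 <= X w) -> 0 <= t ->
  (t%:E * P [set w | (t <= X w)%R] <= 'E_P[X])%E.
Proof.
move=> mX X0 t0; rewrite unlock.
have mE : measurable [set w | (t <= X w)%R].
  rewrite -[X in measurable X]setTI; exact: measurable_fun_le.
rewrite -(setIT [set w | _]) -(integral_indic P measurableT mE) -ge0_integralZl_EFin//; last first.
  by apply/measurable_EFinP; exact: measurable_indic.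
apply: ge0_le_integral => //.
- by move=> w _; rewrite mule_ge0// lee_fin.
- by apply: measurable_funeM; apply/measurable_EFinP; exact: measurable_indic.
- exact/measurable_EFinP.
move=> w _; rewrite -EFinM lee_fin indicE; case: (boolP (w \in _)) => hw.
  by rewrite mulr1; move: hw; rewrite inE.
by rewrite mulr0.
Qed.

(** A strict inequality below the supremum over c of minus an infimum over
    (gamma, nu) is witnessed by some c, gamma and nu. *)
Lemma lric_lower_bound_lt (alpha beta y : R) : 0 < alpha ->
  (y%:E < lric_lower_bound alpha beta)%E ->
  exists c g nv : R, [/\ 0 < c, c / 2 < g, 0 <= nv &
    Num.sqrt alpha * y - c / 2 + (nv * beta + g + c^-1 * ln (I_uric c g nv)) + I_sph c alpha < 0].
Proof.
move=> a0; rewrite /lric_lower_bound lte_pdivlMl ?sqrtr_gt0// => /ereal_sup_gt[_ [c /= c0 <-]].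
rewrite lteNr => h.
have : (I_lric c beta < (- (Num.sqrt alpha * y) + c / 2 - I_sph c alpha)%:E)%E.
  move: h; case: (I_lric c beta) => [i||] //=; last by move=> _; exact: ltNyr.
  by rewrite -!EFinD !lte_fin; lra.
move=> /ereal_inf_lt[_ [[g nv] /= [cg nv0] <-]]; rewrite lte_fin => h2.
by exists c, g, nv; split => //; lra.
Qed.

End ereal_limits.

(** * The lifted lower bound *)

Unset Implicit Arguments.

Section main.
Context {R : realType} (alpha beta : R).
Hypotheses (beta_gt0 : 0 < beta) (beta_lt_alpha : beta < alpha) (alpha_lt1 : alpha < 1).
Variables (m k : nat -> nat).
Hypotheses (m_round : forall n : nat, rounds_to (alpha * n%:R) (m n))
    (k_round : forall n : nat, rounds_to (beta * n%:R) (k n)).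
Context (d : nat -> measure_display) (T : forall n : nat, measurableType (d n))
    (P : forall n : nat, probability (T n) R)
    (A : forall n : nat, 'I_(m n) * 'I_n -> {RV (P n) >-> R})
    (A_iid : forall n : nat, iid_std_normal (A n)).
Let xi (n : nat) (w : T n) : R := xi_lric (k n) (random_mx (A n) w).

Lemma near_sizes : \forall n \near \oo, [/\ (0 < k n)%N, (k n <= n)%N & (0 < m n)%N].
Proof.
have a0 : 0 < alpha by exact: lt_trans beta_lt_alpha.
have b1 : 0 < 1 - beta by rewrite subr_gt0 (lt_trans beta_lt_alpha).
near=> n.
have hb : 1 / beta < n%:R :> R by near: n; exact: nbhs_infty_gtr.
have ha : 1 / alpha < n%:R :> R by near: n; exact: nbhs_infty_gtr.
have hc : 1 / (1 - beta) < n%:R :> R by near: n; exact: nbhs_infty_gtr.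
rewrite ltr_pdivrMr// in hb; rewrite ltr_pdivrMr// in ha; rewrite ltr_pdivrMr// in hc.
have := m_round n; have := k_round n; rewrite /rounds_to !ltr_distl => /andP[k1 k2] /andP[m1 m2].
split.
- by rewrite -(ltr_nat R); lra.
- by rewrite -(ler_nat R); lra.
- by rewrite -(ltr_nat R); lra.
Unshelve. all: by end_near. Qed.

(** The rounding of m is absorbed by sqrt m <= sqrt alpha sqrt n + 1. *)
Lemma prob_small_cvg0 (y : R) : 0 <= y -> (y%:E < lric_lower_bound alpha beta)%E ->
  fine (P n [set w | (xi n w < y * Num.sqrt (m n)%:R)%R]) @[n --> \oo] --> (0 : R).
Proof.
move=> y0 hy; have a0 : 0 < alpha by exact: lt_trans beta_lt_alpha.
have [c [g [nv [c0 cg nv0 h]]]] := lric_lower_bound_lt a0 hy.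
have [K [a [b [K0 a1 hP]]]] := prob_xi_exp c0 cg nv0 a0 y0 h.
apply: (squeeze_cvgr _ (cvg_cst 0) (exp_decay b (ltW K0) a1)).
apply: filterS near_sizes => n [k0 kn m0].
rewrite fine_ge0//=.
have := m_round n; have := k_round n; rewrite /rounds_to !ltr_distl => /andP[k1 k2] /andP[m1 m2].
rewrite -lee_fin fineK; last exact/fin_num_measure/measurable_xi_lt.
apply: hP => //; rewrite ?(ltW m1) ?(ltW k2)//.
rewrite [X in _ <= X * _ + _]mulrC -mulrA -[X in _ + X]mulr1 -mulrDr ler_wpM2l//.
rewrite -(@ler_pXn2r _ 2)// ?nnegrE ?addr_ge0 ?mulr_ge0 ?sqrtr_ge0//.
rewrite sqrrD expr1n mulr1 exprMn !sqr_sqrtr ?(ltW a0)//.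
have := mulr_ge0 (sqrtr_ge0 alpha) (sqrtr_ge0 (n%:R : R)); lra.
Qed.

Lemma xi_ge0 n w : 0 <= xi n w. Proof. exact: xi_lric_ge0. Qed.

Lemma near_prob_ge (y : R) : \forall n \near \oo,
  (P n [set w | (y * Num.sqrt (m n)%:R <= xi n w)%R] =
   (1 - fine (P n [set w | (xi n w < y * Num.sqrt (m n)%:R)%R]))%:E)%E.
Proof.
apply: filterS near_sizes => n [k0 kn m0].
have mE := measurable_xi_lt (A n) k0 kn (y * Num.sqrt (m n)%:R).
rewrite (_ : [set w | _] = ~` [set w | (xi n w < y * Num.sqrt (m n)%:R)%R]); last first.
  by apply/seteqP; split => w /=; rewrite leNgt => /negP.
by rewrite probability_setC// EFinB fineK// fin_num_measure.
Qed.

(** For negative y the event is everything because xi is nonnegative. *)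
Lemma prob_large_cvg1 (y : R) : (y%:E < lric_lower_bound alpha beta)%E ->
  P n [set w | (y * Num.sqrt (m n)%:R <= xi n w)%R] @[n --> \oo] --> 1%E.
Proof.
move=> hy; have [y0|y0] := leP 0 y; last first.
  rewrite (_ : (fun n => _) = fun=> 1%E); first exact: cvg_cst.
  apply/funext => n; rewrite -(probability_setT (P n)); congr (P n _).
  apply/seteqP; split => w //= _; apply: le_trans (xi_ge0 _ w).
  by rewrite mulr_le0_ge0 ?sqrtr_ge0// ltW.
have h := prob_small_cvg0 _ y0 hy.
have h1 : (1 - fine (P n [set w | (xi n w < y * Num.sqrt (m n)%:R)%R]))%:E @[n --> \oo] --> 1%E.
  apply: cvg_EFin; first exact: nearW.
  by rewrite -[X in _ --> X](subr0 1); apply: cvgB => //; exact: cvg_cst.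
apply: cvg_trans h1; apply: near_eq_cvg.
by apply: filterS (near_prob_ge y) => n ->.
Qed.

(** Markov's inequality with the threshold y sqrt m: E xi / sqrt m is at least
    y (1 - o(1)) for every y below the bound. *)
Lemma expectation_liminf :
  (lric_lower_bound alpha beta <=
     limn_einf (fun n : nat => 'E_(P n)[xi n] * (Num.sqrt (m n)%:R)^-1%:E))%E.
Proof.
apply: lee_real_sub => y e hy e0; apply: limn_einf_ge.
have [y0|y0] := leP 0 y; last first.
  apply: nearW => n; apply: (@le_trans _ _ 0%E).
    by rewrite lee_fin; lra.
  by rewrite mule_ge0// ?lee_fin ?invr_ge0 ?sqrtr_ge0// expectation_ge0// => w; exact: xi_ge0.
have h := prob_small_cvg0 _ y0 hy.
have y1 : 0 < y + 1 by lra.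
have hs : \forall n \near \oo, fine (P n [set w | (xi n w < y * Num.sqrt (m n)%:R)%R]) < e / (y + 1).
  by apply: (cvgr_lt _ h); rewrite divr_gt0.
near=> n.
have hn : fine (P n [set w | (xi n w < y * Num.sqrt (m n)%:R)%R]) < e / (y + 1) by near: n; exact: hs.
have hp : (P n [set w | (y * Num.sqrt (m n)%:R <= xi n w)%R] =
   (1 - fine (P n [set w | (xi n w < y * Num.sqrt (m n)%:R)%R]))%:E)%E.
  by near: n; exact: near_prob_ge.
have [k0 kn m0] : [/\ (0 < k n)%N, (k n <= n)%N & (0 < m n)%N] by near: n; exact: near_sizes.
have s0 : 0 < Num.sqrt (m n)%:R :> R by rewrite sqrtr_gt0 ltr0n.
rewrite lee_pdivlMr//.
have t0 : 0 <= y * Num.sqrt (m n)%:R by rewrite mulr_ge0// ltW.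
have := expectation_ge (P n) (measurable_xi (A n) k0 kn) (fun w => xi_ge0 n w) t0.
apply: le_trans; rewrite hp -!EFinM lee_fin [leRHS]mulrAC ler_pM2r//.
set p := fine _ in hn *.
have p0 : 0 <= p by exact: fine_ge0.
rewrite ltr_pdivlMr// in hn; nra.
Unshelve. all: by end_near. Qed.

End main.

Theorem theorem2 (R : realType) (alpha beta : R)
    (beta_gt0 : 0 < beta) (beta_lt_alpha : beta < alpha) (alpha_lt1 : alpha < 1)
    (m k : nat -> nat)
    (m_round : forall n : nat, rounds_to (alpha * n%:R) (m n))
    (k_round : forall n : nat, rounds_to (beta * n%:R) (k n))
    (d : nat -> measure_display) (T : forall n : nat, measurableType (d n))
    (P : forall n : nat, probability (T n) R)
    (A : forall n : nat, 'I_(m n) * 'I_n -> {RV (P n) >-> R})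
    (A_iid : forall n : nat, iid_std_normal (A n)) :
  let xi (n : nat) (w : T n) : R := xi_lric (k n) (random_mx (A n) w) in
  (lric_lower_bound alpha beta <=
     limn_einf (fun n : nat => 'E_(P n)[xi n] * (Num.sqrt (m n)%:R)^-1%:E))%E
  /\
  (forall xi_lift : R, (xi_lift%:E < lric_lower_bound alpha beta)%E ->
     ((fun n : nat => P n [set w | xi_lift * Num.sqrt (m n)%:R <= xi n w])
        @ \oo --> 1%E)
     /\
     (0 <= xi_lift ->
      (fun n : nat => P n [set w | xi_lift ^+ 2 * (m n)%:R <= xi n w ^+ 2])
        @ \oo --> 1%E)).
Proof.
move=> xi; split; first exact: expectation_liminf.
move=> y hy; have h := prob_large_cvg1 _ _ beta_gt0 beta_lt_alpha alpha_lt1 _ _ m_round k_round _ _ _ _ A_iid _ hy.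
split => // y0; rewrite (_ : (fun n => _) = (fun n => P n [set w | (y * Num.sqrt (m n)%:R <= xi n w)%R]))//.
apply/funext => n; congr (P n _); apply/funext => w; apply/propext.
have -> : y ^+ 2 * (m n)%:R = (y * Num.sqrt (m n)%:R) ^+ 2 by rewrite exprMn sqr_sqrtr.
by rewrite /= ler_pXn2r// nnegrE ?xi_lric_ge0// mulr_ge0// sqrtr_ge0.
Qed.
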